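(* Let $r\ge1$, $d\in\mathbb N$ and $N\in\mathbb N$ with $N\ge r$, and let $\Delta=\Delta(C_r)$ as in the context. Then \begin{align*} \sum_{\substack{a_1,\ldots,a_r\in\mathbb N\\ a_1+\cdots+a_r=N}}\zeta_r(2da_1,\ldots,2da_r) &=\frac{(-1)^r}{2^r}\sum_{J=(j_1,\ldots,j_\nu)\in P_r}\frac{1}{j_1!\cdots j_\nu!}\sum_{(2dk_1,\ldots,2dk_r)\in\mathcal A_r(d,N,J)}\mathcal P_{\Delta_{l+}}\bigl((2dk_1,\ldots,2dk_r),\mathbf 0;\Delta\bigr)\prod_{\rho=1}^r\frac{(2\pi i)^{2dk_\rho}}{(2dk_\rho)!} \end{align*} and this value lies in $\mathbb Q\cdot\pi^{2dN}$.
   Context: Euler–Zagier sum: $\zeta_r(s_1,\ldots,s_r)=\sum_{0<n_1<\cdots<n_r}n_1^{-s_1}\cdots n_r^{-s_r}$. $I_r(d,N)=\{(2da_1,\ldots,2da_r)\in(2d\mathbb N)^r:a_1+\cdots+a_r=N\}$; $P_r=\bigcup_{\nu=1}^r\{(j_1,\ldots,j_\nu)\in\mathbb N^\nu:j_1+\cdots+j_\nu=r\}$; for $J=(j_1,\ldots,j_\nu)\in P_r$, $\mathcal A_r(d,N,J)=\{((2dh_1)^{[j_1]},\ldots,(2dh_\nu)^{[j_\nu]})\in I_r(d,N):h_1<\cdots<h_\nu\}$, where $x^{[j]}$ denotes $j$ consecutive copies of $x$. Type $C_r$: $V=\mathbb R^r$, standard basis $e_i$; $\Delta=\{\pm e_i\pm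 e_j:i<j\}\cup\{\pm2e_i\}$, simple roots $\alpha_i=e_i-e_{i+1}$ ($i<r$), $\alpha_r=2e_r$, $\Delta_+=\{e_i\pm e_j\ (i<j)\}\cup\{2e_i\}$, $\alpha^\vee=2\alpha/\langle\alpha,\alpha\rangle$, $Q^\vee=\bigoplus\mathbb Z\alpha_i^\vee$. $\Delta_{l+}=\{\beta_1,\ldots,\beta_r\}$ with $\beta_i=2e_{r-i+1}$; a tuple $(x_1,\ldots,x_r)$ indexed by $\Delta_{l+}$ attaches $x_i$ to $\beta_i$. Coefficients $\mathcal P_{\Delta^*}$ for $\Delta^*\subset\Delta_+$: $\mathscr V$ = subsets $\mathbf V\subset\Delta_+$ forming bases of $V$; $\{\mu^{\mathbf V}_\beta\}$ dual to $\{\beta^\vee\}_{\beta\in\mathbf V}$; $L(\mathbf V^\vee)=\bigoplus_{\beta\in\mathbf V}\mathbb Z\beta^\vee$; fixed $\phi\in V$ with all $\langle\phi,\mu^{\mathbf V}_\beta\rangle\ne0$; $\{\mathbf y\}_{\mathbf V,\beta}=\{\langle\mathbf y,\mu^{\mathbf V}_\beta\rangle\}$ if $\langle\phi,\mu^{\mathbf V}_\beta\rangle>0$, $=1-\{-\langle\mathbf y,\mu^{\mathbf V}_\beta\rangle\}$ otherwise. With $A=\Delta_+\setminus\Delta^*=\{\nu_1,\ldots,\nu_N\}$, $A_j=\{\nu_1,\ldots,\nu_j\}$, $A_0=\emptyset$, $\mathscr V_A=\{\mathbf V\in\mathscr V:\nu_{j+1}\notin\mathrm{L.h.}[\mathbf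 V\cap A_j],\ 0\le j\le N-1\}$, $$F_{\Delta^*}(\mathbf t_{\Delta^*},\mathbf y;\Delta)=\sum_{\mathbf V\in\mathscr V_A}(-1)^{|A\setminus\mathbf V|}\Bigl(\prod_{\gamma\in\Delta_+\setminus(\mathbf V\cup A)}\frac{t_\gamma}{t_\gamma-\sum_{\beta\in\mathbf V\setminus A}t_\beta\langle\gamma^\vee,\mu^{\mathbf V}_\beta\rangle}\Bigr)\frac{1}{|Q^\vee/L(\mathbf V^\vee)|}\sum_{q\in Q^\vee/L(\mathbf V^\vee)}\prod_{\beta\in\mathbf V\setminus A}\frac{t_\beta e^{t_\beta\{\mathbf y+q\}_{\mathbf V,\beta}}}{e^{t_\beta}-1}=\sum_{\mathbf k}\mathcal P_{\Delta^*}(\mathbf k,\mathbf y;\Delta)\prod_{\alpha\in\Delta^*}\frac{t_\alpha^{k_\alpha}}{k_\alpha!}.$$ (Note the symbol $\nu$ in $J=(j_1,\ldots,j_\nu)$ is the length of $J$.) *)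

(* Defs.v *)
From HB Require Import structures.
From mathcomp Require Import all_boot all_order all_algebra.
From mathcomp Require Import all_classical all_reals all_analysis.
From mathcomp Require Import complex.
From Stdlib Require Import ClassicalEpsilon.
Set Implicit Arguments. Unset Strict Implicit. Unset Printing Implicit Defensive.
Import Order.TTheory GRing.Theory Num.Theory.
Import numFieldNormedType.Exports.
Local Open Scope ring_scope.
Local Open Scope classical_set_scope.

Definition dotv (R : nzRingType) (r : nat) (u v : 'rV[R]_r) : R :=
  \sum_(k < r) u 0 k * v 0 k.

Definition ev (R : nzRingType) (r : nat) (i : 'I_r) : 'rV[R]_r :=
  \row_k (k == i)%:R.

(* Positive roots of C_r.  An index (i,j,b) with i<j denotes
   e_i + e_j (b = true) or e_i - e_j (b = false); (i,i,true) denotes 2e_i.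
   Other triples are not positive roots.                               *)
Definition PR (r : nat) := ('I_r * 'I_r * bool)%type.

Definition posrootb (r : nat) (a : PR r) : bool :=
  let: (i, j, b) := a in (i < j)%N || ((i == j) && b).

Definition Dplus (r : nat) : {set PR r} := [set a | posrootb a].

Definition Dlong (r : nat) : {set PR r} :=
  [set a | let: (i, j, b) := a in (i == j) && b].

Definition rootv (R : nzRingType) (r : nat) (a : PR r) : 'rV[R]_r :=
  let: (i, j, b) := a in ev R i + (if b then 1 else -1) *: ev R j.

Definition corootv (R : fieldType) (r : nat) (al : 'rV[R]_r) : 'rV[R]_r :=
  (2 / dotv al al) *: al.

Definition simplev (R : nzRingType) (r : nat) (i : 'I_r) : 'rV[R]_r :=
  if (i.+1 < r)%N then ev R i - \row_k ((k : nat) == i.+1)%:R else 2%:R *: ev R i.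

Definition Qcheck (R : fieldType) (r : nat) : set 'rV[R]_r :=
  [set v | exists c : 'I_r -> int,
             v = \sum_(i < r) (c i)%:~R *: corootv (simplev R i)].
Arguments Qcheck R r _ : clear implicits.

Definition Lcheck (R : fieldType) (r : nat) (V : {set PR r}) : set 'rV[R]_r :=
  [set v | exists c : PR r -> int,
             v = \sum_(b in V) (c b)%:~R *: corootv (rootv R b)].
Arguments Lcheck R {r} V _.

Definition in_span (R : nzRingType) (r : nat) (S : {set PR r}) (v : 'rV[R]_r) : Prop :=
  exists c : PR r -> R, v = \sum_(b in S) c b *: rootv R b.

Definition lin_indep (R : nzRingType) (r : nat) (S : {set PR r}) : Prop :=
  forall c : PR r -> R, \sum_(b in S) c b *: rootv R b = 0 ->
    forall b, b \in S -> c b = 0.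

Definition Bases (R : nzRingType) (r : nat) : set {set PR r} :=
  [set V : {set PR r} | V \subset Dplus r /\ lin_indep R V /\ forall v : 'rV[R]_r, in_span V v].
Arguments Bases R r _ : clear implicits.

Definition mu (R : realType) (r : nat) (V : {set PR r}) (b : PR r) : 'rV[R]_r :=
  xget 0 [set m | forall b', b' \in V ->
                    dotv (corootv (rootv R b')) m = (b' == b)%:R].

Definition frac (R : realType) (x : R) : R := x - (Num.floor x)%:~R.

Definition brk (R : realType) (r : nat) (phi : 'rV[R]_r) (V : {set PR r})
    (b : PR r) (y : 'rV[R]_r) : R :=
  if 0 < dotv phi (mu R V b) then frac (dotv y (mu R V b))
  else 1 - frac (- dotv y (mu R V b)).

(* A system of representatives of Q^vee / L(V^vee): the points of Q^vee in
   the half-open fundamental parallelepiped of L(V^vee).                *)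
Definition Reps (R : realType) (r : nat) (V : {set PR r}) : set 'rV[R]_r :=
  [set q | Qcheck R r q /\ forall b, b \in V -> 0 <= dotv q (mu R V b) < 1].
Arguments Reps R {r} V _.

(* scr V_A, for A = Delta_+ \ Dstar enumerated as nu = (nu_1, ..., nu_N) *)
Definition VA (R : realType) (r : nat) (nu : seq (PR r)) : set {set PR r} :=
  [set V : {set PR r} | Bases R r V /\
     forall j : 'I_(size nu),
       ~ in_span (V :&: [set x in take j nu]) (rootv R (tnth (in_tuple nu) j))].
Arguments VA R {r} nu _.

(* The generating function F_{Dstar}(t, y; Delta);  A = Delta_+ \ Dstar,
   nu an enumeration of A.  Only the values of t on Dstar are used.     *)
Definition Fgen (R : realType) (r : nat) (Dstar : {set PR r}) (nu : seq (PR r))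
    (phi : 'rV[R]_r) (t : PR r -> R) (y : 'rV[R]_r) : R :=
  let A := Dplus r :\: Dstar in
  \sum_(V \in VA R nu)
    ((-1) ^+ #|A :\: V| *
     (\prod_(g in Dplus r :\: (V :|: A))
        (t g / (t g - \sum_(b in V :\: A)
                         t b * dotv (corootv (rootv R g)) (mu R V b)))) *
     ((\sum_(q \in Reps R V) (1 : R))^-1 *
      \sum_(q \in Reps R V)
        \prod_(b in V :\: A)
          (t b * expR (t b * brk phi V b (y + q)) / (expR (t b) - 1)))).

(* points t where every term of Fgen is defined *)
Definition Freg (R : realType) (r : nat) (Dstar : {set PR r}) (nu : seq (PR r))
    (t : PR r -> R) : Prop :=
  let A := Dplus r :\: Dstar in
  (forall a, a \in Dstar -> t a != 0) /\
  forall V, VA R nu V -> forall g, g \in Dplus r :\: (V :|: A) ->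
    t g - \sum_(b in V :\: A) t b * dotv (corootv (rootv R g)) (mu R V b) != 0.

(* Specialisation Dstar = Delta_{l+}: variables t_i attached to 2e_i.   *)
Definition tlong (R : realType) (r : nat) (t : 'I_r -> R) : PR r -> R :=
  fun a => let: (i, _, _) := a in t i.

Definition coef_term (R : realType) (r : nat) (c : ('I_r -> nat) -> R)
    (k : 'I_r -> nat) (t : 'I_r -> R) : R :=
  c k * \prod_(i < r) (t i ^+ k i / (k i)`!%:R).

(* c is the family of coefficients of the Taylor expansion
     F_{Delta_{l+}}(t, 0; Delta) = sum_k c(k) prod_i t_i^{k_i}/k_i!
   (absolutely convergent on a neighbourhood of 0, equality wherever F is
   defined there).  k i is the exponent of the variable of the root 2e_i. *)
Definition IsCoefLong (R : realType) (r : nat) (nu : seq (PR r))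
    (phi : 'rV[R]_r) (c : ('I_r -> nat) -> R) : Prop :=
  exists2 delta : R, 0 < delta &
    forall t : 'I_r -> R, (forall i, `|t i| < delta) ->
      Freg (Dlong r) nu (tlong t) ->
      (exists B : R, forall M : nat,
         \sum_(k : {ffun 'I_r -> 'I_M}) `|coef_term c (fun i => (k i : nat)) t| <= B)
      /\ (fun M : nat => \sum_(k : {ffun 'I_r -> 'I_M})
                           coef_term c (fun i => (k i : nat)) t)
           @ \oo --> Fgen (Dlong r) nu phi (tlong t) 0.

(* P_{Delta_{l+}}(k, 0; Delta) as a function of k indexed by 'I_r (k i is the
   entry attached to 2e_i), defined as the (unique) Taylor coefficient family. *)
Definition Pcoef (R : realType) (r : nat) (nu : seq (PR r)) (phi : 'rV[R]_r) :
    ('I_r -> nat) -> R :=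
  epsilon (inhabits (fun _ => 0)) (IsCoefLong nu phi).

(* P_{Delta_{l+}}((x_1,...,x_r), 0; Delta) for a tuple indexed by Delta_{l+}
   in the order beta_rho = 2 e_{r-rho+1}: x_rho is attached to beta_rho,
   i.e. (0-based) the root 2e_i receives x_{r-1-i}. *)
Definition Plong (R : realType) (r : nat) (nu : seq (PR r)) (phi : 'rV[R]_r)
    (x : seq nat) : R :=
  Pcoef nu phi (fun i : 'I_r => nth 0%N x (r - 1 - i)).

Definition EZpartial (R : realType) (s : seq nat) (M : nat) : R :=
  \sum_(n : {ffun 'I_(size s) -> 'I_M.+1} |
          [forall i : 'I_(size s), (0 < n i)%N] &&
          [forall i : 'I_(size s), forall j : 'I_(size s), (i < j)%N ==> (n i < n j)%N])
    \prod_(i < size s) ((n i)%:R ^- (nth 0%N s i)).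

Definition EZ (R : realType) (s : seq nat) : R := limn (EZpartial R s).

(* Index sets.  N (naturals) = positive integers.                      *)
Definition Icomp (r N : nat) : set (seq nat) :=
  [set a | size a = r /\ all (fun x => 0 < x)%N a /\ sumn a = N].

Definition Iset (r d N : nat) : set (seq nat) :=
  [set x | exists a, Icomp r N a /\ x = map (fun ai => 2 * d * ai)%N a].

Definition Pset (r : nat) : set (seq nat) :=
  [set J | (1 <= size J <= r)%N /\ all (fun x => 0 < x)%N J /\ sumn J = r].

Definition Aset (r d N : nat) (J : seq nat) : set (seq nat) :=
  [set x | Iset r d N x /\
     exists h : seq nat, size h = size J /\ sorted ltn h /\
       x = flatten [seq nseq p.1 (2 * d * p.2)%N | p <- zip J h]].

(* Main.v *)
(** Let A be the set of short positive roots.  A basis V in V_A splits as S ∪ T, where S ⊂ A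
    contains no broken circuit for the order nu and T consists of one long root for each
    signed block of the orthogonal complement S^⊥.  Summing over T by Lagrange
    interpolation turns F into a sum over such S of products, over the blocks, of power
    series in x/(e^x - 1); their coefficients are Bernoulli numbers, hence even zeta
    values by the partial fractions of coth.  The Taylor family so found is the only one,
    because along a curve t_i = u^(w_i) with generic weights one monomial dominates.

    For even k the coefficient is thus, up to an explicit factor, the sum over S of
    (-1)^|S| times the product over the blocks of twice a zeta value.  That product is the
    sum of prod |l_i|^(-k_i) over the integer points l of S^⊥ with nonzero coordinates.
    Exchanging the sums, the signs attached to a point l add up to 1 if no short root
    vanishes at l and to 0 otherwise (toggle the last short root vanishing at l), so 2^r
    times the sum of prod n_i^(-k_i) over distinct positive integers n_i remains.  Summed
    over all compositions of N, this is r! times the sum of the Euler-Zagier values; sorting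
    the compositions by their multiplicities J gives the right-hand side. *)

Require Import Defs.
From HB Require Import structures.
From mathcomp Require Import all_boot all_order all_algebra.
From mathcomp Require Import fingroup perm.
From mathcomp Require Import all_classical all_reals all_analysis.
From mathcomp Require Import complex.
From mathcomp Require Import ring lra zify.
From Stdlib Require Import ClassicalEpsilon.
Import Order.TTheory GRing.Theory Num.Theory.
Import numFieldNormedType.Exports.
Set Implicit Arguments. Unset Strict Implicit. Unset Printing Implicit Defensive.
Local Open Scope ring_scope.
Local Open Scope classical_set_scope.

(** * Partial fractions of coth *)

Section Cotangent.
Variable R : realType.
Implicit Types x y z : R.

(** The dual vectors of the long roots of a basis have entries 0, 1 and -1, so they pair integrally
    with the coroot lattice. At y = 0 each bracket is therefore 0 or 1 according to [phi]: the mean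
    over the cosets is a mean of equal terms, and [phi] survives only as a sign attached to each
    variable, which even exponents erase. The terms of F have poles along t_g = t_b and t_g = - t_b
    that cancel only after the sum over T; the Taylor family is constrained at generic points only,
    and its uniqueness has to be drawn from those. The exchange of flats with integer points is
    carried out in finite boxes and the limit is taken afterwards, so no infinite sum is rearranged.
    A flat S whose complement lies in a coordinate hyperplane contributes nothing to either side:
    its coefficient vanishes when all exponents are positive, and its complement has no point with
    nonzero coordinates. A single Euler-Zagier value is not symmetric in its arguments; only the sum
    over all compositions compares with a sum over distinct unordered integers. *)

Lemma ge0_of_derive_ge0 (g dg : R -> R) (b : R) :
  (forall x, is_derive x 1 g (dg x)) -> (forall x, 0 < x < b -> 0 <= dg x) ->
  g 0 = 0 -> forall x, 0 <= x <= b -> 0 <= g x.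
Proof.
move=> gd dg0 g0 x /andP[x0 xb]; rewrite -g0.
apply: (@ger0_derive1_ndecr R g 0 b) => //.
- by move=> y; rewrite in_itv /= => yb; rewrite derive1E (@derive_val _ _ _ _ _ _ _ (gd y)) dg0.
- apply: continuous_subspaceT => y.
  by apply: differentiable_continuous; apply/derivable1_diffP; case: (gd y).
Qed.

Lemma sin_le_id x : 0 <= x <= pi / 2 -> sin x <= x.
Proof.
move=> xb; rewrite -subr_ge0.
apply: (@ge0_of_derive_ge0 (fun y => y - sin y) (fun y => 1 - cos y) (pi / 2)) => //.
by rewrite /= sin0 subr0.
Qed.

Lemma id_cos_le_sin x : 0 <= x <= pi / 2 -> x * cos x <= sin x.
Proof.
move=> xb; rewrite -subr_ge0.
apply: (@ge0_of_derive_ge0 (fun y => sin y - y * cos y) (fun y => y * sin y) (pi / 2)) => //.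
- move=> y; apply: is_derive_eq.
  rewrite /GRing.scale /=; ring.
- move=> y /andP[y0 yb]; rewrite mulr_ge0 ?(ltW y0) ?ltW //; apply: sin_gt0_pihalf; exact/andP.
- by rewrite sin0 mul0r subr0.
Qed.

(** The upper bound is the square of x cos x <= sin x with cos^2 replaced by 1 - sin^2. The squared
    form is the one that fits the denominator of [kappa]. *)
Lemma sqr_sin_bounds x : 0 <= x <= pi / 2 ->
  sin x ^+ 2 <= x ^+ 2 <= sin x ^+ 2 * (1 + x ^+ 2).
Proof.
move=> xb; have /andP[x0 _] := xb.
have s0 : 0 <= sin x.
  apply: sin_ge0_pi; case/andP: xb => -> /le_trans -> //.
  by rewrite ler_pdivrMr // ler_peMr ?pi_ge0 // ler1n.
have c0 : 0 <= cos x.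
  apply: cos_ge0_pihalf; case/andP: xb => _ ->; rewrite andbT.
  by apply: le_trans x0; rewrite oppr_le0 divr_ge0 // pi_ge0.
rewrite lerXn2r ?nnegrE ?sin_le_id //=.
have : (x * cos x) ^+ 2 <= sin x ^+ 2 by rewrite lerXn2r ?nnegrE ?mulr_ge0 ?id_cos_le_sin.
rewrite exprMn cos2sin2; nra.
Qed.

Definition sinh x : R := (expR x - expR (- x)) / 2.
Definition cosh x : R := (expR x + expR (- x)) / 2.

Lemma cosh2_sinh2 x : cosh x ^+ 2 = 1 + sinh x ^+ 2.
Proof. by rewrite /cosh /sinh; have := expRxMexpNx_1 x; set a := expR _; set b := expR _; nra. Qed.

Lemma sinh_double x : sinh (x *+ 2) = 2 * sinh x * cosh x.
Proof. rewrite /cosh /sinh mulr2n opprD !expRD; lra. Qed.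

Lemma cosh_ge1 x : 1 <= cosh x.
Proof.
have c0 : 0 <= cosh x by rewrite divr_ge0 // addr_ge0 // expR_ge0.
by have := cosh2_sinh2 x; nra.
Qed.

Lemma is_derive_sinh x : is_derive x 1 sinh (cosh x).
Proof.
by apply: is_derive_eq; rewrite /GRing.scale /= /cosh; lra.
Qed.

Lemma is_derive_cosh x : is_derive x 1 cosh (sinh x).
Proof.
by apply: is_derive_eq; rewrite /GRing.scale /= /sinh; lra.
Qed.

Lemma sinh0 : sinh 0 = 0. Proof. by rewrite /sinh oppr0 subrr mul0r. Qed.
Lemma cosh0 : cosh 0 = 1. Proof. by rewrite /cosh oppr0 expR0 divff. Qed.

Lemma sinh_ge_id x : 0 <= x -> x <= sinh x.
Proof.
move=> x0; rewrite -subr_ge0.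
apply: (@ge0_of_derive_ge0 (fun y => sinh y - y) (fun y => cosh y - 1) x) => //.
- by move=> y; have := is_derive_sinh y => ?; apply: is_derive_eq.
- by move=> y _; rewrite subr_ge0 cosh_ge1.
- by rewrite sinh0 subr0.
- by rewrite x0 lexx.
Qed.

Lemma sinh_le_cosh x : 0 <= x -> sinh x <= x * cosh x.
Proof.
move=> x0; rewrite -subr_ge0.
apply: (@ge0_of_derive_ge0 (fun y => y * cosh y - sinh y) (fun y => y * sinh y) x) => //.
- move=> y; have ? := is_derive_sinh y; have ? := is_derive_cosh y.
  by apply: is_derive_eq; rewrite /GRing.scale /=; ring.
- move=> y /andP[/ltW y0 _]; rewrite mulr_ge0 // (le_trans y0) // sinh_ge_id //.
- by rewrite sinh0 mul0r subr0.
- by rewrite x0 lexx.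
Qed.

Lemma sinh_gt0 x : 0 < x -> 0 < sinh x.
Proof. by move=> x0; apply: lt_le_trans (sinh_ge_id (ltW x0)). Qed.

(* [kappa y 0] is coth y, and iterating the duplication formula below writes it as an average of
   values of [kappa (y / 2 ^ n)], each close to a partial fraction. *)
Definition kappa y z : R := sinh y * cosh y / (sinh y ^+ 2 + sin z ^+ 2).

(** With c^2 = 1 + s^2 and u^2 + v^2 = 1, the two denominators s^2 + u^2 and s^2 + v^2 multiply to a
    quarter of (2sc)^2 + (2uv)^2, the denominator at the doubled arguments. *)
Lemma kappa_double y z : 0 < y ->
  kappa y z + kappa y (z + pi / 2) = 2 * kappa (y *+ 2) (z *+ 2).
Proof.
move=> y0; rewrite /kappa sinDpihalf sin_mulr2n sinh_double.
have s0 := sinh_gt0 y0; have c1 := cosh_ge1 y.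
have -> : cosh (y *+ 2) = 1 + 2 * sinh y ^+ 2.
  have := expRxMexpNx_1 y.
  rewrite /cosh /sinh mulr2n opprD !expRD.
  by set a := expR _; set b := expR _ => h; field: h.
have hc := cosh2_sinh2 y; have ht := cos2sin2 z.
move: s0 c1 hc ht; set s := sinh y; set c := cosh y; set u := sin z; set v := cos z.
move=> s0 c1 hc ht.
have d1 : s ^+ 2 + u ^+ 2 != 0 by rewrite gt_eqF // ltr_pwDl ?sqr_ge0 // exprn_gt0.
have d2 : s ^+ 2 + v ^+ 2 != 0 by rewrite gt_eqF // ltr_pwDl ?sqr_ge0 // exprn_gt0.
have e : (2 * s * c) ^+ 2 + ((v * u) *+ 2) ^+ 2 = 4 * ((s ^+ 2 + u ^+ 2) * (s ^+ 2 + v ^+ 2)).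
  by ring: hc ht.
rewrite e; field: ht => //.
by rewrite d2 d1.
Qed.

(** The nodes k and k + 2 ^ n differ by pi / 2, so the duplication formula merges them and halves
    the number of nodes. *)
Lemma sum_kappa_double n y z : 0 < y ->
  \sum_(0 <= k < 2 ^ n) kappa y (z + pi * k%:R / (2 ^ n)%:R)
    = (2 ^ n)%:R * kappa (y *+ 2 ^ n) (z *+ 2 ^ n).
Proof.
elim: n y z => [|n IH] y z y0.
  by rewrite expn0 big_nat1 !mulr1n mulr0 mul0r addr0 mul1r.
have e : (2 ^ n.+1 = 2 ^ n + 2 ^ n)%N by rewrite expnS mul2n addnn.
have N0 : (2 ^ n)%:R != 0 :> R by rewrite pnatr_eq0 expn_eq0.
have eR : (2 ^ n.+1)%:R = 2 * (2 ^ n)%:R :> R by rewrite expnS natrM.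
rewrite (@big_cat_nat _ _ _ (2 ^ n)%N) //=; last by rewrite e leq_addr.
rewrite -{2}[(2 ^ n)%N]add0n big_addn {2}e addnK -big_split /=.
under eq_bigr => k _.
  have -> : z + pi * (k + 2 ^ n)%:R / (2 ^ n.+1)%:R = z + pi * k%:R / (2 ^ n.+1)%:R + pi / 2.
    by rewrite eR natrD; move: N0; set a := (2 ^ n)%:R => N0; field.
  rewrite kappa_double //.
  have -> : (z + pi * k%:R / (2 ^ n.+1)%:R) *+ 2 = z *+ 2 + pi * k%:R / (2 ^ n)%:R.
    by rewrite eR; move: N0; set a := (2 ^ n)%:R => N0; field.
  over.
rewrite -mulr_sumr IH ?mulrn_wgt0 // -!mulrnA -expnS e natrD; ring.
Qed.

(** Partial sum of 1/x + 2 sum x / (x^2 + pi^2 k^2), with the two end terms counted once and the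
    others twice: the shape left when a sum over 2H nodes, symmetric under k -> 2H - k, is
    folded. *)
Definition coth_trapezoid (x : R) (H : nat) : R :=
  \sum_(0 <= k < H) x / (x ^+ 2 + (pi * k%:R) ^+ 2)
  + \sum_(1 <= k < H.+1) x / (x ^+ 2 + (pi * k%:R) ^+ 2).

(** The errors are harmless for y = x / 2 ^ n.+1: the factor [cosh y ^+ 2] tends to 1, and the
    additive term, averaged over the nodes, still tends to 0. *)
Lemma kappa_bounds y z : 0 < y -> 0 <= z <= pi / 2 ->
  y / (y ^+ 2 + z ^+ 2) <= kappa y z <= cosh y ^+ 2 * (y / (y ^+ 2 + z ^+ 2)) + sinh y * cosh y.
Proof.
move=> y0 /sqr_sin_bounds /andP[sz zs].
have := sinh_ge_id (ltW y0); have := sinh_le_cosh (ltW y0); have := cosh_ge1 y.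
rewrite /kappa; set s := sinh y; set c := cosh y; move: sz zs; set u := sin z ^+ 2.
have u0 : 0 <= u by rewrite sqr_ge0.
have := sqr_ge0 z; set w := z ^+ 2 => w0 uw wu c1 sy ys.
have d1 : 0 < y ^+ 2 + w by rewrite ltr_pwDl // exprn_gt0.
have d2 : 0 < s ^+ 2 + u by rewrite ltr_pwDl // exprn_gt0 // (lt_le_trans y0).
have s0 : 0 < s by apply: lt_le_trans ys.
clearbody s c u w.
apply/andP; split.
  rewrite ler_pdivrMr // mulrAC ler_pdivlMr //.
  have h1 : s * y * s <= s * y * (y * c) by rewrite ler_wpM2l // mulr_ge0 // ltW.
  have h2 : y * w <= s * c * w by rewrite ler_wpM2r //; nra.
  have h3 : y * u <= y * w by rewrite ler_wpM2l // ltW.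
  rewrite !mulrDr; move: h1 h2 h3; rewrite !expr2 !mulrA; lra.
have h4 : y ^+ 2 + w <= (1 + (y ^+ 2 + w)) * (s ^+ 2 + u).
  have : y ^+ 2 <= s ^+ 2 by rewrite lerXn2r // nnegrE ltW.
  have := mulr_ge0 (ltW d1) (sqr_ge0 s); have := mulr_ge0 (sqr_ge0 y) u0.
  rewrite !mulrDr !mulrDl; lra.
have h5 : c * s <= c * (y * c) by rewrite ler_wpM2l // (le_trans _ c1).
rewrite ler_pdivrMr // mulrA -(ler_pM2r d1).
have -> : (c ^+ 2 * y / (y ^+ 2 + w) + s * c) * (s ^+ 2 + u) * (y ^+ 2 + w)
   = (c ^+ 2 * y + s * c * (y ^+ 2 + w)) * (s ^+ 2 + u).
  by field; rewrite gt_eqF.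
apply: (@le_trans _ _ (s * c * ((1 + (y ^+ 2 + w)) * (s ^+ 2 + u)))).
  by rewrite ler_wpM2l // mulr_ge0 // ltW // (lt_le_trans _ c1).
rewrite mulrA ler_wpM2r ?(ltW d2) //; move: h5; rewrite !expr2; lra.
Qed.

(** coth x is the mean of [kappa y] over 2 ^ n.+1 equidistant nodes. Those beyond pi / 2 are
    reflected by sin (pi - z) = sin z, so that [kappa_bounds] applies to every node. *)
Lemma coth_sandwich n x (y := x / (2 ^ n.+1)%:R) : 0 < x ->
  coth_trapezoid x (2 ^ n) <= cosh x / sinh x
    <= cosh y ^+ 2 * coth_trapezoid x (2 ^ n) + sinh y * cosh y.
Proof.
move=> x0; set H := (2 ^ n)%N; set N : R := (2 ^ n.+1)%:R.
have N0 : 0 < N by rewrite ltr0n expn_gt0.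
have y0 : 0 < y by rewrite divr_gt0.
have NH : N = 2 * H%:R by rewrite /N expnS natrM.
pose z k : R := pi * k%:R / N.
have zb k : (k <= H)%N -> 0 <= z k <= pi / 2.
  move=> kH; apply/andP; split.
    by rewrite /z divr_ge0 ?(ltW N0) // mulr_ge0 // pi_ge0.
  rewrite /z NH invfM mulrACA ler_piMr ?divr_ge0 ?pi_ge0 //.
  by rewrite ler_pdivrMr ?mul1r ?ler_nat // ltr0n expn_gt0.
pose K k := kappa y (z k).
have hc : cosh x / sinh x = (\sum_(0 <= k < H) K k + \sum_(1 <= k < H.+1) K k) / N.
  have -> : cosh x / sinh x = kappa (y *+ 2 ^ n.+1) (0 *+ 2 ^ n.+1).
    rewrite mul0rn -mulr_natr /y divfK ?gt_eqF // /kappa sin0 expr0n addr0.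
    by have := sinh_gt0 x0 => ?; field; rewrite gt_eqF.
  apply: (mulfI (lt0r_neq0 N0)); rewrite -sum_kappa_double // mulrCA divff ?gt_eqF // mulr1.
  have e : (2 ^ n.+1 = H + H)%N by rewrite expnS mul2n addnn.
  rewrite (@big_cat_nat _ _ _ H) //=; last by rewrite e leq_addr.
  congr (_ + _); first by apply: eq_bigr => k _; rewrite add0r.
  rewrite -{1}[H]add0n big_addn {1}e addnK big_add1 /= big_nat_rev /=.
  rewrite !big_nat; apply: eq_bigr => k /andP[_ kH].
  rewrite /K /kappa add0r; congr (_ / (_ + _ ^+ 2)).
  have -> : pi * (0 + H - k.+1 + H)%:R / (2 ^ n.+1)%:R = pi - z k.+1.
    rewrite -/N /z add0n natrD natrB //.
    have h0 : H%:R != 0 :> R by rewrite pnatr_eq0 expn_eq0.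
    by rewrite NH; move: h0; set h := H%:R => h0; field.
  by rewrite sinB sinpi cospi mul0r sub0r mulN1r opprK.
pose t k : R := x / (x ^+ 2 + (pi * k%:R) ^+ 2).
have te k : t k = y / (y ^+ 2 + z k ^+ 2) / N.
  have dn : 0 < x ^+ 2 + (pi * k%:R) ^+ 2 by rewrite ltr_pwDl ?sqr_ge0 // exprn_gt0.
  rewrite /t /z /y -/N; move: dn; set p := pi * k%:R; clearbody p => dn.
  by field; rewrite !gt_eqF.
have lo k : (k <= H)%N -> t k <= K k / N.
  move=> /zb zk; rewrite te ler_wpM2r ?invr_ge0 ?(ltW N0) //.
  by have /andP[] := kappa_bounds y0 zk.
have hi k : (k <= H)%N -> K k / N <= cosh y ^+ 2 * t k + sinh y * cosh y / N.
  move=> /zb zk; rewrite te mulrA -mulrDl ler_wpM2r ?invr_ge0 ?(ltW N0) //.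
  by have /andP[] := kappa_bounds y0 zk.
rewrite hc /coth_trapezoid -/(t _); apply/andP; split.
  rewrite mulrDl !mulr_suml lerD // !big_nat; apply: ler_sum => k /andP[_ kH]; by apply: lo; lia.
rewrite mulrDl !mulr_suml.
have h1 : \sum_(0 <= k < H) K k / N <= \sum_(0 <= k < H) (cosh y ^+ 2 * t k + sinh y * cosh y / N).
  by rewrite !big_nat; apply: ler_sum => k /andP[_ kH]; by apply: hi; lia.
have h2 : \sum_(1 <= k < H.+1) K k / N <= \sum_(1 <= k < H.+1) (cosh y ^+ 2 * t k + sinh y * cosh y / N).
  by rewrite !big_nat; apply: ler_sum => k /andP[_ kH]; by apply: hi; lia.
apply: le_trans (lerD h1 h2) _.
rewrite !big_split /= !sumr_const_nat subn0 subSS subn0 -!mulr_sumr.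
rewrite addrACA -mulrDr lerD2l -mulrnDr addnn -mul2n -expnS -mulr_natr -/N divfK ?gt_eqF //.
Qed.
End Cotangent.

(** * Bernoulli numbers and even zeta values *)

Section BernoulliSeries.
Variable R : realType.
Implicit Types x : R.

Definition zeta_partial (m K : nat) : R := \sum_(1 <= k < K.+1) (k%:R ^+ m)^-1.
Definition zeta (m : nat) : R := limn (zeta_partial m).

Lemma zeta_partial_nd m : nondecreasing_seq (zeta_partial m).
Proof.
apply/nondecreasing_seqP => K; rewrite /zeta_partial [leRHS]big_nat_recr //=.
by rewrite lerDl invr_ge0 exprn_ge0.
Qed.

(** Telescoping: 1/(K+2)^2 is at most 1/(K+1) - 1/(K+2), which is why the induction carries the
    stronger bound 2 - 1/(K+1). *)
Lemma zeta_partial_le2 m K : (2 <= m)%N -> zeta_partial m K <= 2.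
Proof.
move=> m2; suff H : zeta_partial m K.+1 <= 2 - (K.+1%:R)^-1.
  apply: le_trans (zeta_partial_nd m (leqnSn K)) _.
  by apply: le_trans H _; rewrite gerBl invr_ge0.
elim: K => [|K IH].
  by rewrite /zeta_partial big_nat1 expr1n invr1; lra.
rewrite /zeta_partial big_nat_recr //= -/(zeta_partial _ _).
have k0 : 0 < K.+1%:R :> R by rewrite ltr0n.
have k1 : 0 < K.+2%:R :> R by rewrite ltr0n.
have h : (K.+2%:R ^+ m)^-1 <= K.+1%:R^-1 - K.+2%:R^-1 :> R.
  apply: (@le_trans _ _ (K.+2%:R ^+ 2)^-1).
    by rewrite lef_pV2 ?posrE ?exprn_gt0 // ler_weXn2l // ler1n.
  have -> : K.+1%:R^-1 - K.+2%:R^-1 = (K.+1%:R * K.+2%:R)^-1 :> R.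
    move: k0 k1; rewrite -[K.+2%:R]natr1; set a := K.+1%:R => k0 k1.
    by field; rewrite !gt_eqF.
  by rewrite lef_pV2 ?posrE ?mulr_gt0 ?exprn_gt0 // expr2 ler_wpM2r ?ler_nat // ltW.
by apply: le_trans (lerD IH h) _; rewrite addrA subrK.
Qed.

Lemma zeta_cvg m : (2 <= m)%N -> zeta_partial m @ \oo --> zeta m.
Proof.
move=> m2; apply: nondecreasing_is_cvgn; first exact: zeta_partial_nd.
by exists 2 => _ [K _ <-]; exact: zeta_partial_le2.
Qed.

Lemma zeta_bounds m : (2 <= m)%N -> 0 <= zeta m <= 2.
Proof.
move=> m2; have zc := zeta_cvg m2; apply/andP; split.
  apply: cvgr_to_ge zc _; apply: nearW => K; apply: sumr_ge0 => k _.
  by rewrite invr_ge0 exprn_ge0.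
by apply: cvgr_to_le zc _; apply: nearW => K; exact: zeta_partial_le2.
Qed.

Lemma geometric_alternating (q : R) M : 0 <= q ->
  `|q / (1 + q) - \sum_(0 <= n < M) (-1) ^+ n * q ^+ n.+1| <= q ^+ M.+1.
Proof.
move=> q0; have q1 : 0 < 1 + q by rewrite ltr_pwDl.
have -> : q / (1 + q) - \sum_(0 <= n < M) (-1) ^+ n * q ^+ n.+1
    = (-1) ^+ M * q ^+ M.+1 / (1 + q).
  elim: M => [|M IH]; first by rewrite big_geq // subr0 mul1r expr1.
  rewrite big_nat_recr //= opprD addrA IH !exprS; move: (_ ^+ M) (_ ^+ M) => a b.
  by field; rewrite gt_eqF.
rewrite !normrM normrX normrN1 expr1n mul1r ger0_norm ?exprn_ge0 //.
rewrite ger0_norm ?invr_ge0 ?(ltW q1) // ler_piMr ?exprn_ge0 //.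
by rewrite invf_le1 // lerDl.
Qed.

(** Each partial fraction is q/(1+q) with q = (x / (pi k))^2; expanding it geometrically and summing
    over k pairs the powers of x / pi with partial zeta sums. The error 1/H accounts for the last
    node, counted once only. *)
Lemma coth_trapezoid_expansion x M H : 0 < x -> x <= 1 -> (0 < H)%N ->
  `|x * coth_trapezoid x H
      - (1 + \sum_(0 <= n < M) (-1) ^+ n * (2 * zeta_partial (n.+1).*2 H) * (x / pi) ^+ (n.+1).*2)|
    <= 4 * (x / pi) ^+ (M.+1).*2 + H%:R^-1.
Proof.
move=> x0 x1 H0; have p0 := pi_gt0 R.
have xp0 : 0 <= x / pi by rewrite divr_ge0 ?ltW.
pose q k : R := (x / (pi * k%:R)) ^+ 2.
have qk k : (0 < k)%N -> x * (x / (x ^+ 2 + (pi * k%:R) ^+ 2)) = q k / (1 + q k).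
  move=> k0; have : 0 < pi * k%:R :> R by rewrite mulr_gt0 ?ltr0n.
  rewrite /q; set c := pi * k%:R; clearbody c => c0; field.
  by rewrite !gt_eqF ?ltr_pwDl ?sqr_ge0 ?exprn_gt0.
have qX k n : q k ^+ n = (x / pi) ^+ n.*2 * (k%:R ^+ n.*2)^-1.
  by rewrite /q -exprM mul2n invfM mulrA exprMn exprVn.
have q0 k : 0 <= q k by rewrite sqr_ge0.
have -> : x * coth_trapezoid x H =
    1 + 2 * (\sum_(1 <= k < H.+1) q k / (1 + q k)) - q H / (1 + q H).
  have hS : x * (\sum_(1 <= k < H.+1) x / (x ^+ 2 + (pi * k%:R) ^+ 2)) =
       \sum_(1 <= k < H.+1) q k / (1 + q k).
    by rewrite mulr_sumr !big_nat; apply: eq_bigr => k /andP[k0 _]; exact: qk.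
  have hx : x * (x / x ^+ 2) = 1 by field; rewrite gt_eqF.
  rewrite /coth_trapezoid big_ltn // mulr0 expr0n addr0.
  have -> (F : nat -> R) : \sum_(1 <= k < H) F k = \sum_(1 <= k < H.+1) F k - F H.
    by rewrite big_nat_recr //= addrK.
  rewrite !mulrDr mulrN hS qk // hx; ring.
have -> : \sum_(0 <= n < M) (-1) ^+ n * (2 * zeta_partial (n.+1).*2 H) * (x / pi) ^+ (n.+1).*2
   = 2 * \sum_(1 <= k < H.+1) \sum_(0 <= n < M) (-1) ^+ n * q k ^+ n.+1.
  rewrite exchange_big /= mulr_sumr; apply: eq_bigr => n _.
  rewrite -mulr_sumr; under [in RHS]eq_bigr do rewrite qX.
  rewrite -mulr_sumr /zeta_partial; ring.
have -> (a b c : R) : 1 + 2 * a - b - (1 + 2 * c) = 2 * (a - c) - b by ring.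
rewrite -sumrB; apply: le_trans (ler_normB _ _) _; apply: lerD.
  rewrite normrM ger0_norm //.
  have -> : 4 * (x / pi) ^+ (M.+1).*2 = 2 * ((x / pi) ^+ (M.+1).*2 * 2) by ring.
  rewrite ler_wpM2l //; apply: le_trans (ler_norm_sum _ _ _) _.
  apply: (@le_trans _ _ (\sum_(1 <= k < H.+1) q k ^+ M.+1)).
    by apply: ler_sum => k _; exact: geometric_alternating.
  under eq_bigr do rewrite qX.
  by rewrite -mulr_sumr ler_wpM2l ?exprn_ge0 // zeta_partial_le2 // doubleS.
have h0 : 0 < H%:R :> R by rewrite ltr0n.
have qH1 : 0 < 1 + q H by rewrite ltr_pwDl.
rewrite ger0_norm ?divr_ge0 ?(ltW qH1) //.
apply: (@le_trans _ _ (q H)); first by rewrite ler_piMr // invf_le1 // lerDl.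
rewrite /q invfM mulrA exprMn -[leRHS]mul1r; apply: ler_pM; rewrite ?sqr_ge0 //.
  rewrite expr_le1 // ler_pdivrMr // mul1r (le_trans x1) // (le_trans _ (pi_ge2 R)) //.
  by rewrite ler1n.
by rewrite expr2 ler_piMr ?invr_ge0 ?(ltW h0) ?invf_le1 ?ler1n.
Qed.

Lemma coth_trapezoid_cvg x : 0 < x ->
  (fun n => coth_trapezoid x (2 ^ n)) @ \oo --> cosh x / sinh x.
Proof.
move=> x0; pose y n : R := x / (2 ^ n.+1)%:R.
have sx := sinh_gt0 x0; have c1 := cosh_ge1 x.
set c := cosh x / sinh x.
have y0 : y @ \oo --> (0 : R).
  have : (fun n => x * (2^-1) ^+ n.+1) @ \oo --> x * (0 : R).
    apply: cvgMr; have := @cvg_expr R (2^-1).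
    rewrite ger0_norm ?invr_ge0 // invf_lt1 // ltr1n => /(_ isT).
    by rewrite -(cvg_shiftS (fun n => (2^-1 : R) ^+ n)).
  rewrite mulr0; apply: cvg_trans; apply: near_eq_cvg; apply: nearW => n.
  by rewrite /y natrX exprVn.
have cosh_cont : cosh (y n) @[n --> \oo] --> (1 : R).
  rewrite -[X in _ --> X](cosh0 R).
  apply: (cvg_comp _ _ y0).
  by apply: differentiable_continuous; apply/derivable1_diffP; case: (is_derive_cosh (0 : R)).
have sinh_cont : sinh (y n) @[n --> \oo] --> (0 : R).
  rewrite -[X in _ --> X](sinh0 R).
  apply: (cvg_comp _ _ y0).
  by apply: differentiable_continuous; apply/derivable1_diffP; case: (is_derive_sinh (0 : R)).
pose low n : R := (c - sinh (y n) * cosh (y n)) / cosh (y n) ^+ 2.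
apply: (squeeze_cvgr (f := low) (h := fun=> c)).
- apply: nearW => n; have /andP[h1 h2] := coth_sandwich n x0; rewrite h1 andbT /low.
  have cn : 0 < cosh (y n) ^+ 2 by rewrite exprn_gt0 // (lt_le_trans _ (cosh_ge1 _)).
  by rewrite ler_pdivrMr // lerBlDr mulrC.
- have -> : c = (c - 0 * 1) / 1 ^+ 2 by rewrite mul0r subr0 expr1n divr1.
  apply: cvgM; first by apply: cvgB; [exact: cvg_cst|exact: cvgM].
  by apply: cvgV; [rewrite expr1n oner_eq0|exact: (cvgM cosh_cont cosh_cont)].
- exact: cvg_cst.
Qed.

(** This is B_n / n!, with B_1 = -1/2, defined through Euler's formula for the even zeta values.
    That these numbers are the Taylor coefficients of x / (e^x - 1), and that they are rational, is
    proved below. *)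
Definition bern (n : nat) : R :=
  if n == 0%N then 1 else if n == 1%N then - 2^-1 else
  if odd n then 0 else - ((-1) ^+ n./2 * (2 * zeta n) / (2 * pi) ^+ n).

Lemma coth_expansion x M : 0 < x -> x <= 1 ->
  `|x * (cosh x / sinh x) - \sum_(0 <= n < M.+1) bern n.*2 * (2 * x) ^+ n.*2|
    <= 4 * (x / pi) ^+ (M.+1).*2.
Proof.
move=> x0 x1.
have e : \sum_(0 <= n < M.+1) bern n.*2 * (2 * x) ^+ n.*2 =
   1 + \sum_(0 <= n < M) (-1) ^+ n * (2 * zeta (n.+1).*2) * (x / pi) ^+ (n.+1).*2.
  rewrite big_nat_recl //= mulr1; congr (_ + _); apply: eq_bigr => n _.
  rewrite /bern doubleS /= odd_double /= doubleK exprS.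
  have p0 := pi_gt0 R.
  rewrite !exprMn exprVn; move: (_ ^+ n) => e; field.
  by rewrite !expf_neq0 // gt_eqF.
rewrite e.
pose u n : R := x * coth_trapezoid x (2 ^ n)
      - (1 + \sum_(0 <= m < M) (-1) ^+ m * (2 * zeta_partial (m.+1).*2 (2 ^ n)) * (x / pi) ^+ (m.+1).*2).
have p2 : (fun n => 2 ^ n)%N @ \oo --> \oo.
  apply/cvgnyPge => A; exists A => // n /= An.
  exact: leq_trans An (ltnW (ltn_expl n (ltnSn 1))).
have zc m : zeta_partial (m.+1).*2 (2 ^ n) @[n --> \oo] --> zeta (m.+1).*2.
  by apply: (cvg_comp _ _ p2); apply: zeta_cvg; rewrite doubleS.
have : `|u n| @[n --> \oo] --> `|x * (cosh x / sinh x) - (1 + \sum_(0 <= n < M) (-1) ^+ n * (2 * zeta (n.+1).*2) * (x / pi) ^+ (n.+1).*2)|.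
  apply: cvg_norm; apply: cvgB; first by apply: cvgMr; exact: coth_trapezoid_cvg.
  apply: cvgD; first exact: cvg_cst.
  apply: (@cvg_big _ _ +%R 0) => [|m _]; first exact: add_continuous.
  by apply: cvgMl; apply: cvgMr; apply: cvgMr.
move=> h; apply: (ler_cvg_to h (_ : 4 * (x / pi) ^+ (M.+1).*2 + (2 ^ n)%:R^-1 @[n --> \oo] --> _)).
  rewrite -[X in _ --> X]addr0; apply: cvgD; first exact: cvg_cst.
  have := @cvg_expr R (2^-1).
  rewrite ger0_norm ?invr_ge0 // invf_lt1 // ltr1n => /(_ isT).
  by apply: cvg_trans; apply: near_eq_cvg; apply: nearW => n; rewrite natrX exprVn.
by apply: nearW => n; apply: coth_trapezoid_expansion; rewrite ?expn_gt0.
Qed.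

Lemma bern_le1 n : `|bern n| <= 1.
Proof.
rewrite /bern; case: eqP => [_|/eqP n0]; first by rewrite normr1.
case: eqP => [_|/eqP n1]; first by rewrite normrN ger0_norm; lra.
case: ifP => _; first by rewrite normr0.
have n2 : (2 <= n)%N by case: n n0 n1 => [|[]].
have /andP[z0 z2] := zeta_bounds n2.
have p4 : 4 <= 2 * pi :> R by have := pi_ge2 R; lra.
have pn : 4 <= (2 * pi : R) ^+ n.
  apply: (@le_trans _ _ ((2 * pi) ^+ 2)); first by rewrite expr2; nra.
  by rewrite ler_weXn2l //; lra.
rewrite normrN !normrM normrX normrN1 expr1n mul1r [`|2|]ger0_norm // (ger0_norm z0).
rewrite normfV ger0_norm; last by lra.
rewrite ler_pdivrMr; lra.
Qed.

Definition todd x : R := x / (expR x - 1).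

Lemma todd_coth x : x != 0 -> todd x = (x / 2) * (cosh (x / 2) / sinh (x / 2)) - x / 2.
Proof.
move=> x0; have e : expR x = expR (x / 2) ^+ 2 by rewrite -expRM_natr divfK.
have a1 : expR (x / 2) ^+ 2 - 1 != 0.
  by rewrite -e subr_eq0 -(expR0 R) (inj_eq (@expR_inj R)).
have a0 : expR (x / 2) != 0 by rewrite gt_eqF // expR_gt0.
rewrite /todd e /cosh /sinh expRN; move: a1 a0; move: (expR _) => a a1 a0.
by field; rewrite a0 /= -expr2 a1.
Qed.

Lemma coshN x : cosh (- x) = cosh x.
Proof. by rewrite /cosh opprK addrC. Qed.

Lemma sinhN x : sinh (- x) = - sinh x.
Proof. by rewrite /sinh opprK -mulNr opprB. Qed.

Lemma sum_bern_even x M :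
  \sum_(0 <= n < M.+1.*2) bern n * x ^+ n = \sum_(0 <= n < M.+1) bern n.*2 * x ^+ n.*2 - x / 2.
Proof.
elim: M => [|M IH].
  by rewrite big_nat_recr //= !big_nat1 /bern /= !expr0 expr1; lra.
rewrite [M.+2.*2]doubleS big_nat_recr //= big_nat_recr //= IH [in RHS]big_nat_recr //=.
have -> : bern M.+1.*2.+1 = 0 by rewrite /bern /= odd_double.
by rewrite mul0r addr0 addrAC.
Qed.

(** Truncations at an even number of terms come from the expansion of coth at |x| / 2. Otherwise one
    term is added, with coefficient at most 1 in absolute value, whence the factor 2. *)
Lemma todd_expansion x N : x != 0 -> `|x| <= 1 ->
  `|todd x - \sum_(0 <= n < N.+2) bern n * x ^+ n| <= 2 * `|x| ^+ N.+1.
Proof.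
move=> x0 x1; have p2 := pi_ge2 R.
have h M : `|todd x - \sum_(0 <= n < M.+1.*2) bern n * x ^+ n| <= `|x| ^+ M.+1.*2.
  have w0 : 0 < `|x| / 2 by rewrite divr_gt0 // normr_gt0.
  have := @coth_expansion (`|x| / 2) M w0 _.
  have -> : `|x| / 2 * (cosh (`|x| / 2) / sinh (`|x| / 2)) = x / 2 * (cosh (x / 2) / sinh (x / 2)).
    have [_|_] := ger0P x; first by [].
    by rewrite mulNr coshN sinhN invrN mulrN mulrNN.
  rewrite sum_bern_even todd_coth // [2 * _]mulrC divfK //.
  have ev n : `|x| ^+ n.*2 = x ^+ n.*2 by rewrite -mul2n !exprM real_normK ?num_real.
  under eq_bigr do rewrite ev.
  have -> (a b c : R) : a - b - (c - b) = a - c by ring.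
  have le1 : `|x| / 2 <= 1 by rewrite ler_pdivrMr //; lra.
  move=> /(_ le1) /le_trans; apply.
  rewrite -mulrA exprMn mulrCA ler_piMr ?exprn_ge0 //.
  set a : R := 2^-1 / pi.
  have a4 : 0 <= a <= 4^-1.
    rewrite /a -invfM invr_ge0 mulr_ge0 ?(le_trans _ p2) //=.
    by rewrite lef_pV2 ?posrE //; lra.
  have : a ^+ M.*2.+1 <= 1 by apply: exprn_ile1; lra.
  have : 0 <= a ^+ M.*2.+1 by rewrite exprn_ge0; lra.
  by move=> b0 b1; rewrite doubleS exprS mulrA; apply: mulr_ile1; lra.
have [M [-> | ->]] : exists M, N = M.*2 \/ N = M.*2.+1.
  by exists N./2; rewrite -{1 3}(odd_double_half N); case: odd; [right|left].
  rewrite -doubleS; apply: le_trans (h M) _; apply: (@le_trans _ _ (`|x| ^+ M.*2.+1)).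
    by rewrite doubleS exprS ler_piMl ?exprn_ge0.
  by rewrite ler_peMl ?exprn_ge0 // ler1n.
rewrite big_nat_recr //= -doubleS opprD addrA.
apply: le_trans (ler_normB _ _) _; rewrite mulr_natl mulr2n lerD ?h //.
by rewrite normrM normrX ler_piMl ?exprn_ge0 // bern_le1.
Qed.

Lemma todd_series x : x != 0 -> `|x| < 1 ->
  \sum_(0 <= n < M) bern n * x ^+ n @[M --> \oo] --> todd x.
Proof.
move=> x0 x1; rewrite -(cvg_shiftn 2).
apply/cvgrPdist_le => e e0.
have : `|x| ^+ n.+1 @[n --> \oo] --> (0 : R).
  have := @cvg_expr R `|x|; rewrite normr_id => /(_ x1).
  by rewrite -(cvg_shiftS (fun n => `|x| ^+ n)).
move=> /cvgrPdist_le /(_ (e / 2)); rewrite divr_gt0 // => /(_ isT).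
apply: filterS => n; rewrite sub0r normrN ger0_norm ?exprn_ge0 // => h.
rewrite /= addn2; apply: le_trans (todd_expansion n x0 (ltW x1)) _; lra.
Qed.

(** As x tends to 0 the bound forces the constant term to vanish; dividing by x then lowers M by
    one. *)
Lemma coef_eq0_of_bigO (P : {poly R}) (C : R) M :
  (forall x, 0 < x < 1 -> `|P.[x]| <= C * x ^+ M) -> forall i, (i < M)%N -> P`_i = 0.
Proof.
elim: M P => [//|M IH]; elim/poly_ind => [|P c _] h i iM; first by rewrite coef0.
have c0 : c = 0.
  apply/eqP; rewrite -normr_eq0; apply/eqP/le_anti; rewrite normr_ge0 andbT.
  apply/ler_addgt0Pl => e e0; rewrite addr0.
  pose B : R := \sum_(j < size P) `|P`_j|.
  have B0 : 0 <= B by apply: sumr_ge0.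
  have PB x : 0 < x < 1 -> `|P.[x]| <= B.
    move=> /andP[x0 x1]; rewrite horner_coef; apply: le_trans (ler_norm_sum _ _ _) _.
    apply: ler_sum => j _; rewrite normrM normrX [`|x|]ger0_norm ?(ltW x0) //.
    by rewrite ler_piMr // exprn_ile1 ?ltW.
  pose D := `|C| + B + 1; have D0 : 0 < D by rewrite ltr_wpDl // addr_ge0.
  pose x := Num.min (2^-1) (e / D).
  have x0 : 0 < x by rewrite lt_min invr_gt0 ltr0n divr_gt0.
  have x1 : x < 1 by rewrite gt_min invf_lt1 ?ltr1n ?ltr0n.
  have xe : x * D <= e by rewrite -ler_pdivlMr // ge_min lexx orbT.
  have xb : 0 < x < 1 by rewrite x0 x1.
  have := h x xb; rewrite hornerMXaddC => hx.
  have -> : c = (P.[x] * x + c) - P.[x] * x by rewrite addrC addKr.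
  apply: le_trans (ler_normB _ _) _; apply: le_trans xe.
  rewrite /D mulrDr mulrDr mulr1 -addrA lerD //.
    apply: le_trans hx _; rewrite exprS mulrCA ler_wpM2l ?(ltW x0) //.
    apply: (@le_trans _ _ (`|C| * x ^+ M)); first by rewrite ler_wpM2r ?ler_norm // exprn_ge0 ?ltW.
    by rewrite ler_piMr // exprn_ile1 ?ltW.
  rewrite normrM [`|x|]ger0_norm ?(ltW x0) // mulrC.
  apply: ler_wpDr; first exact: ltW.
  by rewrite ler_wpM2l ?PB ?(ltW x0).
case: i iM => [|i] iM; rewrite coefD coefC coefMX /= ?c0 ?add0r ?addr0 //.
apply: IH => // x /andP[x0 x1]; have := h x; rewrite x0 x1 => /(_ isT).
rewrite hornerMXaddC c0 addr0 normrM [`|x|]ger0_norm ?(ltW x0) // exprSr mulrA.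
by rewrite ler_pM2r.
Qed.

Lemma expR_expansion x M : 0 < x < 1 ->
  `|expR x - \sum_(0 <= i < M) x ^+ i / i`!%:R| <= expR 1 * x ^+ M.
Proof.
move=> /andP[x0 x1].
have cv : \sum_(0 <= i < n + M) x ^+ i / i`!%:R @[n --> \oo] --> expR x.
  by have := is_cvg_series_exp_coeff x; rewrite -(cvg_shiftn M).
set S := \sum_(0 <= i < M) _.
have cvN : `|\sum_(0 <= i < n + M) x ^+ i / i`!%:R - S| @[n --> \oo] --> `|expR x - S|.
  by apply: cvg_norm; apply: cvgB; [exact: cv|exact: cvg_cst].
apply: (cvgr_to_le cvN); rewrite /S {cvN S}.
apply: nearW => n /=.
have -> : \sum_(0 <= i < n + M) x ^+ i / i`!%:R =
    \sum_(0 <= i < M) x ^+ i / i`!%:R + \sum_(M <= i < n + M) x ^+ i / i`!%:R.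
  by rewrite -big_cat_nat ?leq_addl.
rewrite addrAC subrr add0r ger0_norm; last by apply: sumr_ge0 => i _; rewrite divr_ge0 ?exprn_ge0 ?ltW.
have e1 : \sum_(0 <= i < n + M) i`!%:R^-1 <= expR 1 :> R.
  have nd : nondecreasing_seq (series (exp_coeff (1 : R))).
    apply/nondecreasing_seqP => k; rewrite /series /= [leRHS]big_nat_recr //= lerDl.
    by rewrite divr_ge0 ?exprn_ge0.
  have := nondecreasing_cvgn_le nd (is_cvg_series_exp_coeff 1) (n + M)%N.
  apply: le_trans; rewrite /series /=.
  by apply: ler_sum => i _; rewrite /exp_coeff /= expr1n mul1r.
apply: (@le_trans _ _ (\sum_(M <= i < n + M) x ^+ M * i`!%:R^-1)).
  rewrite !big_nat; apply: ler_sum => i /andP[iM _]; rewrite ler_wpM2r ?invr_ge0 //.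
  by rewrite ler_wiXn2l // ltW.
rewrite -mulr_sumr mulrC ler_wpM2r ?exprn_ge0 ?(ltW x0) //; apply: le_trans e1.
rewrite [leRHS](@big_cat_nat _ _ _ M) //= ?leq_addl // lerDr.
by apply: sumr_ge0 => i _; rewrite invr_ge0.
Qed.

(** Coefficient of x^i in (x / (e^x - 1)) ((e^x - 1) / x) = 1. Both factors are truncated to
    polynomials [P] and [Q]; the error estimates give P Q - 1 = O(x^(i+1)), which determines that
    coefficient. *)
Lemma bern_recurrence i :
  \sum_(j < i.+1) bern j * ((i - j).+1`!)%:R^-1 = (i == 0%N)%:R.
Proof.
pose N := i.+1.
pose P : {poly R} := \poly_(n < N.+2) bern n.
pose Q : {poly R} := \poly_(n < N.+2) (n.+1`!)%:R^-1.
have PQ : (P * Q - 1)`_i = 0.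
  have e0 := expR_gt0 (1 : R).
  apply: (@coef_eq0_of_bigO _ ((N.+2)%:R * expR 1 + 2 * expR 1) N) => // x /andP[x0 x1].
  have Px : P.[x] = \sum_(0 <= n < N.+2) bern n * x ^+ n.
    by rewrite big_mkord horner_poly.
  have hP : `|P.[x]| <= (N.+2)%:R.
    rewrite Px; apply: le_trans (ler_norm_sum _ _ _) _.
    apply: (@le_trans _ _ (\sum_(0 <= n < N.+2) 1)); last by rewrite sumr_const_nat subn0.
    apply: ler_sum => n _; rewrite normrM normrX [`|x|]ger0_norm ?(ltW x0) //.
    apply: mulr_ile1 => //; first exact: exprn_ge0 (ltW x0).
      exact: bern_le1.
    by apply: exprn_ile1; exact: ltW.
  have hQ : `|x * Q.[x] - (expR x - 1)| <= expR 1 * x ^+ N.+3.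
    have := @expR_expansion x N.+3; rewrite x0 x1 => /(_ isT).
    rewrite big_nat_recl // expr0 fact0 divr1 /Q horner_poly mulr_sumr big_mkord.
    have -> : \sum_(i < N.+2) x * ((i.+1)`!%:R^-1 * x ^+ i) = \sum_(i < N.+2) x ^+ i.+1 / (i.+1)`!%:R.
      by apply: eq_bigr => n _; rewrite exprS mulrA mulrAC.
    set S := \sum_(n < _) _ => hS.
    have -> : S - (expR x - 1) = - (expR x - (1 + S)) by ring.
    by rewrite normrN.
  have hT : `|P.[x] - todd x| <= 2 * x ^+ N.+1.
    have := @todd_expansion x N; rewrite Px distrC [`|x|]ger0_norm ?(ltW x0) //.
    by apply; [rewrite gt_eqF|exact: ltW].
  have ex0 : 0 < expR x - 1 by rewrite subr_gt0 expR_gt1.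
  have ex1 : expR x - 1 <= expR 1.
    by rewrite lerBlDr (@le_trans _ _ (expR 1)) ?ler_expR ?(ltW x1) // lerDl.
  rewrite hornerD hornerN hornerM hornerC -(ler_pM2l x0) -{1}[x](ger0_norm (ltW x0)) -normrM.
  have -> : x * (P.[x] * Q.[x] - 1) =
     P.[x] * (x * Q.[x] - (expR x - 1)) + (P.[x] - todd x) * (expR x - 1).
    by rewrite /todd; field; rewrite gt_eqF.
  apply: le_trans (ler_normD _ _) _; rewrite !normrM.
  have -> : x * (((N.+2)%:R * expR 1 + 2 * expR 1) * x ^+ N) =
     (N.+2)%:R * (expR 1 * x ^+ N.+1) + (2 * x ^+ N.+1) * expR 1 by rewrite exprS; ring.
  apply: lerD; apply: ler_pM => //.
    apply: le_trans hQ _; rewrite ler_pM2l //.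
    by apply: ler_wiXn2l; rewrite ?ltW //; lia.
  by rewrite ger0_norm // ltW.
move: PQ => /eqP; rewrite coefB coef1 subr_eq0 => /eqP <-.
rewrite coefM; apply: eq_bigr => j _.
rewrite !coef_poly; have -> : (j < N.+2)%N by rewrite /N; have := ltn_ord j; lia.
by have -> : (i - j < N.+2)%N by rewrite /N; lia.
Qed.

(** In the recurrence [bern n] has coefficient 1, so it is a rational combination of the earlier
    values. Together with the definition of [bern] this makes each even zeta value a rational
    multiple of a power of pi. *)
Lemma bern_rat n : exists q : rat, bern n = ratr q.
Proof.
elim/ltn_ind: n => n IH.
have [f fE] : exists f : nat -> rat, forall j, (j < n)%N -> bern j = ratr (f j).
  have /choice[f fE] : forall j, exists q : rat, (j < n)%N -> bern j = ratr q.
    by move=> j; case: (ltnP j n) => [/IH [q ->]|_]; [exists q|exists 0].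
  by exists f.
exists ((n == 0%N)%:R - \sum_(j < n) f j * ((n - j).+1`!)%:R^-1).
have := bern_recurrence n; rewrite big_ord_recr /= subnn (_ : 1`! = 1)%N // invr1 mulr1 => h.
rewrite rmorphB rmorph_nat -h rmorph_sum [_ + bern n]addrC.
have -> : \sum_(i < n) ratr (f i / ((n - i).+1)`!%:R) =
    \sum_(i < n) bern i / ((n - i).+1)`!%:R :> R.
  by apply: eq_bigr => j _; rewrite fE // rmorphM fmorphV rmorph_nat.
by rewrite addrK.
Qed.

End BernoulliSeries.

(** * Flats spanned by short roots *)

Section Flats.
Variables (R : realType) (r : nat).
Implicit Types (S V : {set PR r}) (l v : 'rV[R]_r) (i j : 'I_r).

Definition short_roots : {set PR r} := Dplus r :\: Dlong r.
Definition long_root i : PR r := (i, i, true).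

Lemma short_rootsE (a : PR r) : (a \in short_roots) = (a.1.1 < a.1.2)%N.
Proof.
case: a => [[i j] b]; rewrite !inE /=.
by case: (eqVneq i j) => [->|_] /=; rewrite ?ltnn ?orbF //; case: b.
Qed.

Lemma Dlong_long_root i : long_root i \in Dlong r.
Proof. by rewrite inE /= eqxx. Qed.

Lemma mem_Dlong (a : PR r) : a \in Dlong r -> a = long_root a.1.1.
Proof. by case: a => [[i j] b]; rewrite inE /= => /andP[/eqP -> ->]. Qed.

Lemma Dlong_sub_Dplus : Dlong r \subset Dplus r.
Proof. by apply/fintype.subsetP => a /mem_Dlong ->; rewrite inE /= eqxx orbT. Qed.

Lemma dotv_suml (I : Type) (s : seq I) (P : pred I) (F : I -> 'rV[R]_r) l :
  dotv (\sum_(x <- s | P x) F x) l = \sum_(x <- s | P x) dotv (F x) l.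
Proof.
rewrite /dotv exchange_big /=; apply: eq_bigr => k _.
by rewrite summxE mulr_suml.
Qed.

Lemma dotvZl (c : R) v l : dotv (c *: v) l = c * dotv v l.
Proof. by rewrite /dotv mulr_sumr; apply: eq_bigr => k _; rewrite mxE mulrA. Qed.

Lemma dotvDl v w l : dotv (v + w) l = dotv v l + dotv w l.
Proof. by rewrite /dotv -big_split; apply: eq_bigr => k _; rewrite mxE mulrDl. Qed.

Lemma dotvBr v l m : dotv v (l - m) = dotv v l - dotv v m.
Proof. by rewrite /dotv -sumrB; apply: eq_bigr => k _; rewrite !mxE mulrBr. Qed.

Lemma dotv_ev i l : dotv (ev R i) l = l 0 i.
Proof.
rewrite /dotv (bigD1 i) //= mxE eqxx mul1r big1 ?addr0 // => k ki.
by rewrite mxE (negPf ki) mul0r.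
Qed.

Lemma dotv_root i j (b : bool) l :
  dotv (rootv R (i, j, b)) l = l 0 i + (if b then 1 else -1) * l 0 j.
Proof. by rewrite /rootv dotvDl dotvZl !dotv_ev. Qed.

Lemma rootv_long i : rootv R (long_root i) = 2 *: ev R i.
Proof. by rewrite /rootv /= scale1r scaler_nat mulr2n. Qed.

Lemma corootv_long i : corootv (rootv R (long_root i)) = ev R i.
Proof.
rewrite rootv_long /corootv dotvZl /dotv (bigD1 i) //= big1; last first.
  by move=> k ki; rewrite !mxE (negPf ki) mul0r.
rewrite !mxE eqxx scalerA -[RHS]scale1r; congr (_ *: _).
by rewrite !mulr1 addr0 mul1r; field.
Qed.

Lemma corootv_short (a : PR r) : a \in short_roots -> corootv (rootv R a) = rootv R a.
Proof.
rewrite short_rootsE; case: a => [[i j] b] /= ij.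
have ji : (j == i) = false by apply/negP => /eqP e; rewrite e ltnn in ij.
rewrite /corootv; suff -> : dotv (rootv R (i, j, b)) (rootv R (i, j, b)) = 2.
  by rewrite divff // scale1r.
rewrite dotv_root !mxE !eqxx [i == j]eq_sym ji /=; case: b; ring.
Qed.

Definition perp S l := forall a, a \in S -> dotv (rootv R a) l = 0.

Lemma perp_span S v l : in_span S v -> perp S l -> dotv v l = 0.
Proof.
move=> [c ->] pl; rewrite dotv_suml big1 // => a aS.
by rewrite dotvZl pl ?mulr0.
Qed.

(** Double orthogonality: the columns of the cokernel of the matrix of roots are orthogonal to [S],
    and a row killed by the cokernel lies in the row space. Spans can thus be handled through
    orthogonal complements alone. *)
Lemma in_span_of_perp S v : (forall l, perp S l -> dotv v l = 0) -> in_span S v.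
Proof.
move=> h; pose M : 'M[R]_(#|S|, r) := \matrix_(k < #|S|) rootv R (enum_val k).
have dotE w l : dotv w l = (w *m l^T) 0 0.
  by rewrite mxE /dotv; apply: eq_bigr => k _; rewrite mxE.
have : (v <= M)%MS.
  rewrite submxE; apply/eqP/rowP => j; rewrite [RHS]mxE.
  pose l : 'rV[R]_r := (col j (cokermx M))^T.
  have -> : (v *m cokermx M) 0 j = dotv v l.
    by rewrite /dotv mxE; apply: eq_bigr => k _; rewrite !mxE.
  apply: h => a aS.
  have -> : dotv (rootv R a) l = (M *m cokermx M) (enum_rank_in aS a) j.
    by rewrite /dotv mxE; apply: eq_bigr => k _; rewrite !mxE enum_rankK_in.
  by rewrite mulmx_coker mxE.
move=> /submxP [D ->]; rewrite mulmx_sum_row.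
have [S0|[x xS]] := set_0Vmem S.
  have c0 : #|S| = 0%N by rewrite S0 cards0.
  exists (fun=> 0); rewrite [RHS]big1 => [|a _]; last by rewrite scale0r.
  by rewrite big1 // => k _; have := ltn_ord k; rewrite [X in (_ < X)%N]c0.
exists (fun a => D 0 (enum_rank_in xS a)).
rewrite (big_enum_rank xS); apply: eq_bigr => a aS.
by rewrite rowK enum_rankK_in.
Qed.

Lemma in_span_mono S1 S2 v : S1 \subset S2 -> in_span S1 v -> in_span S2 v.
Proof.
move=> /fintype.subsetP s12 h; apply: in_span_of_perp => l pl.
by apply: perp_span h _ => a /s12; exact: pl.
Qed.

(* The zero block, the partition of the other coordinates into signed blocks, a
   representative of each block and the sign relative to it, all read off the
   orthogonal complement of [S]. *)
Definition zero_block S : {set 'I_r} := [set i | `[< forall l, perp S l -> l 0 i = 0 >]].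

Definition same_block S i j : bool :=
  `[< forall l, perp S l -> l 0 i = l 0 j >] || `[< forall l, perp S l -> l 0 i = - l 0 j >].

Definition rep S i : 'I_r := odflt i [pick j | same_block S i j].

Definition bsign S i : R :=
  if `[< forall l, perp S l -> l 0 i = l 0 (rep S i) >] then 1 else -1.

Lemma same_block_refl S i : same_block S i i.
Proof. by apply/orP; left; apply/asboolP. Qed.

Lemma same_block_rep S i : same_block S i (rep S i).
Proof.
rewrite /rep; case: pickP => //= /(_ i).
by rewrite same_block_refl.
Qed.

Lemma eq_same_block S i j : same_block S i j -> same_block S i =1 same_block S j.
Proof.
move=> ij k.
have [e [e2 he]] : exists e : R, e * e = 1 /\ forall l, perp S l -> l 0 i = e * l 0 j.
  case/orP: ij => /asboolP h; [exists 1|exists (-1)]; split; try ring; move=> l /h ->; ring.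
have sbP i' : same_block S i' k <-> exists d : R, (d = 1 \/ d = -1) /\ forall l, perp S l -> l 0 i' = d * l 0 k.
  split=> [/orP[]/asboolP h|[d [[] -> h]]]; first (exists 1).
  - by split; [left|move=> l /h ->; rewrite mul1r].
  - by exists (-1); split; [right|move=> l /h ->; rewrite mulN1r].
  - by apply/orP; left; apply/asboolP => l /h; rewrite mul1r.
  - by apply/orP; right; apply/asboolP => l /h; rewrite mulN1r.
have e1 : e = 1 \/ e = -1.
  have : (e - 1) * (e + 1) = 0 by rewrite mulrDr mulr1 mulrBl mul1r e2; ring.
  by move/eqP; rewrite mulf_eq0 subr_eq0 addr_eq0 => /orP[]/eqP; [left|right].
apply/idP/idP => /sbP [d [d1 hd]]; apply/sbP; exists (e * d); split.
- by case: e1 => ->; case: d1 => ->; rewrite ?mul1r ?mulN1r ?opprK; auto.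
- by move=> l pl; rewrite -mulrA -hd // (he l pl) mulrA e2 mul1r.
- by case: e1 => ->; case: d1 => ->; rewrite ?mul1r ?mulN1r ?opprK; auto.
- by move=> l pl; rewrite -mulrA -hd // he.
Qed.

Lemma eq_rep S i j : same_block S i j -> rep S i = rep S j.
Proof.
move=> ij; have e := eq_same_block ij; rewrite /rep (eq_pick e).
by case: pickP => //= /(_ j); rewrite same_block_refl.
Qed.

Lemma rep_idem S i : rep S (rep S i) = rep S i.
Proof. by rewrite -(eq_rep (same_block_rep S i)). Qed.

Lemma bsignE S i l : perp S l -> l 0 i = bsign S i * l 0 (rep S i).
Proof.
move=> pl; rewrite /bsign; case: asboolP => [h|nh]; first by rewrite mul1r h.
have /orP[/asboolP //|/asboolP h] := same_block_rep S i.
by rewrite mulN1r h.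
Qed.

Lemma bsign_sqr S i : bsign S i * bsign S i = 1.
Proof. by rewrite /bsign; case: ifP => _; ring. Qed.

Lemma bsign_neq0 S i : bsign S i != 0.
Proof. by apply/eqP => h; have := bsign_sqr S i; rewrite h mul0r => /eqP; rewrite eq_sym oner_eq0. Qed.

Lemma bsign_rep S i : bsign S (rep S i) = 1.
Proof. by rewrite /bsign rep_idem; case: asboolP. Qed.

Lemma zero_block_rep S i : (rep S i \in zero_block S) = (i \in zero_block S).
Proof.
rewrite !inE; apply/asboolP/asboolP => h l pl.
  by rewrite (bsignE i pl) h ?mulr0.
apply/eqP; have /eqP := h l pl; rewrite (bsignE i pl) mulf_eq0.
by rewrite (negPf (bsign_neq0 S i)).
Qed.

(** For the converse, a root of [S] ties its two coordinates up to sign, hence puts them into one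
    block. Outside the zero block some [m] in the complement has a nonzero coordinate there, and
    this forces the relative block sign to be the one prescribed by the root. *)
Lemma perpE S l : perp S l <->
  (forall i, i \in zero_block S -> l 0 i = 0) /\ (forall i, l 0 i = bsign S i * l 0 (rep S i)).
Proof.
split=> [pl|[h0 h1]].
  by split=> [i|i]; [rewrite inE => /asboolP; apply|exact: bsignE].
move=> [[i j] b] aS; rewrite dotv_root.
set e : R := if b then 1 else -1.
have e2 : e * e = 1 by rewrite /e; case: (b); ring.
have hij m : perp S m -> m 0 i = - e * m 0 j.
  by move=> pm; have := pm _ aS; rewrite dotv_root -/e mulNr => /eqP; rewrite addr_eq0 => /eqP.
have sij : same_block S i j.
  move: hij; rewrite /e; case: (b) => hij; apply/orP; [right|left]; apply/asboolP => m /hij ->.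
    by rewrite mulN1r.
  by rewrite opprK mul1r.
have rij := eq_rep sij.
have [iZ|] := boolP (i \in zero_block S).
  have jZ : j \in zero_block S by rewrite -zero_block_rep -rij zero_block_rep.
  by rewrite !h0 // mulr0 addr0.
rewrite inE => /asboolPn /existsNP [m] /not_implyP [pm] /eqP mi.
have := hij m pm; rewrite (bsignE i pm) (bsignE j pm) -rij mulrA => /eqP.
rewrite -subr_eq0 -mulrBl mulf_eq0 => /orP[/eqP h|/eqP h]; last first.
  by case/negP: mi; rewrite (bsignE i pm) h mulr0.
rewrite (h1 i) (h1 j) -rij mulrA -mulrDl.
have -> : bsign S i + e * bsign S j = 0 by rewrite -h; ring.
by rewrite mul0r.
Qed.

(* The vector [mu V b] dual to a long root [b = 2 e_i] of a basis [V] with short part [S]. *)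
Definition block_vec S i : 'rV[R]_r :=
  \row_j (if (j \notin zero_block S) && (rep S j == rep S i) then bsign S j * bsign S i else 0).

Lemma perp_block_vec S i : perp S (block_vec S i).
Proof.
apply/perpE; split=> [j jZ|j]; first by rewrite mxE jZ.
rewrite !mxE zero_block_rep rep_idem; case: ifP => _; last by rewrite mulr0.
by rewrite bsign_rep mul1r.
Qed.

Lemma block_vec_self S i : i \notin zero_block S -> block_vec S i 0 i = 1.
Proof. by move=> iZ; rewrite mxE iZ eqxx bsign_sqr. Qed.

Definition is_rep S i : bool := (i \notin zero_block S) && (rep S i == i).

Lemma is_rep_rep S i : i \notin zero_block S -> is_rep S (rep S i).
Proof. by move=> iZ; rewrite /is_rep zero_block_rep iZ rep_idem eqxx. Qed.

Lemma lin_indep_notin_span V a : lin_indep R V -> a \in V -> ~ in_span (V :\ a) (rootv R a).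
Proof.
move=> li aV [c hc].
have := li (fun b => if b == a then 1 else - c b).
rewrite (big_setD1 a) //= eqxx scale1r {1}hc -big_split /= big1.
  by move=> /(_ erefl a aV); rewrite eqxx => /eqP; rewrite oner_eq0.
move=> b; rewrite !inE => /andP[/negPf -> _].
by rewrite -scalerDl subrr scale0r.
Qed.

Section Basis.
Variable V : {set PR r}.
Hypothesis bV : Bases R r V.
Let S := V :&: short_roots.

Lemma basis_perp0 l : perp V l -> l = 0.
Proof.
move=> pl; apply/rowP => i; rewrite mxE -dotv_ev.
by apply: perp_span pl; case: bV => _ [_]; apply.
Qed.

Lemma basis_short_or_long a : a \in V -> a \in S \/ a = long_root a.1.1.
Proof.
move=> aV; have /fintype.subsetP /(_ a aV) aD : V \subset Dplus r by case: bV.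
have [/mem_Dlong|aL] := boolP (a \in Dlong r); first by right.
by left; rewrite finset.in_setI aV finset.in_setD aL aD.
Qed.

Lemma basis_long_notin_zero i : long_root i \in V -> i \notin zero_block S.
Proof.
move=> iV; apply/negP; rewrite inE => /asboolP iZ.
have [_ [li _]] := bV; apply: (lin_indep_notin_span li iV).
apply: in_span_of_perp => l pl; rewrite rootv_long dotvZl dotv_ev iZ ?mulr0 //.
move=> a; rewrite finset.in_setI => /andP[aV aS]; apply: pl; rewrite in_setD1 aV andbT.
by apply: contraTneq aS => ->; rewrite short_rootsE ltnn.
Qed.

Lemma basis_long_inj i j : long_root i \in V -> long_root j \in V -> rep S i = rep S j -> i = j.
Proof.
move=> iV jV rij; apply/eqP/negPn/negP => ij.
have [_ [li _]] := bV; apply: (lin_indep_notin_span li iV).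
apply: in_span_of_perp => l pl; rewrite rootv_long dotvZl dotv_ev.
have lj : l 0 j = 0.
  have := pl (long_root j); rewrite in_setD1 jV andbT rootv_long dotvZl dotv_ev.
  have ji : long_root j != long_root i.
    by apply: contra ij => /eqP [->].
  by move=> /(_ ji) /eqP; rewrite mulf_eq0 pnatr_eq0 /= => /eqP.
have pS : perp S l.
  move=> a; rewrite finset.in_setI => /andP[aV aS]; apply: pl; rewrite in_setD1 aV andbT.
  by apply: contraTneq aS => ->; rewrite short_rootsE ltnn.
move: lj; rewrite (bsignE i pS) (bsignE j pS) rij => /eqP.
by rewrite mulf_eq0 (negPf (bsign_neq0 S j)) /= => /eqP ->; rewrite !mulr0.
Qed.

(** Otherwise [block_vec S i] would be a nonzero vector orthogonal to the whole basis. *)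
Lemma basis_long_ex i : i \notin zero_block S -> exists2 j, long_root j \in V & rep S j = rep S i.
Proof.
move=> iZ; apply: contrapT => nj.
suff h : perp V (block_vec S i).
  by have := block_vec_self iZ; rewrite (basis_perp0 h) mxE => /eqP; rewrite eq_sym oner_eq0.
move=> a aV; have [aS|ea] := basis_short_or_long aV; first exact: perp_block_vec.
move: aV; rewrite ea rootv_long dotvZl dotv_ev mxE => aV.
case: ifP => [/andP[_ /eqP e]|_]; last by rewrite mulr0.
by exfalso; apply: nj; exists a.1.1.
Qed.

(** The choice made by [xget] is settled by uniqueness: two dual vectors differ by a vector
    orthogonal to a basis. *)
Lemma mu_long i : long_root i \in V -> mu R V (long_root i) = block_vec S i.
Proof.
move=> iV; have iZ := basis_long_notin_zero iV.
apply: xget_subset1 => [b bV'|m m' hm hm'] /=.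
  have [bS|eb] := basis_short_or_long bV'.
    have bA : b \in short_roots by move: bS; rewrite finset.in_setI => /andP[].
    rewrite corootv_short // perp_block_vec //; case: eqP => // e.
    by move: bA; rewrite e short_rootsE ltnn.
  move: bV'; rewrite eb corootv_long dotv_ev mxE => bV'.
  have -> : (long_root b.1.1 == long_root i) = (b.1.1 == i).
    by apply/eqP/eqP => [[]//|->].
  rewrite (basis_long_notin_zero bV') /=.
  case: eqP => [/(basis_long_inj bV' iV) ->|ne]; first by rewrite bsign_sqr eqxx.
  by case: eqP ne => // ->.
apply/eqP; rewrite -subr_eq0; apply/eqP/basis_perp0 => b bV'.
have : dotv (corootv (rootv R b)) (m - m') = 0 by rewrite dotvBr hm // hm' // subrr.
have [bS|eb] := basis_short_or_long bV'.
  by rewrite corootv_short //; move: bS; rewrite finset.in_setI => /andP[].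
by rewrite eb corootv_long rootv_long dotvZl => ->; rewrite mulr0.
Qed.
End Basis.

End Flats.

Lemma fsbig_fintype (M : Type) (idx : M) (op : Monoid.com_law idx) (T : finType)
    (A : set T) (F : T -> M) :
  \big[op/idx]_(x \in A) F x = \big[op/idx]_(x | `[< A x >]) F x.
Proof.
rewrite (@bigfs _ _ _ _ (index_enum T)) ?index_enum_uniq //; last first.
  by move=> i _; rewrite mem_index_enum.
by apply: eq_fsbigl; apply/predeqP => x; split=> [Ax|/asboolP //]; apply/asboolP.
Qed.

(** * Bases with a prescribed set of short roots *)

Section BasesOfFlats.
Variables (R : realType) (r : nat).
Implicit Types (S V : {set PR r}) (l v : 'rV[R]_r) (i j : 'I_r).
Local Notation A := (short_roots r).
Local Notation zero_block := (@zero_block R r).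
Local Notation rep := (@rep R r).
Local Notation is_rep := (@is_rep R r).
Local Notation bsign := (@bsign R r).
Local Notation block_vec := (@block_vec R r).

Definition in_block S i j : bool := (j \notin zero_block S) && (rep S j == i).

Lemma in_block_rep S j : j \notin zero_block S -> in_block S (rep S j) j.
Proof. by move=> jZ; rewrite /in_block jZ eqxx. Qed.

(** A choice of one member per block is encoded by [h], read only at the representatives of the
    blocks. *)
Definition extend S (h : 'I_r -> 'I_r) : {set PR r} :=
  S :|: [set long_root (h i) | i : 'I_r & is_rep S i].

Lemma extend_short S h : S \subset A -> extend S h :&: A = S.
Proof.
move=> SA; rewrite finset.setIUl (finset.setIidPl SA); apply/finset.setUidPl.
apply/fintype.subsetP => a; rewrite finset.in_setI => /andP[/imsetP[i _ ->]].
by rewrite short_rootsE ltnn.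
Qed.

Lemma long_in_extend S h j : S \subset A ->
  (long_root j \in extend S h) = [exists i, is_rep S i && (h i == j)].
Proof.
move=> /fintype.subsetP SA; rewrite finset.in_setU.
have -> : long_root j \in S = false.
  by apply/negP => /SA; rewrite short_rootsE ltnn.
apply/imsetP/existsP.
  by case=> i; rewrite inE => ri [->]; exists i; rewrite ri eqxx.
by case=> i /andP[ri /eqP <-]; exists i; rewrite ?inE.
Qed.

(** Pairing a linear relation with a block vector kills [S] and the other blocks, which isolates one
    long coefficient. The set spans because a vector orthogonal to [S] that vanishes at one
    coordinate of each block is zero. *)
Lemma extend_basis S h : S \subset A -> lin_indep R S ->
  (forall i, is_rep S i -> in_block S i (h i)) -> Bases R r (extend S h).
Proof.
move=> SA liS hh.
have lh l i : perp S l -> is_rep S i -> l 0 (h i) = bsign S (h i) * l 0 i.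
  by move=> pl /hh /andP[_ /eqP e]; rewrite (bsignE (h i) pl) e.
split; [|split].
- apply/fintype.subsetP => a; rewrite finset.in_setU => /orP[/(fintype.subsetP SA)|].
    by rewrite finset.in_setD => /andP[].
  by case/imsetP => i _ ->; apply: (fintype.subsetP (Dlong_sub_Dplus r)); apply: Dlong_long_root.
- move=> c c0.
  have cl i : is_rep S i -> c (long_root (h i)) = 0.
    move=> ri; have /andP[hZ /eqP hr] := hh i ri.
    have := congr1 (fun v => dotv v (block_vec S (h i))) c0.
    have -> : dotv 0 (block_vec S (h i)) = 0.
      by rewrite -[X in dotv X _](scale0r 0) dotvZl mul0r.
    rewrite dotv_suml (bigD1 (long_root (h i))); last first.
      by rewrite finset.in_setU; apply/orP; right; apply/imsetP; exists i; rewrite ?inE.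
    rewrite dotvZl rootv_long dotvZl dotv_ev block_vec_self // mulr1 big1.
      by rewrite /= addr0; move/eqP; rewrite mulf_eq0 pnatr_eq0 orbF => /eqP.
    move=> a /andP[]; rewrite finset.in_setU => /orP[aS _|/imsetP].
      by rewrite dotvZl perp_block_vec ?mulr0.
    case=> k; rewrite inE => rk -> ne; rewrite dotvZl rootv_long dotvZl dotv_ev mxE.
    have /andP[_ /eqP ->] := hh k rk; rewrite hr.
    by case: eqP => [e|_]; [rewrite e eqxx in ne|rewrite andbF !mulr0].
  move=> b; rewrite finset.in_setU => /orP[bS|/imsetP]; last first.
    by case=> i; rewrite inE => ri ->; exact: cl.
  apply: liS b bS; rewrite -[RHS]c0 [RHS](big_setID S) /=.
  have -> : extend S h :&: S = S by rewrite finset.setIC; apply/finset.setIidPl/finset.subsetUl.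
  rewrite [X in _ + X]big1 ?addr0 // => a; rewrite finset.in_setD finset.in_setU => /andP[/negPf -> /=].
  by move=> /imsetP; case=> i; rewrite inE => ri ->; rewrite cl // scale0r.
- move=> v; apply: in_span_of_perp => l pl.
  have pS : perp S l by move=> a aS; apply: pl; rewrite finset.in_setU aS.
  suff -> : l = 0 by rewrite /dotv big1 // => k _; rewrite mxE mulr0.
  apply/rowP => j; rewrite mxE (bsignE j pS).
  have [jZ|jZ] := boolP (j \in zero_block S).
    by have /(perpE S l) [h0 _] := pS; rewrite h0 ?mulr0 // zero_block_rep.
  have rj := is_rep_rep jZ.
  have : dotv (rootv R (long_root (h (rep S j)))) l = 0.
    by apply: pl; rewrite finset.in_setU; apply/orP; right; apply/imsetP; exists (rep S j); rewrite ?inE.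
  rewrite rootv_long dotvZl dotv_ev lh // => /eqP.
  by rewrite !mulf_eq0 pnatr_eq0 (negPf (bsign_neq0 R S _)) /= => /eqP ->; rewrite mulr0.
Qed.

Section NoBrokenCircuit.
Variable nu : seq (PR r).
Hypothesis hnu : perm_eq nu (enum A).

Lemma mem_nu a : (a \in nu) = (a \in A).
Proof. by rewrite (perm_mem hnu) mem_enum. Qed.

(* No broken circuit, for the order of the list [nu]. *)
Definition nbc S : Prop := forall j : 'I_(size nu),
  ~ in_span (S :&: [set x in take j nu]) (rootv R (tnth (in_tuple nu) j)).

(** Prefixes of [nu] consist of short roots, so the defining condition sees only the short part of
    [V]. *)
Lemma VA_nbc V : VA R nu V <-> Bases R r V /\ nbc (V :&: A).
Proof.
have e (j : nat) : V :&: A :&: [set x in take j nu] = V :&: [set x in take j nu].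
  apply/setP => a; rewrite !finset.in_setI -andbA; congr (_ && _).
  by rewrite [X in _ && X]finset.in_set [RHS]finset.in_set; apply: andb_idl => /mem_take; rewrite mem_nu.
by split=> -[bV h]; split=> // j; have := h j; rewrite e.
Qed.

(** In a nontrivial relation, the root of largest index with nonzero coefficient would be a
    combination of earlier members of [S]. *)
Lemma nbc_lin_indep S : S \subset A -> nbc S -> lin_indep R S.
Proof.
move=> /fintype.subsetP SA nS c c0 b bS; apply/eqP/negPn/negP => cb.
pose P := [pred a | (a \in S) && (c a != 0)].
have Pb : P b by rewrite /= bS.
have [a /andP[aS ca] amax] := arg_maxnP (fun a => index a nu) Pb.
have an : (index a nu < size nu)%N by rewrite index_mem mem_nu SA.
apply: (nS (Ordinal an)); rewrite (tnth_nth a) /= nth_index ?mem_nu ?SA //.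
exists (fun d => if d \in take (index a nu) nu then - (c d / c a) else 0).
apply: (scalerI ca); rewrite scaler_sumr.
move: c0; rewrite (bigD1 a) //= => /eqP; rewrite addr_eq0 => /eqP ->.
rewrite -sumrN [RHS]big_mkcond [LHS]big_mkcond /=; apply: eq_bigr => d _.
rewrite finset.in_setI [X in _ = if _ && X then _ else _]finset.in_set.
have [dS|dS] := boolP (d \in S) => //=.
have din : (d \in take (index a nu) nu) = (index d nu < index a nu)%N.
  by rewrite in_take // mem_nu SA.
have [->|da] := eqVneq d a; first by rewrite in_take ?ltnn // mem_nu SA.
rewrite din; case: ltnP => h.
  by rewrite scalerA mulrN mulrC divfK // scaleNr.
have [->|cd] := eqVneq (c d) 0; first by rewrite scale0r oppr0.
have := amax d; rewrite /= dS cd => /(_ isT) h2.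
have e : index d nu = index a nu by apply/eqP; rewrite eqn_leq h h2.
by case/negP: da; rewrite -(nth_index a (_ : d \in nu)) ?mem_nu ?SA // e nth_index ?mem_nu ?SA.
Qed.

End NoBrokenCircuit.
End BasesOfFlats.

(** * The generating function as a sum over flats *)

Section CosetRepresentatives.
Variables (R : realType) (r : nat).
Implicit Types (V : {set PR r}) (l q v : 'rV[R]_r) (i j : 'I_r) (a b : PR r).
Local Notation A := (short_roots r).

Lemma corootv_Dplus a : a \in Dplus r -> exists2 c : R, c != 0 & corootv (rootv R a) = c *: rootv R a.
Proof.
move=> aD; have [/mem_Dlong ->|aL] := boolP (a \in Dlong r).
  exists 2^-1; first by rewrite invr_eq0 pnatr_eq0.
  by rewrite corootv_long rootv_long scalerA mulVf ?scale1r ?pnatr_eq0.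
exists 1; first exact: oner_neq0.
by rewrite scale1r corootv_short // finset.in_setD aL aD.
Qed.

Lemma corootv_coord a i : a \in Dplus r ->
  (corootv (rootv R a) 0 i \is a Num.int) && (`|corootv (rootv R a) 0 i| <= 1).
Proof.
move=> aD; have [/mem_Dlong ->|aL] := boolP (a \in Dlong r).
  by rewrite corootv_long mxE; case: eqP; rewrite /= ?rpred1 ?rpred0 ?normr0 ?normr1 ?ler01 ?lexx.
have aA : a \in A by rewrite finset.in_setD aL aD.
rewrite corootv_short //; move: aA; rewrite short_rootsE; case: a {aD aL} => [[k m] b] /= km.
have ik : (i == k) && (i == m) = false.
  by apply/negP => /andP[/eqP e1 /eqP e2]; move: km; rewrite -e1 -e2 ltnn.
rewrite !mxE; case: (i == k) (i == m) ik => [] [] //= _; case: b.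
all: by rewrite ?mulr1 ?mulr0 ?addr0 ?add0r ?rpredN ?rpred1 ?rpred0 ?normrN ?normr1 ?normr0 ?ler01 ?lexx.
Qed.

Lemma Qcheck_int q i : Qcheck R r q -> q 0 i \is a Num.int.
Proof.
move=> [c ->]; rewrite summxE; apply: rpred_sum => k _; rewrite mxE.
apply: rpredM; first exact: intr_int.
suff [a aD ->] : exists2 a, a \in Dplus r & simplev R k = rootv R a.
  by have /andP[] := corootv_coord i aD.
rewrite /simplev; case: ifP => h.
  exists (k, Ordinal h, false); first by rewrite inE /= ltnSn.
  by rewrite /rootv /= scaleN1r; congr (_ - _); apply/rowP => j; rewrite !mxE.
exists (long_root k); first by rewrite inE /= eqxx orbT.
by rewrite rootv_long.
Qed.

Section FixBasis.
Variable V : {set PR r}.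
Hypothesis bV : Bases R r V.

Lemma basis_sub_Dplus a : a \in V -> a \in Dplus r.
Proof. by case: bV => /fintype.subsetP h _; exact: h. Qed.

Lemma mu_dual b b' : b \in V -> b' \in V -> dotv (corootv (rootv R b')) (mu R V b) = (b' == b)%:R.
Proof.
move=> bVb; move: b'.
suff : exists m, forall b', b' \in V -> dotv (corootv (rootv R b')) m = (b' == b)%:R.
  by move=> /xgetPex h b' b'V; apply: h.
have [c c0 cE] := corootv_Dplus (basis_sub_Dplus bVb).
have [_ [li _]] := bV; have ns := lin_indep_notin_span li bVb.
have [l pl ln] : exists2 l, perp (V :\ b) l & dotv (rootv R b) l != 0.
  apply: contrapT => nl; apply: ns; apply: in_span_of_perp => l pl.
  by apply/eqP/negPn/negP => ln; apply: nl; exists l.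
exists ((c * dotv (rootv R b) l)^-1 *: l) => b' b'V.
have dotvZr (k : R) u w : dotv u (k *: w) = k * dotv u w.
  by rewrite /dotv mulr_sumr; apply: eq_bigr => t _; rewrite mxE mulrCA.
rewrite dotvZr; have [->|ne] := eqVneq b' b; first by rewrite cE dotvZl mulVf // mulf_neq0.
have [c' _ ->] := corootv_Dplus (basis_sub_Dplus b'V).
have -> : dotv (c' *: rootv R b') l = 0.
  by rewrite dotvZl pl ?mulr0 // finset.in_setD finset.in_set1 ne b'V.
exact: mulr0.
Qed.

Lemma basis_expand q : q = \sum_(b in V) dotv q (mu R V b) *: corootv (rootv R b).
Proof.
have [_ [_ /(_ q) [c cE]]] := bV.
have [d dE] : exists d : PR r -> R, q = \sum_(b in V) d b *: corootv (rootv R b).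
  have /choice [k kE] : forall b, exists k : R, b \in V -> rootv R b = k *: corootv (rootv R b).
    move=> b; have [bVb|_] := boolP (b \in V); last by exists 0.
    have [c' c0 e] := corootv_Dplus (basis_sub_Dplus bVb).
    by exists c'^-1; rewrite e scalerA mulVf // scale1r.
  by exists (fun b => c b * k b); rewrite cE; apply: eq_bigr => b bVb; rewrite -scalerA -kE.
rewrite [LHS]dE; apply: eq_bigr => b bVb; congr (_ *: _).
rewrite dE dotv_suml (bigD1 b) //= dotvZl mu_dual // eqxx mulr1 big1 ?addr0 // => b' /andP[b'V ne].
by rewrite dotvZl mu_dual // (negPf ne) mulr0.
Qed.

(** A representative has integer coordinates, and its expansion in the coroots of [V], with
    coefficients in [0, 1), bounds them by the size of [V]. Finiteness is essential: a sum of ones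
    over an infinite set is 0 by convention. *)
Lemma finite_Reps : finite_set (Reps R V).
Proof.
pose K := #|V|.
pose f (g : {ffun 'I_r -> 'I_(K + K).+1}) : 'rV[R]_r := \row_k ((g k)%:R - K%:R).
apply: (@sub_finite_set _ _ (f @` [set: _])); last exact: finite_image.
move=> q [qQ qb].
have qK i : `|q 0 i| <= K%:R.
  rewrite [q]basis_expand summxE; apply: le_trans (ler_norm_sum _ _ _) _.
  rewrite /K -sum1_card natr_sum; apply: ler_sum => b bVb.
  rewrite mxE normrM; have /andP[_ h] := corootv_coord i (basis_sub_Dplus bVb).
  have /andP[q0 q1] := qb b bVb.
  by apply: mulr_ile1 => //; rewrite ger0_norm // ltW.
have /choice [z zE] : forall i, exists n : 'I_(K + K).+1, q 0 i = n%:R - K%:R.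
  move=> i; have /intrP [m mE] := Qcheck_int i qQ.
  have := qK i; rewrite mE -intr_norm -[K%:R]/((K%:Z)%:~R : R) ler_int => h1.
  have h3 : (absz (m + K%:Z)%R < (K + K).+1)%N by lia.
  exists (Ordinal h3) => /=.
  have -> : (absz (m + K%:Z)%R)%:R = (m + K%:Z)%:~R :> R by rewrite [LHS]pmulrn; congr (_%:~R); lia.
  by rewrite intrD addrK.
exists [ffun i => z i] => //; apply/rowP => i.
by rewrite mxE ffunE zE.
Qed.

(** The index of the sublattice never has to be computed: it is enough that it is nonzero, and 0 is
    a representative. *)
Lemma mean_Reps (F : 'rV[R]_r -> R) (c : R) : (forall q, Reps R V q -> F q = c) ->
  (\sum_(q \in Reps R V) (1 : R))^-1 * \sum_(q \in Reps R V) F q = c.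
Proof.
move=> Fc; have -> : \sum_(q \in Reps R V) F q = \sum_(q \in Reps R V) c * 1.
  by apply: eq_fsbigr => q; rewrite inE mulr1 => /Fc.
rewrite -mulr_fsumr mulrCA mulVf ?mulr1 //.
have R0 : Reps R V 0.
  split; first by exists (fun=> 0); rewrite big1 // => i _; exact: scale0r.
  by move=> b _; rewrite /dotv big1 ?lexx ?ltr01 // => k _; rewrite mxE mul0r.
rewrite (fsbigD1 (0 : 'rV[R]_r)) //=; last exact: finite_Reps.
by rewrite gt_eqF // ltr_pwDl // fsumr_ge0.
Qed.

(** Block vectors have entries 0, 1 and -1 and so take integer values on the coroot lattice; the
    fractional parts vanish and only the branch selected by [phi] remains. *)
Lemma brk_long (phi q : 'rV[R]_r) i : long_root i \in V -> Reps R V q ->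
  brk phi V (long_root i) (0 + q) = (~~ (0 < dotv phi (block_vec R (V :&: A) i)))%:R.
Proof.
move=> iV [qQ _]; rewrite add0r /brk (mu_long bV iV).
set S := V :&: A; set d := dotv q _.
have dint : d \is a Num.int.
  apply: rpred_sum => k _; apply: rpredM; first exact: Qcheck_int.
  by rewrite mxE /bsign; case: ifP => _; rewrite ?rpred0 //; case: ifP => _; case: ifP => _;
    rewrite rpredM // ?rpredN rpred1.
have fr x : x \is a Num.int -> Defs.frac x = 0 by move=> xi; rewrite /Defs.frac floorK // subrr.
by case: ifP => _; rewrite fr ?rpredN ?subr0.
Qed.

End FixBasis.
End CosetRepresentatives.

(** * Factorisation of the generating function over blocks *)

Section GeneratingFunction.
Variables (R : realType) (r : nat).
Implicit Types (S V : {set PR r}) (i j g : 'I_r).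
Local Notation A := (short_roots r).
Local Notation zero_block := (@zero_block R r).
Local Notation rep := (@rep R r).
Local Notation is_rep := (@is_rep R r).
Local Notation bsign := (@bsign R r).
Local Notation block_vec := (@block_vec R r).
Local Notation in_block := (@in_block R r).

Lemma big_long (M : Type) (idx : M) (op : Monoid.com_law idx) (X : {set PR r}) (F : PR r -> M) :
  X \subset Dlong r ->
  \big[op/idx]_(a in X) F a = \big[op/idx]_(i | long_root i \in X) F (long_root i).
Proof.
move=> /fintype.subsetP XL; rewrite (reindex_onto (@long_root r) (fun a => a.1.1)) /=.
  by apply: eq_bigl => i; rewrite eqxx andbT.
by move=> a /XL /mem_Dlong <-.
Qed.

Lemma card_short_even : ~~ odd #|A|.
Proof.
rewrite -sum1_card (eq_bigl (fun p : PR r => (p.1.1 < p.1.2)%N)); last exact: short_rootsE.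
rewrite big_mkcond -(pair_bigA _ (fun (q : 'I_r * 'I_r) (b : bool) => if (q.1 < q.2)%N then 1 else 0)%N) /=.
by under eq_bigr do rewrite sum_nat_const card_bool; rewrite -big_distrr /= mul2n odd_double.
Qed.

(** The short positive roots come in pairs e_i + e_j, e_i - e_j, so their number is even and the
    complement inside [A] has the same parity. *)
Lemma sign_card_short V : (-1) ^+ #|A :\: V| = (-1) ^+ #|V :&: A| :> R.
Proof.
rewrite -signr_odd -[RHS]signr_odd; congr (_ ^+ (nat_of_bool _)).
have := card_short_even; rewrite -(cardsID V A) oddD finset.setIC.
by case: (odd _) (odd _) => [] [].
Qed.

Section Signs.
Variable phi : 'rV[R]_r.

Definition phi_sign S i : R := Num.sg (dotv phi (block_vec S i)).

Definition block_sum S i (s : 'I_r -> R) : R :=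
  \sum_(b | in_block S i b)
    todd (s b) * \prod_(g | in_block S i g && (g != b)) (s g / (s g - s b)).

Lemma block_vec_same S i j : rep S i = rep S j ->
  block_vec S i = (bsign S i * bsign S j) *: block_vec S j.
Proof.
move=> e; apply/rowP => k; rewrite !mxE e; case: ifP => _; last by rewrite mulr0.
rewrite mulrACA [bsign S j * _]mulrC !mulrA -mulrA bsign_sqr mulr1 mulrC //.
Qed.

Lemma phi_sign_same S i j : rep S i = rep S j ->
  phi_sign S i = bsign S i * bsign S j * phi_sign S j.
Proof.
move=> e; have dotvZr (k : R) u w : dotv u (k *: w : 'rV[R]_r) = k * dotv u w.
  by rewrite /dotv mulr_sumr; apply: eq_bigr => t _; rewrite mxE mulrCA.
rewrite /phi_sign (block_vec_same e) dotvZr sgrM; congr (_ * _).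
by rewrite /bsign; case: ifP => _; case: ifP => _; rewrite ?mulr1 ?mul1r ?mulN1r ?opprK ?sgrN ?sgr1.
Qed.

(** x e^x / (e^x - 1) is x / (e^x - 1) evaluated at -x: a bracket equal to 1 amounts to a change of
    sign of the variable. *)
Lemma todd_sign (x d : R) : d != 0 ->
  x * expR (x * (~~ (0 < d))%:R) / (expR x - 1) = todd (Num.sg d * x).
Proof.
case: (ltrgt0P d) => [d0|d0|//].
- by move=> _; rewrite mulr0 expR0 mulr1 gtr0_sg // mul1r.
- move=> _; rewrite mulr1 ltr0_sg // mulN1r /todd expRN.
  have [->|x0] := eqVneq x 0; first by rewrite oppr0 !mul0r.
  have e1 : expR x != 0 by rewrite gt_eqF // expR_gt0.
  have e2 : expR x - 1 != 0 by rewrite subr_eq0 -(expR0 R) (inj_eq (@expR_inj R)).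
  move: e1 e2; move: (expR x) => e e1 e2; field.
  have -> : 1 + -1 * e = - (e - 1) by ring.
  by rewrite e1 oppr_eq0 e2.
Qed.

Section Extend.
Variables (S : {set PR r}) (h : 'I_r -> 'I_r).
Hypothesis SA : S \subset A.
Hypothesis liS : lin_indep R S.
Hypothesis hh : forall i, is_rep S i -> in_block S i (h i).
Hypothesis hphi : forall V, Bases R r V -> forall b, b \in V -> dotv phi (mu R V b) != 0.
Let V := extend R S h.
Let bV : Bases R r V := extend_basis SA liS hh.

Lemma long_in_V j : (long_root j \in V) = (j \notin zero_block S) && (h (rep S j) == j).
Proof.
rewrite long_in_extend //; apply/existsP/andP.
  case=> i /andP[ri /eqP <-]; have /andP[hZ /eqP ->] := hh ri.
  by rewrite hZ eqxx.
by move=> [jZ /eqP e]; exists (rep S j); rewrite is_rep_rep // e eqxx.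
Qed.

Lemma VA_short : V :&: A = S. Proof. exact: extend_short. Qed.

Lemma phi_block_vec_neq0 j : j \notin zero_block S -> dotv phi (block_vec S j) != 0.
Proof.
move=> jZ; have rj := is_rep_rep jZ; have /andP[hZ /eqP hr] := hh rj.
have hV : long_root (h (rep S j)) \in V by rewrite long_in_V hZ hr eqxx.
have := hphi bV hV; rewrite (mu_long bV hV) VA_short.
have e : rep S (h (rep S j)) = rep S j by rewrite hr.
rewrite -sgr_eq0 -/(phi_sign S (h (rep S j))) (phi_sign_same e) mulf_eq0 negb_or.
by case/andP => _; rewrite sgr_eq0.
Qed.

(** The vectors dual to the long roots of [V] are supported on distinct blocks, so at most one of
    them has a nonzero coordinate g. *)
Lemma linear_form_long (t : 'I_r -> R) g :
  \sum_(b in V :\: A) tlong t b * dotv (corootv (rootv R (long_root g))) (mu R V b)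
  = if g \in zero_block S then 0 else bsign S g * bsign S (h (rep S g)) * t (h (rep S g)).
Proof.
have VL : V :\: A \subset Dlong r.
  apply/fintype.subsetP => a; rewrite finset.in_setD => /andP[aA aV].
  have [|->] := basis_short_or_long bV aV; last exact: Dlong_long_root.
  by rewrite finset.in_setI (negPf aA) andbF.
rewrite big_long // corootv_long.
have lA i : (long_root i \in V :\: A) = (long_root i \in V).
  by rewrite finset.in_setD short_rootsE ltnn.
rewrite (eq_bigl _ _ lA); under eq_bigr => i iV.
  rewrite (mu_long bV iV) VA_short dotv_ev mxE; over.
case: ifP => gZ /=; first by rewrite big1 // => i _; rewrite mulr0.
have rg : is_rep S (rep S g) by rewrite is_rep_rep ?gZ.
have /andP[hZ /eqP hr] := hh rg.
rewrite (bigD1 (h (rep S g))) /=; last by rewrite long_in_V hZ hr eqxx.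
rewrite hr eqxx big1 ?addr0; first by rewrite mulrC.
move=> i /andP[]; rewrite long_in_V => /andP[iZ /eqP hi] ne.
by case: eqP => [e|_]; rewrite ?mulr0 //; rewrite e hi eqxx in ne.
Qed.

(** Long roots in the zero block give the factor t / t = 1, and the others are grouped by block.
    Within a block the values of [phi_sign] differ exactly by the relative block signs, so passing
    from t to [phi_sign] times t absorbs the signs of all denominators. *)
Lemma extend_term (t : 'I_r -> R) : (forall i, t i != 0) ->
  (-1) ^+ #|A :\: V| *
     (\prod_(g in Dplus r :\: (V :|: A))
        (tlong t g / (tlong t g - \sum_(b in V :\: A)
                         tlong t b * dotv (corootv (rootv R g)) (mu R V b)))) *
     ((\sum_(q \in Reps R V) (1 : R))^-1 *
      \sum_(q \in Reps R V)
        \prod_(b in V :\: A)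
          (tlong t b * expR (tlong t b * brk phi V b (0 + q)) / (expR (tlong t b) - 1)))
  = (-1) ^+ #|S| * \prod_(i | is_rep S i)
      (todd (phi_sign S (h i) * t (h i)) *
        \prod_(g | in_block S i g && (g != h i))
          (phi_sign S g * t g / (phi_sign S g * t g - phi_sign S (h i) * t (h i)))).
Proof.
move=> t0; rewrite sign_card_short VA_short -mulrA; congr (_ * _).
rewrite [RHS]big_split [LHS]mulrC /=; congr (_ * _).
- apply: (mean_Reps bV) => q qR.
  have VL : V :\: A \subset Dlong r.
    apply/fintype.subsetP => a; rewrite finset.in_setD => /andP[aA aV].
    have [|->] := basis_short_or_long bV aV; last exact: Dlong_long_root.
    by rewrite finset.in_setI (negPf aA) andbF.
  rewrite big_long //.
  have lA i : (long_root i \in V :\: A) = (long_root i \in V).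
    by rewrite finset.in_setD short_rootsE ltnn.
  rewrite (eq_bigl _ _ lA); under eq_bigr => i iV.
    have iZ : i \notin zero_block S by move: iV; rewrite long_in_V => /andP[].
    rewrite (brk_long bV phi iV qR) VA_short /= todd_sign ?phi_block_vec_neq0 //.
    rewrite -/(phi_sign _ _); over.
  rewrite (reindex_onto h (rep S)) /=; last first.
    by move=> i; rewrite long_in_V => /andP[_ /eqP].
  apply: eq_bigl => i; rewrite long_in_V; apply/idP/idP.
    by case/andP=> /andP[hZ _] /eqP e; rewrite -e is_rep_rep.
  by move=> ri; have /andP[-> /eqP ->] := hh ri; rewrite !eqxx.
- have VL : Dplus r :\: (V :|: A) \subset Dlong r.
    apply/fintype.subsetP => a; rewrite finset.in_setD finset.in_setU negb_or finset.in_setD.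
    by case/andP=> /andP[_ h1] aD; move: h1; rewrite aD andbT negbK.
  rewrite big_long //.
  have lA g : (long_root g \in Dplus r :\: (V :|: A)) = (long_root g \notin V).
    rewrite finset.in_setD finset.in_setU short_rootsE ltnn orbF.
    by rewrite (fintype.subsetP (Dlong_sub_Dplus r) _ (Dlong_long_root g)) andbT.
  rewrite (eq_bigl _ _ lA); under [LHS]eq_bigr => g _ do rewrite linear_form_long.
  rewrite (bigID (fun g => g \in zero_block S)) /= big1 ?mul1r; last first.
    by move=> g /andP[_ gZ]; rewrite gZ subr0 divff.
  rewrite (partition_big (rep S) (is_rep S)) /=; last first.
    by move=> g /andP[_]; exact: is_rep_rep.
  apply: eq_bigr => i ri; apply: eq_big => g.
    rewrite long_in_V /in_block; case: (boolP (g \in _)) => gZ; rewrite ?andbF //= andbT.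
    by rewrite andbC; case: (eqVneq (rep S g) i) => [->|//]; rewrite eq_sym.
  case/andP=> /andP[_ gZ] /eqP e; rewrite (negPf gZ) e.
  have /andP[hZ /eqP hr] := hh ri.
  have eh : rep S g = rep S (h i) by rewrite hr e.
  rewrite (phi_sign_same eh) /=.
  set x := bsign S g * bsign S (h i).
  have x2 : x * x = 1 by rewrite /x mulrACA !bsign_sqr mulr1.
  have p0 : phi_sign S (h i) != 0 by rewrite sgr_eq0 phi_block_vec_neq0.
  have xn : x != 0 by apply/eqP => x0; move: x2; rewrite x0 mul0r => /eqP; rewrite eq_sym oner_eq0.
  have -> : phi_sign S (h i) * t (h i) = x * phi_sign S (h i) * (x * t (h i)).
    by rewrite [RHS]mulrACA x2 mul1r.
  by rewrite -mulrBr -mulf_div divff ?mul1r // mulf_neq0.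
Qed.

End Extend.

Section Fgen.
Variable nu : seq (PR r).
Hypothesis hnu : perm_eq nu (enum A).
Hypothesis hphi : forall V, Bases R r V -> forall b, b \in V -> dotv phi (mu R V b) != 0.
Variable i0 : 'I_r.

(** The inverse of [extend]. The value [i0] off the representatives makes the choice function
    canonical, as membership in a [pfamily] requires. *)
Definition longs_of S V : {ffun 'I_r -> 'I_r} :=
  [ffun i => if is_rep S i then odflt i0 [pick j | (long_root j \in V) && (rep S j == i)] else i0].

Lemma longs_ofP S V i : Bases R r V -> V :&: A = S -> is_rep S i ->
  (long_root (longs_of S V i) \in V) && (rep S (longs_of S V i) == i).
Proof.
move=> bV VS ri; rewrite ffunE ri; case: pickP => [j -> //|nj].
have /andP[iZ /eqP ei] := ri.
have [|j jV ej] := basis_long_ex bV (i := i); first by rewrite VS.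
by have := nj j; rewrite jV -VS ej VS ei eqxx.
Qed.

Lemma extend_longs_of S V : Bases R r V -> V :&: A = S -> extend R S (longs_of S V) = V.
Proof.
move=> bV VS; have SA : S \subset A by rewrite -VS finset.subsetIr.
apply/setP => a; apply/idP/idP.
  rewrite finset.in_setU => /orP[|/imsetP]; first by rewrite -VS finset.in_setI => /andP[].
  by case=> i; rewrite inE => ri ->; have /andP[] := longs_ofP bV VS ri.
move=> aV; have [aS|ea] := basis_short_or_long bV aV.
  by rewrite finset.in_setU -VS aS.
move: aV; rewrite ea; move: (a.1.1) => j jV.
have jZ : j \notin zero_block S by have := basis_long_notin_zero bV jV; rewrite VS.
have rj := is_rep_rep jZ; have /andP[h1 /eqP h2] := longs_ofP bV VS rj.
rewrite long_in_extend //; apply/existsP; exists (rep S j); rewrite rj /=.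
by apply/eqP/(basis_long_inj bV h1 jV); rewrite VS.
Qed.

Lemma longs_of_extend S (f : {ffun 'I_r -> 'I_r}) : S \subset A -> lin_indep R S ->
  f \in pfamily i0 (is_rep S) (in_block S) -> longs_of S (extend R S f) = f.
Proof.
move=> SA liS /pfamilyP [/supportP f0 ff]; apply/ffunP => i; rewrite ffunE.
case: ifP => ri; last by rewrite f0 //; exact: negbT.
case: pickP => [j /andP[]|/(_ (f i))].
  by rewrite (long_in_V SA ff) => /andP[_ /eqP {2}<-] /eqP ->.
have /andP[fZ /eqP fr] := ff i ri.
by rewrite (long_in_V SA ff) fZ fr !eqxx.
Qed.

(** Bases with short part [S] correspond to choice functions on the blocks, and a sum over choice
    functions of a product over blocks is the product of the sums. *)
Lemma Fgen_flats (t : 'I_r -> R) : (forall i, t i != 0) ->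
  Fgen (Dlong r) nu phi (tlong t) 0 =
  \sum_(S : {set PR r} | (S \subset A) && `[< nbc R nu S >])
     (-1) ^+ #|S| * \prod_(i | is_rep S i) block_sum S i (fun j => phi_sign S j * t j).
Proof.
move=> t0; rewrite /Fgen fsbig_fintype.
rewrite (partition_big (fun V => V :&: A) (fun S => (S \subset A) && `[< nbc R nu S >])) /=; last first.
  move=> V /asboolP /(VA_nbc R hnu) [_ nV]; rewrite finset.subsetIr /=; exact/asboolP.
apply: eq_bigr => S /andP[SA /asboolP nS].
have liS := nbc_lin_indep hnu SA nS.
rewrite /block_sum (big_distr_big_dep i0) mulr_sumr /=.
rewrite (reindex_onto (fun f : {ffun 'I_r -> 'I_r} => extend R S f) (longs_of S)); last first.
  by move=> V /andP[/asboolP /(VA_nbc R hnu) [bV _] /eqP VS]; exact: extend_longs_of.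
apply: eq_big => [f|f].
  apply/idP/idP.
    case/andP => /andP[/asboolP /(VA_nbc R hnu) [bV _] /eqP VS] /eqP ef.
    apply/pfamilyP; split.
      by apply/supportP => i /negPf ri; rewrite -ef ffunE; move: ri; rewrite /in_mem /= => ->.
    move=> i ri; have /andP[h1 h2] := longs_ofP bV VS ri.
    rewrite ef in h1 h2; have := basis_long_notin_zero bV h1; rewrite VS => z.
    by apply/andP; split.
  move=> fP; have /pfamilyP [_ ff] := fP.
  rewrite longs_of_extend // eqxx andbT extend_short // eqxx andbT.
  apply/asboolP/(VA_nbc R hnu); rewrite extend_short //; split=> //.
  exact: extend_basis.
case/andP => /andP[/asboolP /(VA_nbc R hnu) [bV _] /eqP VS] /eqP ef.
have ff i : is_rep S i -> in_block S i (f i).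
  move=> ri; have /andP[h1 h2] := longs_ofP bV VS ri.
  rewrite ef in h1 h2; have := basis_long_notin_zero bV h1; rewrite VS => z.
  by apply/andP; split.
exact: extend_term.
Qed.

End Fgen.
End Signs.
End GeneratingFunction.

(** * Taylor expansion *)

Section Interpolation.
Variables (R : fieldType) (I : finType) (s : I -> R).
Implicit Types (B : {set I}).

(* By Lagrange interpolation a polynomial in [s]: [n == 0] minus [(-1) ^ #|B|] times the sum of the
   monomials of degree [n] in which every variable of [B] occurs. *)
Definition interp n B : R :=
  \sum_(b in B) s b ^+ n * \prod_(g in B :\ b) (s g / (s g - s b)).

Lemma prod_setU1D1 (F : I -> R) B y b : y \notin B -> b \in B ->
  \prod_(g in (y |: B) :\ b) F g = F y * \prod_(g in B :\ b) F g.
Proof.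
move=> yB bB; have yb : y != b by apply: contraNneq yB => ->.
rewrite -big_setU1 ?finset.in_setD1 ?negb_and ?yB ?orbT //.
apply: eq_bigl => g; rewrite !inE; case: (eqVneq g y) => [->|_] //=.
by rewrite yb.
Qed.

Lemma interp_setU1 n B y : y \notin B ->
  interp n (y |: B) = s y ^+ n * \prod_(g in B) (s g / (s g - s y))
    + \sum_(b in B) s b ^+ n * (s y / (s y - s b) * \prod_(g in B :\ b) (s g / (s g - s b))).
Proof.
move=> yB; rewrite /interp big_setU1 //= setU1K //; congr (_ + _).
by apply: eq_bigr => b bB; rewrite prod_setU1D1.
Qed.

(** Termwise this is the partial fraction (z - y) zy / ((z - b)(y - b)) = zy / (y - b) - yz / (z -
    b); the terms at y and z fit the same pattern. *)
Lemma interp_exchange n B y z : y \notin B -> z \notin B -> y != z ->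
  {in z |: (y |: B) &, injective s} ->
  (s z - s y) * interp n (z |: (y |: B)) = s z * interp n (y |: B) - s y * interp n (z |: B).
Proof.
move=> yB zB yz sI.
have zyB : z \notin y |: B by rewrite finset.in_setU1 negb_or eq_sym yz zB.
have iy : y \in z |: (y |: B) by rewrite !inE eqxx orbT.
have iz : z \in z |: (y |: B) by rewrite !inE eqxx.
have szy : s z - s y != 0 by rewrite subr_eq0; apply: contra yz => /eqP /sI ->.
have syz : s y - s z != 0 by rewrite -opprB oppr_eq0.
have sb b c : b \in B -> c \in z |: (y |: B) -> c \notin B -> s c - s b != 0.
  move=> bB cI cB; rewrite subr_eq0; apply: contra cB => /eqP /sI -> //.
  by rewrite !inE bB !orbT.
rewrite (interp_setU1 n zyB) big_setU1 //= big_setU1 //= setU1K // !interp_setU1 //.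
set P := \prod_(g in B) (s g / (s g - s z)); set Q := \prod_(g in B) (s g / (s g - s y)).
have e1 : (s z - s y) * (s z ^+ n * (s y / (s y - s z) * P)) = - (s y * (s z ^+ n * P)).
  by move: syz; move: (s z ^+ n) => u h; field.
have e2 : (s z - s y) * (s y ^+ n * (s z / (s z - s y) * Q)) = s z * (s y ^+ n * Q).
  by move: szy; move: (s y ^+ n) => u h; field.
have alg (a b c d : R) : - b + (a + (c - d)) = a + c - (b + d) by ring.
rewrite !mulrDr e1 e2 -alg; congr (_ + (_ + _)).
rewrite !mulr_sumr -sumrB; apply: eq_bigr => b bB.
rewrite prod_setU1D1 //; set L := \prod_(g in _) _.
have zb := sb b z bB iz zB; have yb := sb b y bB iy yB.
by move: zb yb; move: (s b ^+ n) (s z) (s y) (s b) => u p q v h1 h2; field; rewrite h1 h2.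
Qed.

Lemma interp0 B : B != finset.set0 -> {in B &, injective s} -> interp 0 B = 1.
Proof.
move: {2}#|B| (erefl #|B|) => m; elim/ltn_ind: m B => m IH C cC C0 sI.
have [y yC] := set0Pn _ C0.
have [e|] := eqVneq (C :\ y) finset.set0.
  have -> : C = [set y]%SET.
    by apply/eqP; rewrite finset.eqEsubset finset.sub1set yC andbT -finset.setD_eq0 e.
  by rewrite /interp big_set1 expr0 mul1r big1 // => g; rewrite !inE andNb.
move=> /set0Pn [z]; rewrite finset.in_setD1 => /andP[zy zC].
pose B' := C :\ y :\ z.
have zB : z \notin B' by rewrite !inE eqxx.
have yB : y \notin B' by rewrite !inE eqxx andbF.
have eC : C = z |: (y |: B').
  rewrite finset.setUCA /B' finset.setD1K ?finset.setD1K // finset.in_setD1 zy zC //.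
have sI2 := sI; rewrite eC in sI2.
have szy : s z - s y != 0.
  by rewrite subr_eq0; apply: contra zy => /eqP /sI ->.
apply: (mulfI szy); rewrite eC interp_exchange // 1?eq_sym // mulr1.
have c1 : (#|y |: B'| < m)%N.
  by rewrite -cC eC [X in (_ < X)%N]cardsU1 finset.in_setU1 negb_or zy zB ltnS.
have c2 : (#|z |: B'| < m)%N.
  by rewrite -cC eC finset.setUCA [X in (_ < X)%N]cardsU1 finset.in_setU1 negb_or eq_sym zy yB ltnS.
have n1 : y |: B' != finset.set0 by apply/set0Pn; exists y; rewrite !inE eqxx.
have n2 : z |: B' != finset.set0 by apply/set0Pn; exists z; rewrite !inE eqxx.
rewrite (IH _ c1) // ?(IH _ c2) // ?mulr1 //.
- by move=> a b ha hb; apply: sI2; rewrite finset.setUCA finset.in_setU1 ?ha ?hb orbT.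
- by move=> a b ha hb; apply: sI2; rewrite finset.in_setU1 ?ha ?hb orbT.
Qed.

(** From s_b s_y / (s_y - s_b) = s_y (s_y / (s_y - s_b) - 1) in each term with b in [B]. *)
Lemma interp_succ n B y : y \notin B -> {in y |: B &, injective s} ->
  interp n.+1 (y |: B) = s y * (interp n (y |: B) - interp n B).
Proof.
move=> yB sI; rewrite !interp_setU1 // mulrBr mulrDr -addrA exprS -mulrA; congr (_ + _).
rewrite !mulr_sumr -sumrB; apply: eq_bigr => b bB.
have yb : s y - s b != 0.
  rewrite subr_eq0; apply: contra yB => /eqP /sI -> //; rewrite !inE ?eqxx ?bB ?orbT //.
rewrite exprS; move: yb; move: (s b ^+ n) (\prod_(g in _) _) => u L h; field.
by rewrite h.
Qed.

(** Truncation of the series xX / (1 - xX). For n < M, the coefficient of X^n in the product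
    [compos_poly] is the sum of the monomials of degree n that contain every variable of [B]. *)
Definition tail_poly M (x : R) : {poly R} := \poly_(j < M) ((0 < j)%:R * x ^+ j).
Definition compos_poly M B : {poly R} := \prod_(i in B) tail_poly M (s i).

Lemma tail_polyE M x :
  tail_poly M.+1 x = x *: ('X * tail_poly M.+1 x) + x *: 'X - x ^+ M.+1 *: 'X^(M.+1).
Proof.
apply/polyP => i; rewrite coefB coefD !coefZ coefXM coefX coefXn !coef_poly.
case: i => [|i] /=; first by rewrite mul0r !mulr0 addr0 subr0.
rewrite !ltnS !eqSS; case: (ltngtP i M) => iM /=.
- rewrite mul1r mulr0 subr0 exprS; case: i iM => [|i] _ /=.
    by rewrite mul0r mulr0 add0r expr0.
  by rewrite mul1r mulr0 addr0.
- by case: i iM => [//|i] _; rewrite !mulr0 !addr0 subr0.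
- rewrite iM mulr1 exprS; case: M {iM} => [|M] /=.
    by rewrite mul0r mulr0 add0r expr0 subrr.
  by rewrite mul1r mulr0 addr0 subrr.
Qed.

Lemma coef_compos_poly_setU1 M B y n : y \notin B -> (n.+1 < M)%N ->
  (compos_poly M (y |: B))`_n.+1 = s y * ((compos_poly M (y |: B))`_n + (compos_poly M B)`_n).
Proof.
move=> yB; case: M => [//|M] nM; rewrite /compos_poly big_setU1 //=.
set Q := \prod_(i in B) _; rewrite {1}tail_polyE mulrBl mulrDl -!scalerAl coefB coefD !coefZ.
by rewrite -mulrA !coefXM /= coefXnM nM mulr0 subr0 -mulrDr.
Qed.

Lemma coef0_compos_poly M B : B != finset.set0 -> (compos_poly M B)`_0 = 0.
Proof.
move=> /set0Pn [y yB]; rewrite /compos_poly (big_setD1 y) //= coef0M coef_poly.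
by case: ifP => _; rewrite ?mul0r.
Qed.

(** Both sides satisfy the same recursion in n, obtained by splitting one variable off [B]. *)
Lemma interp_compos n M B : (n < M)%N -> {in B &, injective s} ->
  interp n B = (n == 0%N)%:R - (-1) ^+ #|B| * (compos_poly M B)`_n.
Proof.
elim: n B => [|n IH] B nM sI.
  have [->|B0] := eqVneq B finset.set0.
    by rewrite /interp /compos_poly !big_set0 cards0 coef1 mul1r subrr.
  by rewrite interp0 // coef0_compos_poly // mulr0 subr0.
have [->|/set0Pn [y yB]] := eqVneq B finset.set0.
  by rewrite /interp /compos_poly !big_set0 cards0 coef1 mulr0 subr0.
have eB := finset.setD1K yB; have yB' : y \notin B :\ y by rewrite !inE eqxx.
rewrite -eB in sI; rewrite -eB interp_succ // !IH ?(ltnW nM) //; last first.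
  by move=> a b ha hb; apply: sI; rewrite finset.in_setU1 ?ha ?hb orbT.
rewrite coef_compos_poly_setU1 // cardsU1 yB' add1n exprS /=.
move: (_`_n) (_`_n) (_ ^+ _) => u v w; ring.
Qed.

End Interpolation.

(** * Sums over exponent boxes that factor over disjoint blocks *)

Section CubeSums.
Variables (I J : finType) (j0 : J) (R : comNzRingType).
Implicit Types (U : {set I}) (k : {ffun I -> J}) (a : {ffun I -> J} -> R).

(** Functions on the subset [U] are represented by functions on [I] with the default value [j0]
    elsewhere, so that all blocks share one finite type of exponents. *)
Definition supported U k : bool := [forall i, (i \notin U) ==> (k i == j0)].
Definition local_on U a : Prop := forall k k', {in U, k =1 k'} -> a k = a k'.
Definition restrict_to U k : {ffun I -> J} := [ffun i => if i \in U then k i else j0].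

Lemma supportedP U k : reflect (forall i, i \notin U -> k i = j0) (supported U k).
Proof. by apply: (iffP forallP) => h i; [move=> iU; have := h i; rewrite iU => /eqP|apply/implyP => /h ->]. Qed.

Lemma supported_restrict_to U k : supported U (restrict_to U k).
Proof. by apply/supportedP => i /negPf iU; rewrite ffunE iU. Qed.

Lemma sum_supported_mul U1 U2 a b : {in U1, forall i, i \notin U2} -> local_on U1 a -> local_on U2 b ->
  \sum_(k | supported (U1 :|: U2) k) a k * b k =
  (\sum_(k | supported U1 k) a k) * (\sum_(k | supported U2 k) b k).
Proof.
move=> dU la lb; rewrite big_distrlr /= pair_big /=.
have U12 i : i \in U2 -> (i \in U1) = false.
  by move=> i2; apply/negP => /dU; rewrite i2.
pose mg (p : {ffun I -> J} * {ffun I -> J}) : {ffun I -> J} :=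
  [ffun i => if i \in U1 then p.1 i else p.2 i].
rewrite (reindex_onto mg (fun k => (restrict_to U1 k, restrict_to U2 k))) /=; last first.
  move=> k /supportedP ks; apply/ffunP => i; rewrite !ffunE /= ?ffunE.
  case: (boolP (i \in U1)) => //= i1; case: ifPn => // i2.
  by rewrite ks // finset.in_setU negb_or i1 i2.
apply: eq_big => [p|p].
  apply/idP/idP => [/andP[_ /eqP <-]|/andP[/supportedP s1 /supportedP s2]].
    by rewrite !supported_restrict_to.
  apply/andP; split.
    apply/supportedP => i; rewrite finset.in_setU negb_or => /andP[i1 i2].
    by rewrite ffunE (negPf i1) s2.
  case: p s1 s2 => p q /= s1 s2; apply/eqP; congr (_, _); apply/ffunP => i; rewrite !ffunE /=.
    by case: (boolP (i \in U1)) => // h; rewrite s1.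
  by case: (boolP (i \in U2)) => [h|h]; [rewrite U12|rewrite s2].
move=> /andP[_ /eqP ep]; congr (_ * _).
  by apply: la => i i1; rewrite ffunE i1.
by apply: lb => i i2; rewrite ffunE U12.
Qed.

Lemma sum_supported_prod (T : finType) (l : seq T) (B : T -> {set I}) (a : T -> {ffun I -> J} -> R) :
  uniq l -> {in l &, forall x y, x != y -> {in B x, forall i, i \notin B y}} ->
  (forall x, local_on (B x) (a x)) ->
  \sum_(k | supported (\bigcup_(x <- l) B x) k) \prod_(x <- l) a x k =
  \prod_(x <- l) \sum_(k | supported (B x) k) a x k.
Proof.
move=> + + la; elim: l => [_ _|x l IH /= /andP[xl ul] dB].
  rewrite !big_nil (eq_bigl (pred1 [ffun=> j0])); last first.
    move=> k; apply/supportedP/eqP => [h|-> i _]; last by rewrite ffunE.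
    by apply/ffunP => i; rewrite ffunE h // inE.
  by rewrite big_pred1_eq big_nil.
rewrite !big_cons -IH //; last first.
  by move=> y z yl zl; apply: dB; rewrite inE ?yl ?zl orbT.
rewrite -sum_supported_mul //; first by apply: eq_bigr => k _; rewrite big_cons.
- move=> i ix; apply/negP; rewrite finset.bigcup_seq => /finset.bigcupP [y yl iy].
  have xy : x != y by apply: contraNneq xl => ->.
  have := dB x y; rewrite !inE yl eqxx orbT => /(_ isT isT xy i ix).
  by rewrite iy.
- move=> k k' kk; rewrite !big_seq; apply: eq_bigr => y yl; apply: la => i iy; apply: kk.
  by rewrite finset.bigcup_seq; apply/finset.bigcupP; exists y.
Qed.

Lemma prod_sum_supported U (F : I -> J -> R) :
  \prod_(i in U) \sum_j F i j = \sum_(k | supported U k) \prod_(i in U) F i (k i).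
Proof.
rewrite (big_distr_big j0) /=; apply: eq_bigl => k.
apply/pffun_onP/supportedP => [[/supportP h _] i /h //|h]; split=> //.
by apply/supportP.
Qed.
End CubeSums.

(** * Power series of a single block *)

Section BlockExpansion.
Variables (R : realType) (I : finType) (B : {set I}) (s : I -> R).
Hypothesis B0 : B != finset.set0.

(** Coefficient of prod s_i^(k_i) in the sum over n of [bern n] times [interp n B]: by
    [interp_compos] a monomial survives only if it is constant or contains every variable of the
    block. *)
Definition block_coef (k : I -> nat) : R :=
  if [forall i in B, k i == 0%N] then 1
  else if [forall i in B, (0 < k i)%N] then - ((-1) ^+ #|B| * bern R (\sum_(i in B) k i)) else 0.

Lemma block_coefE (k : I -> nat) : block_coef k =
  [forall i in B, k i == 0%N]%:R - (-1) ^+ #|B| * ([forall i in B, (0 < k i)%N]%:R * bern R (\sum_(i in B) k i)).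
Proof.
rewrite /block_coef; case: ifP => [/'forall_implyP h|_]; last first.
  by case: ifP => _; rewrite ?mul1r ?mul0r ?mulr0 sub0r ?oppr0.
have -> : [forall i in B, (0 < k i)%N] = false; last by rewrite mul0r mulr0 subr0.
have [i iB] := set0Pn _ B0; apply/negP => /'forall_implyP /(_ i iB).
by rewrite (eqP (h i iB)).
Qed.

Lemma block_coef_abs (k : I -> nat) : `|block_coef k| <=
  [forall i in B, k i == 0%N]%:R + [forall i in B, (0 < k i)%N]%:R.
Proof.
rewrite /block_coef; case: ifP => _; first by rewrite normr1 lerDl.
case: ifP => _; last by rewrite normr0 addr0.
by rewrite normrN normrM normrX normrN1 expr1n mul1r add0r bern_le1.
Qed.

Lemma block_coef_local (k k' : I -> nat) : {in B, k =1 k'} -> block_coef k = block_coef k'.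
Proof.
move=> kk; rewrite /block_coef.
have -> : [forall i in B, k i == 0%N] = [forall i in B, k' i == 0%N].
  by apply: eq_forallb => i; case: (boolP (i \in B)) => //= /kk ->.
have -> : [forall i in B, (0 < k i)%N] = [forall i in B, (0 < k' i)%N].
  by apply: eq_forallb => i; case: (boolP (i \in B)) => //= /kk ->.
by rewrite (eq_bigr _ kk).
Qed.

Lemma prod_pos_pow (k : I -> nat) (c : I -> R) :
  \prod_(i in B) ((0 < k i)%N%:R * c i ^+ k i) =
  [forall i in B, (0 < k i)%N]%:R * \prod_(i in B) c i ^+ k i.
Proof.
rewrite big_split /=; congr (_ * _).
case: (boolP [forall i in B, (0 < k i)%N]) => [/'forall_implyP h|].
  by rewrite big1 // => i /h ->.
case/forallPn => i; rewrite negb_imply => /andP[iB /negPf k0].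
by rewrite (bigD1 i) //= k0 mul0r.
Qed.

Local Notation cube M := {ffun I -> 'I_M.+1}.
Local Notation supp := (supported (ord0 : 'I__.+1) B).

Lemma sum_pos_geometric M (c : I -> R) : (forall i, i \in B -> 0 <= c i <= 2^-1) ->
  \sum_(k : cube M | supported ord0 B k) [forall i in B, (0 < k i)%N]%:R * \prod_(i in B) c i ^+ k i <= 1.
Proof.
move=> hc; under eq_bigr do rewrite -prod_pos_pow.
rewrite -(prod_sum_supported ord0 B (fun i (j : 'I_M.+1) => (0 < j)%N%:R * c i ^+ j)).
apply: prodr_ile1 => i iB; have /andP[c0 c1] := hc i iB.
apply/andP; split; first by apply: sumr_ge0 => j _; rewrite mulr_ge0 // exprn_ge0.
rewrite big_ord_recl /= mul0r add0r.
apply: (@le_trans _ _ (\sum_(j < M) (2^-1) ^+ j.+1)).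
  by apply: ler_sum => j _; rewrite mul1r lerXn2r // nnegrE.
suff -> : \sum_(j < M) (2^-1) ^+ j.+1 = 1 - (2^-1) ^+ M :> R by rewrite gerBl exprn_ge0.
elim: M => [|M IH]; first by rewrite big_ord0 expr0 subrr.
by rewrite big_ord_recr /= IH exprS; move: (_ ^+ M) => x; field.
Qed.

Lemma sum_supported_zero M :
  \sum_(k : cube M | supported ord0 B k)
    [forall i in B, (k i : nat) == 0%N]%:R * \prod_(i in B) s i ^+ k i = 1.
Proof.
rewrite (bigD1 [ffun=> ord0]) /=; last by apply/supportedP => i _; rewrite ffunE.
rewrite [X in _ + X]big1 ?addr0; last first.
  move=> k /andP[/supportedP ks kn].
  case: (boolP [forall i in B, (k i : nat) == 0%N]) => [/'forall_implyP h|]; last by rewrite mul0r.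
  case/eqP: kn; apply/ffunP => i; rewrite ffunE.
  by have [/h /eqP e|/ks //] := boolP (i \in B); apply/val_inj.
have -> : [forall i in B, ([ffun=> ord0] i : 'I_M.+1) == 0%N :> nat].
  by apply/'forall_implyP => i _; rewrite ffunE.
by rewrite mul1r big1 // => i _; rewrite ffunE.
Qed.

Lemma block_cube_abs M : (forall i, i \in B -> `|s i| <= 4^-1) ->
  \sum_(k : cube M | supported ord0 B k) `|block_coef (fun i => (k i : nat)) * \prod_(i in B) s i ^+ k i| <= 2.
Proof.
move=> hs.
apply: (@le_trans _ _ (\sum_(k : cube M | supported ord0 B k)
   ([forall i in B, (k i : nat) == 0%N]%:R * \prod_(i in B) s i ^+ k i +
    [forall i in B, (0 < k i)%N]%:R * \prod_(i in B) `|s i| ^+ k i))).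
  apply: ler_sum => k _; rewrite normrM normr_prod.
  have -> : \prod_(i in B) `|s i ^+ k i| = \prod_(i in B) `|s i| ^+ k i.
    by apply: eq_bigr => i _; rewrite normrX.
  apply: le_trans (ler_wpM2r _ (block_coef_abs _)) _.
    by apply: prodr_ge0 => i _; rewrite exprn_ge0.
  rewrite mulrDl lerD2r //.
  case: (boolP [forall i in B, (k i : nat) == 0%N]) => [/'forall_implyP h|_]; last by rewrite !mul0r.
  by rewrite !mul1r !big1 // => i /h /eqP ->.
rewrite big_split /= sum_supported_zero.
have h i : i \in B -> 0 <= `|s i| <= 2^-1.
  move=> /hs h; rewrite normr_ge0 /=; apply: le_trans h _; lra.
apply: (@le_trans _ _ (1 + 1)); last by lra.
by rewrite lerD2l; exact: sum_pos_geometric.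
Qed.

Definition pos_sum M : R := \sum_(k : cube M | supported ord0 B k)
  [forall i in B, (0 < k i)%N]%:R * (\prod_(i in B) s i ^+ k i) * bern R (\sum_(i in B) k i).

Lemma block_cube_sum M :
  \sum_(k : cube M | supported ord0 B k) block_coef (fun i => (k i : nat)) * \prod_(i in B) s i ^+ k i =
  1 - (-1) ^+ #|B| * pos_sum M.
Proof.
rewrite -[X in X - _](sum_supported_zero M) /pos_sum mulr_sumr -sumrB; apply: eq_bigr => k _.
by rewrite block_coefE mulrBl; congr (_ - _); rewrite -!mulrA [bern _ _ * _]mulrC.
Qed.

Lemma compos_poly_bern M :
  \sum_(n < M.+1) bern R n * (compos_poly s M.+1 B)`_n =
  \sum_(k : cube M | supported ord0 B k)
    [forall i in B, (0 < k i)%N]%:R * (\prod_(i in B) s i ^+ k i) *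
    (if (\sum_(i in B) k i < M.+1)%N then bern R (\sum_(i in B) k i) else 0).
Proof.
have -> : compos_poly s M.+1 B = \sum_(k : cube M | supported ord0 B k)
   ([forall i in B, (0 < k i)%N]%:R * \prod_(i in B) s i ^+ k i) *: 'X^(\sum_(i in B) k i).
  rewrite /compos_poly /tail_poly; under eq_bigr do rewrite poly_def.
  rewrite (prod_sum_supported ord0 B (fun i (j : 'I_M.+1) => ((0 < j)%N%:R * s i ^+ j) *: 'X^j)).
  by apply: eq_bigr => k _; rewrite scaler_prod prodrXr prod_pos_pow.
under eq_bigr do rewrite coef_sum mulr_sumr.
rewrite exchange_big /=; apply: eq_bigr => k _.
under eq_bigr do rewrite coefZ coefXn mulrCA.
rewrite -mulr_sumr; congr (_ * _).
case: ifP => h; last first.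
  rewrite big1 // => n _; case: eqP => [e|_]; rewrite ?mulr0 //.
  by have := ltn_ord n; rewrite e h.
move: (\sum_(i in B) k i)%N h => m h.
rewrite (bigD1 (Ordinal h)) //= eqxx mulr1 big1 ?addr0 // => n ne.
case: eqP => [e|_]; rewrite ?mulr0 //.
by case/eqP: ne; apply/val_inj.
Qed.

(** The box of exponents and the truncation by total degree differ only in monomials of degree above
    M. Comparison with the geometric sum at 2 |s_i| <= 1/2 gains the factor 2^(-M); this is the
    origin of the radius 1/4. *)
Lemma pos_sum_tail M : (forall i, i \in B -> `|s i| <= 4^-1) ->
  `|pos_sum M - \sum_(n < M.+1) bern R n * (compos_poly s M.+1 B)`_n| <= (2^-1) ^+ M.
Proof.
move=> hs; rewrite compos_poly_bern /pos_sum -sumrB.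
apply: le_trans (ler_norm_sum _ _ _) _.
have h i : i \in B -> 0 <= 2 * `|s i| <= 2^-1.
  move=> /hs h; rewrite mulr_ge0 //=; lra.
have e0 : 0 <= (2^-1) ^+ M :> R by rewrite exprn_ge0.
apply: (@le_trans _ _ ((2^-1) ^+ M * 1)); last by rewrite mulr1.
apply: le_trans (ler_wpM2l e0 (sum_pos_geometric M h)).
rewrite mulr_sumr; apply: ler_sum => k _; rewrite -mulrBr.
case: ifP => hk; first by rewrite subrr mulr0 normr0 !mulr_ge0 // prodr_ge0 // => i _; rewrite exprn_ge0 // mulr_ge0.
rewrite subr0 !normrM normr_nat mulrCA -mulrA ler_wpM2l //.
have -> : \prod_(i in B) (2 * `|s i|) ^+ k i = 2 ^+ (\sum_(i in B) k i) * \prod_(i in B) `|s i| ^+ k i.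
  by rewrite -prodrXr -big_split /=; apply: eq_bigr => i _; rewrite exprMn.
rewrite normr_prod mulrA.
have -> : \prod_(i in B) `|s i ^+ k i| = \prod_(i in B) `|s i| ^+ k i.
  by apply: eq_bigr => i _; rewrite normrX.
rewrite mulrC ler_wpM2r ?prodr_ge0 //.
apply: le_trans (bern_le1 _ _) _.
rewrite exprVn mulrC ler_pdivlMr ?exprn_gt0 // mul1r ler_weXn2l ?ler1n //.
by move: hk; move/negbT; rewrite -leqNgt => /ltnW.
Qed.

Lemma pos_sum_cvg : (forall i, i \in B -> (s i != 0) && (`|s i| <= 4^-1)) -> {in B &, injective s} ->
  1 - (-1) ^+ #|B| * pos_sum M @[M --> \oo] -->
  \sum_(b in B) todd (s b) * \prod_(g in B :\ b) (s g / (s g - s b)).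
Proof.
move=> hs sI.
have hs4 i : i \in B -> `|s i| <= 4^-1 by case/hs/andP.
set G := \sum_(b in B) _.
have c1 : \sum_(0 <= n < M) bern R n * interp s n B @[M --> \oo] --> G.
  have : \sum_(b in B) (\sum_(0 <= n < M) bern R n * s b ^+ n) * \prod_(g in B :\ b) (s g / (s g - s b))
     @[M --> \oo] --> G.
    apply: (@cvg_big _ _ +%R 0) => [|b bB]; first exact: add_continuous.
    have /andP[sb0 sb4] := hs b bB.
    apply: cvgMl; apply: todd_series => //; apply: le_lt_trans sb4 _; lra.
  apply: cvg_trans; apply: near_eq_cvg; apply: nearW => M.
  rewrite /interp; under eq_bigr do rewrite mulr_suml.
  rewrite exchange_big /=; apply: eq_bigr => n _.
  by rewrite mulr_sumr; apply: eq_bigr => b _; rewrite mulrA.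
have c1' : \sum_(0 <= n < M.+1) bern R n * interp s n B @[M --> \oo] --> G.
  by move: c1; rewrite -(cvg_shiftS (fun M => \sum_(0 <= n < M) bern R n * interp s n B)).
have c2 : (-1) ^+ #|B| * (pos_sum M - \sum_(n < M.+1) bern R n * (compos_poly s M.+1 B)`_n) @[M --> \oo] --> (0 : R).
  rewrite -[X in _ --> X](mulr0 ((-1) ^+ #|B|)); apply: cvgMr.
  apply: norm_cvg0; apply: (squeeze_cvgr (f := fun=> 0) (h := fun M => (2^-1) ^+ M)).
  - by apply: nearW => M; rewrite normr_ge0 pos_sum_tail.
  - exact: cvg_cst.
  - have := @cvg_expr R (2^-1).
    by rewrite ger0_norm ?invr_ge0 // invf_lt1 // ltr1n => /(_ isT).
rewrite -[G]subr0; apply: cvg_trans (cvgB c1' c2); apply: near_eq_cvg; apply: nearW => M.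
rewrite !fctE /= mulrBr.
have -> : \sum_(0 <= n < M.+1) bern R n * interp s n B =
   1 - (-1) ^+ #|B| * \sum_(n < M.+1) bern R n * (compos_poly s M.+1 B)`_n.
  rewrite big_mkord; under eq_bigr => n _ do rewrite (interp_compos (ltn_ord n)) // mulrBr.
  rewrite sumrB; congr (_ - _); last by rewrite mulr_sumr; apply: eq_bigr => n _; rewrite mulrCA.
  by rewrite big_ord_recl /= mulr1 big1 ?addr0 // => n _; rewrite mulr0.
by rewrite opprB addrA subrK.
Qed.

End BlockExpansion.

(** * The Taylor coefficients of the generating function *)

Section FlatExpansion.
Variables (R : realType) (r : nat).
Implicit Types (S V : {set PR r}) (i j g : 'I_r).
Local Notation A := (short_roots r).
Local Notation zero_block := (@zero_block R r).
Local Notation rep := (@rep R r).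
Local Notation is_rep := (@is_rep R r).
Local Notation bsign := (@bsign R r).
Local Notation in_block := (@in_block R r).
Local Notation cube M := {ffun 'I_r -> 'I_M.+1}.

Definition block S i : {set 'I_r} := [set j | in_block S i j].

Lemma block_neq0 S i : is_rep S i -> block S i != finset.set0.
Proof. by move=> /andP[iZ /eqP e]; apply/set0Pn; exists i; rewrite inE /in_block iZ e eqxx. Qed.

(** The term of [S] does not involve the variables of the zero block, so their exponents have to be
    0. *)
Definition zero_on S (k : 'I_r -> nat) : bool := [forall i in zero_block S, k i == 0%N].

Lemma sum_cube_blocks S M (a : 'I_r -> cube M -> R) : (forall i, local_on (block S i) (a i)) ->
  \sum_(k : cube M) (zero_on S (fun i => k i))%:R * \prod_(i | is_rep S i) a i k =
  \prod_(i | is_rep S i) \sum_(k : cube M | supported ord0 (block S i) k) a i k.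
Proof.
move=> la; pose l := [seq i <- index_enum 'I_r | is_rep S i].
rewrite -[RHS]big_filter -/l -(@sum_supported_prod _ _ ord0 _ _ l (block S)) //; first last.
- move=> i j _ _ ij m; rewrite !inE => /andP[_ /eqP e]; rewrite /in_block e.
  by rewrite negb_and negbK ij orbT.
- by rewrite filter_uniq // index_enum_uniq.
rewrite [RHS]big_mkcond; apply: eq_bigr => k _.
have -> : zero_on S (fun i => k i) = supported ord0 (\bigcup_(x <- l) block S x) k.
  rewrite finset.bigcup_seq; apply/'forall_implyP/supportedP => h i.
    move=> iU; apply/val_inj/eqP/h; apply: contraR iU => iZ.
    apply/finset.bigcupP; exists (rep S i); last by rewrite inE in_block_rep.
    by rewrite mem_filter mem_index_enum is_rep_rep.
  move=> iZ; rewrite h //; apply/negP => /finset.bigcupP [j _].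
  by rewrite inE /in_block iZ.
by case: ifP => _; rewrite ?mul1r ?mul0r // -big_filter.
Qed.

Variable phi : 'rV[R]_r.

Definition flat_coef S (k : 'I_r -> nat) : R :=
  (zero_on S k)%:R * (\prod_j phi_sign phi S j ^+ k j) *
  \prod_(i | is_rep S i) block_coef R (block S i) k.

Lemma flat_coef_term S (k : 'I_r -> nat) (t : 'I_r -> R) :
  flat_coef S k * \prod_j t j ^+ k j =
  (zero_on S k)%:R * \prod_(i | is_rep S i)
     (block_coef R (block S i) k * \prod_(j in block S i) (phi_sign phi S j * t j) ^+ k j).
Proof.
rewrite /flat_coef; case: (boolP (zero_on S k)) => [/'forall_implyP h|]; last by rewrite !mul0r.
rewrite !mul1r [RHS]big_split /= mulrAC mulrC; congr (_ * _).
rewrite -big_split /= (bigID (fun j => j \in zero_block S)) /= big1 ?mul1r; last first.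
  by move=> j /h /eqP ->; rewrite mulr1.
rewrite (partition_big (rep S) (is_rep S)) /=; last by move=> j; exact: is_rep_rep.
apply: eq_bigr => i ri; apply: eq_big => [j|j _]; first by rewrite [RHS]finset.in_set.
by rewrite exprMn.
Qed.

Lemma block_term_local S i M (t : 'I_r -> R) :
  local_on (block S i) (fun k : cube M => block_coef R (block S i) (fun j => k j) *
     \prod_(j in block S i) (phi_sign phi S j * t j) ^+ k j).
Proof.
move=> k k' kk; rewrite (@block_coef_local _ _ _ _ (fun j => k' j)) => [|j jB]; last by rewrite kk.
by congr (_ * _); apply: eq_bigr => j jB; rewrite kk.
Qed.

Lemma flat_cube_sum S M (t : 'I_r -> R) :
  \sum_(k : cube M) flat_coef S (fun i => k i) * \prod_j t j ^+ k j =
  \prod_(i | is_rep S i) (1 - (-1) ^+ #|block S i| * pos_sum (block S i) (fun j => phi_sign phi S j * t j) M).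
Proof.
under [LHS]eq_bigr => k _ do rewrite (flat_coef_term S (fun i => k i) t).
rewrite (sum_cube_blocks (fun i => @block_term_local S i M t)); apply: eq_bigr => i ri.
by rewrite block_cube_sum // block_neq0.
Qed.

Lemma phi_sign_abs S j : `|phi_sign phi S j| <= 1.
Proof. by rewrite /phi_sign normr_sg; case: (_ != 0); rewrite ?ler01. Qed.

Lemma flat_cube_abs S M (t : 'I_r -> R) : (forall i, `|t i| < 4^-1) ->
  \sum_(k : cube M) `|flat_coef S (fun i => k i) * \prod_j t j ^+ k j| <= 2 ^+ r.
Proof.
move=> ht; under eq_bigr do rewrite flat_coef_term normrM normr_nat normr_prod.
rewrite sum_cube_blocks; last by move=> i k k' kk; congr (`|_|); exact: block_term_local.
apply: (@le_trans _ _ (\prod_(i | is_rep S i) 2)).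
  apply: ler_prod => i ri; rewrite sumr_ge0 //=; apply: block_cube_abs => j _.
   rewrite normrM; apply: le_trans (ltW (ht j)).
  by rewrite ler_piMl // phi_sign_abs.
rewrite prodr_const; apply: ler_weXn2l; first by rewrite ler1n.
by rewrite -[X in (_ <= X)%N]card_ord max_card.
Qed.

Section Coefficients.
Variable nu : seq (PR r).
Hypothesis hnu : perm_eq nu (enum A).
Hypothesis hphi : forall V, Bases R r V -> forall b, b \in V -> dotv phi (mu R V b) != 0.
Variable i0 : 'I_r.

Definition nbc_flat S : bool := (S \subset A) && `[< nbc R nu S >].

Definition long_coef (k : 'I_r -> nat) : R :=
  (\prod_j (k j)`!%:R) * \sum_(S | nbc_flat S) (-1) ^+ #|S| * flat_coef S k.

Lemma coef_term_long (k : 'I_r -> nat) (t : 'I_r -> R) :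
  coef_term long_coef k t = \sum_(S | nbc_flat S) (-1) ^+ #|S| * (flat_coef S k * \prod_j t j ^+ k j).
Proof.
rewrite /coef_term /long_coef big_split /=.
set P := \prod_j _; set X := \sum_(S | _) _; set Y := \prod_(i < r) t i ^+ k i; set Z := \prod_(i < r) _.
have PZ : P * Z = 1.
  by rewrite -big_split /= big1 // => j _; rewrite mulfV // pnatr_eq0 -lt0n fact_gt0.
have -> : P * X * (Y * Z) = (P * Z) * (X * Y) by ring.
by rewrite PZ mul1r mulr_suml; apply: eq_bigr => S _; rewrite -mulrA.
Qed.

(** For g and b in one block, the basis that takes [b] as the long root of that block has, at g, a
    denominator proportional to the difference of the two values; [Freg] says that it is nonzero. *)
Lemma Freg_injective (t : 'I_r -> R) S i : Freg (Dlong r) nu (tlong t) -> nbc_flat S ->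
  {in block S i &, injective (fun j => phi_sign phi S j * t j)}.
Proof.
move=> [_ reg] /andP[SA /asboolP nS] g b; rewrite !inE => /andP[gZ /eqP eg] /andP[bZ /eqP eb] e.
apply/eqP/negPn/negP => gb.
have liS := nbc_lin_indep hnu SA nS.
pose h m := if m == i then b else m.
have hh m : is_rep S m -> in_block S m (h m).
  rewrite /h => /andP[mZ /eqP em]; case: eqP => [->|_]; first by rewrite /in_block bZ eb eqxx.
  by rewrite /in_block mZ em eqxx.
have bV := extend_basis SA liS hh; have VS := @extend_short R r S h SA.
have VV : VA R nu (extend R S h) by apply/(VA_nbc R hnu); rewrite VS.
have gV : long_root g \notin extend R S h.
  by rewrite (long_in_V SA hh) gZ eg /h eqxx eq_sym.
have gD : long_root g \in Dplus r :\: (extend R S h :|: (Dplus r :\: Dlong r)).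
  rewrite finset.in_setD finset.in_setU negb_or gV short_rootsE ltnn /=.
  by rewrite (fintype.subsetP (Dlong_sub_Dplus r) _ (Dlong_long_root g)).
have := reg _ VV _ gD.
rewrite -/A (linear_form_long SA liS hh) (negPf gZ) eg /h eqxx /= => /eqP; apply.
have egb : rep S g = rep S b by rewrite eg eb.
have p0 : phi_sign phi S b != 0.
  by rewrite sgr_eq0; exact: (phi_block_vec_neq0 SA liS hh hphi bZ).
move: e; rewrite /= (phi_sign_same phi egb); set x := bsign S g * bsign S b.
have x2 : x * x = 1 by rewrite /x mulrACA !bsign_sqr mulr1.
move=> e; apply/eqP; rewrite subr_eq0; apply/eqP/(mulfI p0).
by rewrite mulrCA -e mulrA mulrA x2 mul1r.
Qed.

Lemma IsCoefLong_long_coef : IsCoefLong nu phi long_coef.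
Proof.
exists 4^-1; first by rewrite invr_gt0.
move=> t ht reg.
have t0 i : t i != 0 by have [/(_ (long_root i)) h _] := reg; apply: h; exact: Dlong_long_root.
split.
  (* For M = 0 there is no exponent at all, because of the index [i0]; for larger boxes each flat is
     bounded by 2 ^+ r, a factor 2 per block. *)
  exists (\sum_(S | nbc_flat S) 2 ^+ r) => -[|M].
    rewrite big1; first by apply: sumr_ge0 => S _; exact: exprn_ge0.
    by move=> k; have := ltn_ord (k i0).
  apply: (@le_trans _ _ (\sum_(k : cube M) \sum_(S | nbc_flat S)
       `|flat_coef S (fun i => k i) * \prod_j t j ^+ k j|)).
    apply: ler_sum => k _; rewrite coef_term_long; apply: le_trans (ler_norm_sum _ _ _) _.
    by apply: ler_sum => S _; rewrite normrM normrX normrN1 expr1n mul1r.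
  by rewrite exchange_big /=; apply: ler_sum => S _; exact: flat_cube_abs.
rewrite (Fgen_flats hnu hphi i0 t0).
rewrite -(cvg_shiftS (fun M => \sum_(k : {ffun 'I_r -> 'I_M}) coef_term long_coef (fun i => k i) t)).
have : \sum_(S | nbc_flat S) (-1) ^+ #|S| *
     \prod_(i | is_rep S i) (1 - (-1) ^+ #|block S i| * pos_sum (block S i) (fun j => phi_sign phi S j * t j) M)
     @[M --> \oo] --> \sum_(S | nbc_flat S)
     (-1) ^+ #|S| * \prod_(i | is_rep S i) block_sum S i (fun j => phi_sign phi S j * t j).
  apply: (@cvg_big _ _ +%R 0) => [|S nS]; first exact: add_continuous.
  apply: cvgMr; apply: (@cvg_big R _ (@GRing.mul R) 1) => [|i ri]; first exact: mul_continuous.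
  have -> : block_sum S i (fun j => phi_sign phi S j * t j) =
    \sum_(b in block S i) todd (phi_sign phi S b * t b) *
      \prod_(g in block S i :\ b) (phi_sign phi S g * t g / (phi_sign phi S g * t g - phi_sign phi S b * t b)).
    rewrite /block_sum; apply: eq_big => [b|b _]; first by rewrite inE.
    by congr (_ * _); apply: eq_bigl => g; rewrite !inE andbC.
  apply: pos_sum_cvg; last exact: Freg_injective.
  move=> j; rewrite inE => /andP[jZ _].
  have [SA /asboolP nS'] := andP nS; have liS := nbc_lin_indep hnu SA nS'.
  have hh m : is_rep S m -> in_block S m (id m) by rewrite /in_block => /andP[-> ->].
  rewrite mulf_neq0 //=; last by rewrite sgr_eq0; exact: (phi_block_vec_neq0 SA liS hh hphi jZ).
  by rewrite normrM; apply: le_trans (ltW (ht j)); rewrite ler_piMl // phi_sign_abs.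
apply: cvg_trans; apply: near_eq_cvg; apply: nearW => M /=.
under [RHS]eq_bigr do rewrite coef_term_long.
rewrite exchange_big /=; apply: eq_bigr => S _.
by rewrite -mulr_sumr flat_cube_sum.
Qed.

End Coefficients.
End FlatExpansion.

(** * Uniqueness of the Taylor family *)

Lemma sum_digits_inj (r b : nat) (k k' : 'I_r -> nat) :
  (forall i, k i < b)%N -> (forall i, k' i < b)%N ->
  (\sum_(i < r) k i * b ^ i = \sum_(i < r) k' i * b ^ i)%N -> k =1 k'.
Proof.
elim: r k k' => [|r IH] k k' hk hk' e; first by case.
have b0 : (0 < b)%N by apply: leq_ltn_trans (hk ord0).
have st (f : 'I_r.+1 -> nat) :
    (\sum_(i < r.+1) f i * b ^ i = f ord0 + b * \sum_(i < r) f (lift ord0 i) * b ^ i)%N.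
  rewrite big_ord_recl expn0 muln1; congr (_ + _)%N.
  by rewrite big_distrr /=; apply: eq_bigr => i _; rewrite /bump add1n expnS mulnCA.
move: e; rewrite !st => e.
have e0 : k ord0 = k' ord0.
  have := congr1 (fun m => m %% b)%N e.
  by rewrite !(addnC (_ ord0)) ![(b * _)%N]mulnC !modnMDl !modn_small.
move: e => /eqP; rewrite e0 eqn_add2l eqn_pmul2l // => /eqP e.
have h := IH _ _ (fun i => hk (lift ord0 i)) (fun i => hk' (lift ord0 i)) e.
by move=> i; have [j ->|->] := unliftP ord0 i; [exact: h|].
Qed.

Section Uniqueness.
Variables (R : realType) (r : nat).
Local Notation wt w k := (\sum_(i < r) k i * w i)%N.

(* With [n] the least total degree of a monomial of [c], weights [W + (n+2)^i] with [W] large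
   single out one monomial: it is the dominant term along the curve [t_i = u^(w_i)]. *)
Lemma exists_dominant (c : ('I_r -> nat) -> R) : (exists k, c k != 0) ->
  exists w k0, [/\ forall i, (0 < w i)%N, injective w, c k0 != 0 &
    forall k, c k != 0 -> k <> k0 -> (wt w k0 < wt w k)%N].
Proof.
move=> [k1 ck1].
pose Pdeg n := `[< exists2 k : 'I_r -> nat, c k != 0 & (\sum_(i < r) k i = n)%N >].
have exdeg : exists n, Pdeg n by exists (\sum_(i < r) k1 i)%N; apply/asboolP; exists k1.
have [n /asboolP [kn ckn dn] nmin] := ex_minnP exdeg.
(* [W] exceeds the contribution of the powers of [b] at degree n, so a monomial of least weight has
   degree n; [b] exceeds every exponent of such a monomial, so these are the digits of a number in
   base [b] and the weight determines them. *)
pose b := n.+2; pose W := (n * b ^ r).+1; pose w (i : 'I_r) := (W + b ^ i)%N.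
pose Pwt m := `[< exists2 k : 'I_r -> nat, c k != 0 & wt w k = m >].
have exwt : exists m, Pwt m by exists (wt w k1); apply/asboolP; exists k1.
have [m /asboolP [k0 ck0 wk0] mmin] := ex_minnP exwt.
have wE k : wt w k = (W * \sum_(i < r) k i + \sum_(i < r) k i * b ^ i)%N.
  rewrite big_distrr /= -big_split /=; apply: eq_bigr => i _.
  by rewrite /w mulnDr [(k i * W)%N]mulnC.
have le_deg k : (wt w k <= wt w kn)%N -> (\sum_(i < r) k i <= n)%N.
  rewrite !wE dn => h; rewrite leqNgt; apply/negP => h1.
  have h2 : (\sum_(i < r) kn i * b ^ i <= n * b ^ r)%N.
    rewrite -dn big_distrl /=; apply: leq_sum => i _.
    by rewrite leq_mul2l leq_pexp2l ?orbT // ltnW.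
  have h3 : (W * n.+1 <= W * \sum_(i < r) k i)%N by rewrite leq_mul2l h1 orbT.
  have : (W * n.+1 <= W * n + n * b ^ r)%N.
    by apply: leq_trans h3 _; apply: leq_trans (leq_addr _ _) _; apply: leq_trans h _; rewrite leq_add2l.
  by rewrite mulnS addnC leq_add2l /W ltnn.
exists w, k0; split=> //.
- by move=> i j /eqP; rewrite /w eqn_add2l eqn_exp2l // => /eqP /val_inj.
- move=> k ck kk0; rewrite ltn_neqAle; apply/andP; split; last first.
    by rewrite wk0; apply: mmin; apply/asboolP; exists k.
  apply/eqP => e; apply: kk0; apply/funext.
  have w0n : (wt w k0 <= wt w kn)%N by rewrite wk0; apply: mmin; apply/asboolP; exists kn.
  have d0 : (\sum_(i < r) k0 i = n)%N.
    apply/eqP; rewrite eqn_leq le_deg //=; apply: nmin; apply/asboolP; by exists k0.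
  have dk : (\sum_(i < r) k i = n)%N.
    apply/eqP; rewrite eqn_leq le_deg -?e //=; apply: nmin; apply/asboolP; by exists k.
  apply: (@sum_digits_inj r b).
  + by move=> i; rewrite ltnS -dk ltnW // ltnS (bigD1 i) //= leq_addr.
  + by move=> i; rewrite ltnS -d0 ltnW // ltnS (bigD1 i) //= leq_addr.
  + by move: e; rewrite !wE d0 dk => /eqP; rewrite eqn_add2l => /eqP.
Qed.

(** Let m be the weight of the dominant monomial and u = u0 q. That monomial has size D q^m, while
    all others together are at most B q^(m+1), where B bounds the absolute sum at u0. A zero limit
    gives D <= B q for every q in (0, 1], which is absurd. *)
Lemma cube_series_unique (c : ('I_r -> nat) -> R) (delta : R) : 0 < delta ->
  (forall t : 'I_r -> R, (forall i, 0 < t i < delta) -> injective t ->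
    (exists B : R, forall M : nat,
       \sum_(k : {ffun 'I_r -> 'I_M}) `|c (fun i => k i) * \prod_i t i ^+ k i| <= B)
    /\ \sum_(k : {ffun 'I_r -> 'I_M}) c (fun i => k i) * \prod_i t i ^+ k i @[M --> \oo] --> (0 : R)) ->
  forall k, c k = 0.
Proof.
move=> d0 h k; apply/eqP/negPn/negP => ck.
have [|w [k0 [w0 wI ck0 dom]]] := @exists_dominant c; first by exists k.
pose u0 : R := Num.min delta 1 / 2.
have m0 : 0 < Num.min delta 1 by rewrite lt_min d0 ltr01.
have u00 : 0 < u0 by rewrite divr_gt0.
have u0d : u0 < delta.
  by apply: (@lt_le_trans _ _ (Num.min delta 1)); [rewrite /u0; lra|rewrite ge_min lexx].
have u01 : u0 < 1.
  by apply: (@lt_le_trans _ _ (Num.min delta 1)); [rewrite /u0; lra|rewrite ge_min lexx orbT].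
have tpos (u : R) : 0 < u <= u0 -> forall i, 0 < u ^+ w i < delta.
  move=> /andP[up uu] i; have u1 : u <= 1 by apply: le_trans uu _; exact: ltW.
  rewrite exprn_gt0 //=; apply: le_lt_trans u0d; apply: le_trans uu.
  by case: (w i) (w0 i) => // m _; rewrite exprS ler_piMr ?(ltW up) // exprn_ile1 // ltW.
have tinj (u : R) : 0 < u <= u0 -> injective (fun i => u ^+ w i).
  move=> /andP[up uu] i j /eqP e; apply: wI; apply/eqP; move: e; apply: contraTT => ne.
  have u1 : u < 1 by apply: le_lt_trans uu u01.
  have lt m n : (m < n)%N -> u ^+ n != u ^+ m by move=> mn; rewrite lt_eqF // ltr_iXn2l.
  by move: ne; rewrite neq_ltn => /orP[] /lt //; rewrite eq_sym.
have prodE (u : R) (m : 'I_r -> nat) : \prod_i (u ^+ w i) ^+ m i = u ^+ wt w m.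
  by rewrite -prodrXr; apply: eq_bigr => i _; rewrite -exprM mulnC.
have u0b : 0 < u0 <= u0 by rewrite u00 lexx.
have [[B hB] _] := h _ (tpos u0 u0b) (tinj u0 u0b).
have B0 : 0 <= B by apply: le_trans (hB 0%N); apply: sumr_ge0.
pose D := `|c k0| * u0 ^+ wt w k0.
have D0 : 0 < D by rewrite mulr_gt0 ?normr_gt0 // exprn_gt0.
suff key q : 0 < q <= 1 -> D <= B * q.
  have q01 : 0 < D / (2 * (D + B)) <= 1.
    have p : 0 < 2 * (D + B) by rewrite mulr_gt0 // ltr_pwDl.
    by rewrite divr_gt0 //= ler_pdivrMr // mul1r; lra.
  have := key _ q01; rewrite mulrA ler_pdivlMr; last by rewrite mulr_gt0 // ltr_pwDl.
  nra.
move=> /andP[q0 q1]; pose u := u0 * q.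
have ub : 0 < u <= u0 by rewrite mulr_gt0 //= ler_piMr // ltW.
have [_ lim0] := h _ (tpos u ub) (tinj u ub).
have lim1 : `|\sum_(k : {ffun 'I_r -> 'I_M}) c (fun i => k i) * \prod_i (u ^+ w i) ^+ k i|
    @[M --> \oo] --> (0 : R).
  by rewrite -[X in _ --> X](@normr0 _ R); exact: cvg_norm lim0.
pose M0 := (\sum_(i < r) k0 i).+1.
have : `|c k0| * u ^+ wt w k0 - B * q ^+ (wt w k0).+1 <= 0.
  apply: (cvgr_to_ge lim1); exists M0 => // M /= hM.
  have k0M i : (k0 i < M)%N.
    by apply: leq_trans hM; rewrite ltnS (bigD1 i) //= leq_addr.
  pose kk : {ffun 'I_r -> 'I_M} := [ffun i => Ordinal (k0M i)].
  have kkE : (fun i => kk i : nat) = k0 by apply/funext => i; rewrite ffunE.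
  rewrite (bigD1 kk) //= kkE.
  have -> : \prod_i (u ^+ w i) ^+ kk i = u ^+ wt w k0.
    by rewrite -prodE; apply: eq_bigr => i _; rewrite ffunE.
  set rest : R := \sum_(j | j != kk) _.
  have hr : `|rest| <= B * q ^+ (wt w k0).+1.
    apply: le_trans (ler_norm_sum _ _ _) _.
    rewrite mulrC; apply: le_trans (ler_wpM2l _ (hB M)); last by rewrite exprn_ge0 // ltW.
    rewrite mulr_sumr [leRHS](bigD1 kk) //= ler_wpDl //.
      by rewrite mulr_ge0 // exprn_ge0 // ltW.
    apply: ler_sum => m mk; rewrite !prodE !normrM.
    have [->|cm] := eqVneq (c (fun i => m i)) 0; first by rewrite normr0 !mul0r mulr0.
    rewrite mulrCA ler_wpM2l // !ger0_norm ?exprn_ge0 ?(ltW u00) //; last first.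
      by case/andP: ub => /ltW.
    rewrite /u exprMn mulrC ler_wpM2r ?exprn_ge0 ?(ltW u00) //.
    apply: ler_wiXn2l; rewrite ?(ltW q0) //.
    apply: (dom _ cm) => e; case/eqP: mk; apply/ffunP => i; rewrite ffunE; apply/val_inj => /=.
    exact: (congr1 (fun f => f i) e).
  have : `|c k0 * u ^+ wt w k0| <= `|c k0 * u ^+ wt w k0 + rest| + `|rest|.
    by rewrite -[X in `|X| <= _](addrK rest) ler_normB.
  have upos : 0 <= u ^+ wt w k0 by rewrite exprn_ge0 //; case/andP: ub => /ltW.
  rewrite normrM (ger0_norm upos) => hx.
  by rewrite lerBlDr; apply: le_trans hx _; rewrite lerD2l.
rewrite subr_le0 /u exprMn mulrA -/D exprS mulrA ler_pM2r //.
by rewrite exprn_gt0.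
Qed.

Variables (nu : seq (PR r)) (phi : 'rV[R]_r).
Hypothesis hnu : perm_eq nu (enum (short_roots r)).
Hypothesis hphi : forall V, Bases R r V -> forall b, b \in V -> dotv phi (mu R V b) != 0.
Variable i0 : 'I_r.

(** Every denominator is t_g, t_g - t_b or t_g + t_b with b different from g. *)
Lemma Freg_generic (t : 'I_r -> R) : (forall i, 0 < t i) -> injective t -> Freg (Dlong r) nu (tlong t).
Proof.
move=> t0 tI; split; first by move=> a /mem_Dlong ->; rewrite gt_eqF //=.
move=> V /(VA_nbc R hnu) [bV nV] a; rewrite -/(short_roots r) => aD.
have aE : a = long_root a.1.1.
  apply: mem_Dlong; move: aD; rewrite finset.in_setD finset.in_setU negb_or finset.in_setD.
  by case/andP => /andP[_ h1] aD; move: h1; rewrite aD andbT negbK.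
move: aE aD; move: (a.1.1) => g -> aD {a}.
have liS := nbc_lin_indep hnu (finset.subsetIr _ _) nV.
have VS : extend R (V :&: short_roots r) (longs_of R i0 (V :&: short_roots r) V) = V.
  exact: extend_longs_of.
have hh i : is_rep R (V :&: short_roots r) i ->
    in_block R (V :&: short_roots r) i (longs_of R i0 (V :&: short_roots r) V i).
  move=> ri; have /andP[h1 h2] := longs_ofP i0 bV erefl ri.
  by rewrite /in_block h2 andbT (basis_long_notin_zero bV h1).
have := linear_form_long (finset.subsetIr _ _) liS hh t g.
rewrite VS => ->; case: ifP => gZ; first by rewrite subr0 /tlong /= gt_eqF.
set S := V :&: _; set b := longs_of _ _ _ _ _.
have gb : g != b.
  move: aD; rewrite finset.in_setD => /andP[+ _]; apply: contra => /eqP e.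
  rewrite finset.in_setU -{1}VS (long_in_V (finset.subsetIr _ _) hh) gZ /=.
  by rewrite -/S -/b -e eqxx.
apply/eqP => /eqP; rewrite subr_eq0 /tlong /= => /eqP e.
have : bsign R S g * bsign R S b = 1 \/ bsign R S g * bsign R S b = -1.
  by rewrite /bsign; case: ifP => _; case: ifP => _; rewrite ?mulr1 ?mul1r ?mulN1r ?opprK; auto.
case=> h; move: e; rewrite h ?mul1r ?mulN1r; first by move/tI/eqP; rewrite (negPf gb).
by move=> e; have := t0 g; rewrite e oppr_gt0 ltNge (ltW (t0 _)).
Qed.

(** The family picked by [epsilon] satisfies its specification because [long_coef] does; uniqueness
    is applied to the difference of the two, divided by the factorials, within the smaller of the
    two radii. *)
Lemma Pcoef_long_coef k : Pcoef nu phi k = long_coef phi nu k.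
Proof.
have hc : IsCoefLong nu phi (long_coef phi nu) := IsCoefLong_long_coef hnu hphi i0.
have hP : IsCoefLong nu phi (Pcoef nu phi).
  by apply: epsilon_spec; exists (long_coef phi nu).
case: hc => d1 d10 h1; case: hP => d2 d20 h2.
have f0 (k' : 'I_r -> nat) : \prod_i ((k' i)`!%:R)^-1 != 0 :> R.
  by apply/prodf_neq0 => i _; rewrite invr_eq0 pnatr_eq0 -lt0n fact_gt0.
apply/eqP; rewrite -subr_eq0; apply/eqP/(mulIf (f0 k)); rewrite mul0r.
apply: (@cube_series_unique (fun k => (Pcoef nu phi k - long_coef phi nu k) * \prod_i ((k i)`!%:R)^-1)
   (Num.min d1 d2)); first by rewrite lt_min d10.
move=> t ht tI; have t0 i : 0 < t i by case/andP: (ht i).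
have reg := Freg_generic t0 tI.
have tn i : `|t i| < Num.min d1 d2 by rewrite gtr0_norm //; case/andP: (ht i).
have minl (a b : R) : Num.min a b <= a by rewrite ge_min lexx.
have minr (a b : R) : Num.min a b <= b by rewrite ge_min lexx orbT.
have [[B1 hB1] l1] := h1 t (fun i => lt_le_trans (tn i) (minl _ _)) reg.
have [[B2 hB2] l2] := h2 t (fun i => lt_le_trans (tn i) (minr _ _)) reg.
have term (k' : 'I_r -> nat) :
    (Pcoef nu phi k' - long_coef phi nu k') * \prod_i ((k' i)`!%:R)^-1 * \prod_i t i ^+ k' i =
    coef_term (Pcoef nu phi) k' t - coef_term (long_coef phi nu) k' t.
  by rewrite /coef_term -mulrBl -mulrA; congr (_ * _); rewrite big_split mulrC.
split.
  exists (B2 + B1) => M; apply: le_trans (lerD (hB2 M) (hB1 M)).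
  by rewrite -big_split; apply: ler_sum => k' _; rewrite (term (fun i => k' i)) ler_normB.
rewrite -[X in _ --> X](subrr (Fgen (Dlong r) nu phi (tlong t) 0)).
apply: cvg_trans (cvgB l2 l1); apply: near_eq_cvg; apply: nearW => M.
rewrite !fctE -sumrB; apply: eq_bigr => k' _; by rewrite (term (fun i => k' i)).
Qed.
End Uniqueness.

(** * Exchanging flats and integer points *)

Section SignedSums.
Variables (R : realType) (r : nat).
Implicit Types (S : {set PR r}) (i j : 'I_r) (l : 'rV[R]_r).
Local Notation A := (short_roots r).
Local Notation zero_block := (@zero_block R r).
Local Notation rep := (@rep R r).
Local Notation is_rep := (@is_rep R r).
Local Notation bsign := (@bsign R r).
Local Notation block := (@block R r).

Definition annihilated l : {set PR r} := [set a in A | dotv (rootv R a) l == 0].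

Lemma in_annihilated l a : (a \in annihilated l) = (a \in A) && (dotv (rootv R a) l == 0).
Proof. by rewrite [LHS]finset.in_set. Qed.

Definition perpb S l : bool := [forall a in S, dotv (rootv R a) l == 0].

Lemma perpP S l : reflect (perp S l) (perpb S l).
Proof. by apply: (iffP 'forall_implyP) => h a /h /eqP. Qed.

Lemma perpb_sub S l : S \subset A -> perpb S l = (S \subset annihilated l).
Proof.
move=> /fintype.subsetP SA; apply/perpP/fintype.subsetP => h a aS.
  by rewrite in_annihilated SA // h ?eqxx.
by have := h a aS; rewrite in_annihilated => /andP[_ /eqP].
Qed.

Section Nbc.
Variable nu : seq (PR r).
Hypothesis hnu : perm_eq nu (enum A).
Local Notation nbc_flat := (nbc_flat R nu).

Lemma nbc_sub S1 S2 : S1 \subset S2 -> nbc R nu S2 -> nbc R nu S1.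
Proof.
move=> s12 n2 j sp; apply: (n2 j); apply: in_span_mono sp.
exact: finset.setSI.
Qed.

(** A violation that involves [x] would be a root after [x] in [nu] lying in the span of [x |: S];
    it would vanish at [l], against the maximality of [x]. *)
Lemma nbc_add S l x : S \subset annihilated l -> x \in annihilated l ->
  (forall a, a \in annihilated l -> (index a nu <= index x nu)%N) ->
  nbc R nu S -> nbc R nu (x |: S).
Proof.
move=> SA xA xmax nS j sp.
have jn := ltn_ord j.
have [xj|jx] := ltnP (index x nu) j; last first.
  apply: (nS j); apply: in_span_mono sp; apply/fintype.subsetP => a.
  rewrite !finset.in_setI finset.in_setU1 => /andP[/orP[/eqP ->|-> ->//]].
  move=> xt0; have xt : x \in take j nu by move: xt0; rewrite finset.in_set.
  have := index_mem x (take j nu); rewrite xt size_take jn => h.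
  have xn : x \in nu by apply: mem_take xt.
  by rewrite in_take // ltnNge jx in xt.
set a := tnth _ j in sp.
have an : a \in nu by apply: mem_tnth.
have ia : index a nu = j.
  by rewrite /a (tnth_nth a) /= index_uniq // (perm_uniq hnu) enum_uniq.
have aA : a \in annihilated l.
  rewrite in_annihilated -(mem_nu hnu) an /=; apply/eqP; apply: perp_span sp _ => b.
  rewrite finset.in_setI finset.in_setU1 => /andP[/orP[/eqP ->|bS] _].
    by move: xA; rewrite in_annihilated => /andP[_ /eqP].
  by have /fintype.subsetP /(_ b bS) := SA; rewrite in_annihilated => /andP[_ /eqP].
by have := xmax a aA; rewrite ia leqNgt xj.
Qed.

Lemma nbc_sign_sum l :
  \sum_(S | nbc_flat S && perpb S l) (-1) ^+ #|S| = (annihilated l == finset.set0)%:R :> R.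
Proof.
have nA : annihilated l \subset A by apply/fintype.subsetP => a; rewrite in_annihilated => /andP[].
have PE S : nbc_flat S && perpb S l = (S \subset annihilated l) && `[< nbc R nu S >].
  rewrite /nbc_flat; case: (boolP (S \subset A)) => SA /=; first by rewrite perpb_sub // andbC.
  by symmetry; apply/negbTE; apply: contra SA => /andP[h _]; apply: fintype.subset_trans nA.
rewrite (eq_bigl _ _ PE).
have [e|/set0Pn [y yA]] := eqVneq (annihilated l) finset.set0.
  rewrite (big_pred1 finset.set0); first by rewrite cards0.
  move=> S; rewrite e finset.subset0; apply: andb_idr => /eqP ->.
  (* Only the empty set is left, and it is admissible since no root is the zero vector. *)
  apply/asboolP => j; rewrite finset.set0I => -[c]; rewrite big_set0 => h.
  have := mem_tnth j (in_tuple nu); rewrite (mem_nu hnu) => aA.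
  have := corootv_short R aA; rewrite h => h2.
  have : dotv (rootv R (tnth (in_tuple nu) j)) (rootv R (tnth (in_tuple nu) j)) = 0.
    by rewrite h /dotv big1 // => k _; rewrite mxE mul0r.
  move: aA; rewrite short_rootsE; case: (tnth _ _) => [[p q] b] /= pq.
  have qp : (q == p) = false by apply/negP => /eqP eqp; rewrite eqp ltnn in pq.
  rewrite dotv_root !mxE !eqxx [p == q]eq_sym qp /=; case: b => /eqP; rewrite ?mulr0 ?mulr1 ?mul1r ?mulN1r ?mulrN1 ?addr0 ?add0r ?opprK.
    by rewrite -mulr2n pnatr_eq0.
  by rewrite -mulr2n pnatr_eq0.
have [x xA xmax] := arg_maxnP (fun a => index a nu) yA.
have {}xA : x \in annihilated l := xA.
rewrite (bigID (fun S => x \in S)) /=.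
rewrite (reindex_onto (fun S => x |: S) (fun S => S :\ x)) /=; last first.
  by move=> S /andP[_ xS]; exact: finset.setD1K.
rewrite -[RHS](subrr (\sum_(S : {set PR r} | (S \subset annihilated l) && `[< nbc R nu S >] && (x \notin S)) (-1) ^+ #|S|)).
rewrite [RHS]addrC; congr (_ + _); rewrite -sumrN; apply: eq_big => [S|S].
  apply/idP/idP.
    case/andP => /andP[/andP[sub /asboolP ns] _] /eqP e.
    have xS : x \notin S by rewrite -e !inE eqxx.
    rewrite xS andbT; apply/andP; split.
      by apply: fintype.subset_trans sub; exact: finset.subsetU1.
    by apply/asboolP; apply: nbc_sub ns; exact: finset.subsetU1.
  case/andP => /andP[sub /asboolP ns] xS.
  rewrite finset.setU1K // eqxx finset.setU11 !andbT finset.subUset finset.sub1set xA sub /=.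
  by apply/asboolP; apply: (nbc_add sub xA).
case/andP => _ /eqP e; have xS : x \notin S by rewrite -e !inE eqxx.
by rewrite cardsU1 xS add1n exprS mulN1r.
Qed.

End Nbc.

Section Truncated.
Variable M : nat.
Local Notation spt := ('I_M.+1 * bool)%type.
Implicit Types (p h : {ffun 'I_r -> spt}) (k : 'I_r -> nat).

(** The shift by one makes the finite type [spt] enumerate exactly the nonzero integers of absolute
    value at most M + 1. *)
Definition signed_val (x : spt) : R := (if x.2 then 1 else -1) * (x.1.+1)%:R.
Definition point p : 'rV[R]_r := \row_i signed_val (p i).
Definition weight k p : R := \prod_i (((p i).1.+1)%:R ^+ k i)^-1.

Lemma signed_val_neq0 x : signed_val x != 0.
Proof.
by rewrite mulf_neq0 ?pnatr_eq0 //; case: (x.2); rewrite ?oppr_eq0 oner_eq0.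
Qed.

Lemma signed_val_norm x : `|signed_val x| = (x.1.+1)%:R.
Proof. by rewrite normrM normr_nat; case: (x.2); rewrite ?normrN normr1 mul1r. Qed.

Lemma signed_val_inj : injective signed_val.
Proof.
move=> [a b] [a' b'] e.
have e1 : a = a'.
  apply/val_inj/eqP; rewrite -eqSS -(eqr_nat R).
  by rewrite -(signed_val_norm (a, b)) e signed_val_norm.
rewrite e1 in e *; congr (_, _); move: e; rewrite /signed_val /= => /eqP.
have a0 : (a'.+1)%:R != 0 :> R by rewrite pnatr_eq0.
rewrite (inj_eq (mulIf a0)); case: b b' => [] [] //.
  by rewrite -subr_eq0 opprK -mulr2n pnatr_eq0.
by rewrite eq_sym -subr_eq0 opprK -mulr2n pnatr_eq0.
Qed.

Definition rep_set S : {set 'I_r} := [set i | is_rep S i].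

(* The signed integer points of the orthogonal complement of [S], parametrised by their values at the
   representatives of the blocks. *)
Definition spread S h : {ffun 'I_r -> spt} :=
  [ffun j => ((h (rep S j)).1, (bsign S j == 1) == (h (rep S j)).2)].

Lemma signed_val_spread S h j : signed_val (spread S h j) = bsign S j * signed_val (h (rep S j)).
Proof.
rewrite ffunE /signed_val /= mulrA; congr (_ * _).
have [-> | e] : bsign S j = 1 \/ bsign S j = -1 by rewrite /bsign; case: ifP; auto.
  by rewrite eqxx mul1r eq_sym; case: (_.2).
have -> : (bsign S j == 1) = false by rewrite e eq_sym -subr_eq0 opprK -mulr2n pnatr_eq0.
by rewrite e mulN1r; case: (_.2); rewrite ?opprK.
Qed.

Lemma zeta_partial_ord m : zeta_partial R m M.+1 = \sum_(n < M.+1) ((n.+1)%:R ^+ m)^-1.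
Proof. by rewrite /zeta_partial big_add1 big_mkord. Qed.

(** A point is free at the representatives and determined elsewhere up to known signs; weights
    ignore signs, so each block gives a zeta sum in the total exponent, doubled by the sign of its
    representative. *)
Lemma sum_perp_points S k :
  \sum_(p | perpb S (point p)) weight k p =
  (zero_block S == finset.set0)%:R *
    \prod_(i | is_rep S i) (2 * zeta_partial R (\sum_(j in block S i) k j)%N M.+1).
Proof.
have [Z0|/set0Pn [i iZ]] := eqVneq (zero_block S) finset.set0; last first.
  rewrite mul0r big_pred0 // => p; apply/perpP => pp.
  have [/(_ i iZ) h _] := (perpE _ _).1 pp.
  by have := signed_val_neq0 (p i); rewrite mxE in h; rewrite h eqxx.
have nZ j : j \notin zero_block S by rewrite Z0 inE.
rewrite mul1r; pose x0 : spt := (ord0, true).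
have -> : \prod_(i | is_rep S i) (2 * zeta_partial R (\sum_(j in block S i) k j)%N M.+1) =
  \prod_(i in rep_set S) \sum_(x : spt) ((x.1.+1)%:R ^+ (\sum_(j in block S i) k j)%N)^-1.
  apply: eq_big => [i|i _]; first by rewrite inE.
  rewrite zeta_partial_ord -(pair_bigA _ (fun (a : 'I_M.+1) (b : bool) => ((a.+1)%:R ^+ (\sum_(j in block S i) k j)%N)^-1)) /=.
  by rewrite mulr_sumr; apply: eq_bigr => a _; rewrite big_bool /= mulr_natl mulr2n.
rewrite (prod_sum_supported x0).
rewrite (reindex_onto (spread S) (restrict_to x0 (rep_set S))) /=; last first.
  move=> p /perpP pp; apply/ffunP => j; apply: signed_val_inj.
  rewrite signed_val_spread ffunE inE is_rep_rep //.
  by have [_ /(_ j)] := (perpE _ _).1 pp; rewrite !mxE.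
apply: eq_big => [h|h _].
  apply/idP/idP => [/andP[_ /eqP <-]|/supportedP hs]; first exact: supported_restrict_to.
  apply/andP; split.
    apply/perpP/perpE; split=> [j|j]; first by rewrite (negPf (nZ j)).
    by rewrite !mxE !signed_val_spread rep_idem bsign_rep mul1r.
  apply/eqP/ffunP => i; rewrite ffunE; case: ifPn => [|/hs //].
  rewrite inE => /andP[_ /eqP ri]; apply: signed_val_inj.
  by rewrite signed_val_spread -{1}ri bsign_rep mul1r ri.
rewrite /weight (partition_big (rep S) (mem (rep_set S))) /=; last first.
  by move=> j _; rewrite inE is_rep_rep.
apply: eq_bigr => i _.
rewrite -prodrXr -prodfV; apply: eq_big => [j|j /eqP e].
  by rewrite inE /in_block nZ.
by rewrite ffunE /= e.
Qed.

Definition generic_point p : bool := annihilated (point p) == finset.set0.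

(** One of e_i + e_j and e_i - e_j vanishes at a point exactly when the two coordinates have equal
    absolute value. *)
Lemma generic_pointP p : generic_point p = injectiveb [ffun i => (p i).1].
Proof.
apply/eqP/injectiveP => [h i j|h].
  rewrite !ffunE => eij; apply/eqP/negPn/negP => ij.
  have [b hb] : exists b : bool, signed_val (p i) + (if b then 1 else -1) * signed_val (p j) = 0.
    exists ((p i).2 != (p j).2); rewrite /signed_val eij.
    by case: (p i).2; case: (p j).2 => /=; ring.
  have hb' : signed_val (p j) + (if b then 1 else -1) * signed_val (p i) = 0.
    by case: b hb => /= hb; [rewrite mul1r addrC -hb; ring|apply/eqP; rewrite -oppr_eq0 -hb; apply/eqP; ring].
  have [lij|lji|/val_inj e] := ltngtP i j; last by rewrite e eqxx in ij.
    have : (i, j, b) \in annihilated (point p) by rewrite in_annihilated short_rootsE lij dotv_root !mxE hb eqxx.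
    by rewrite h inE.
  have : (j, i, b) \in annihilated (point p) by rewrite in_annihilated short_rootsE lji dotv_root !mxE hb' eqxx.
  by rewrite h inE.
apply/setP => -[[i j] b]; rewrite [RHS]inE in_annihilated short_rootsE dotv_root !mxE.
apply/negP => /andP[/= ij /eqP e].
have : `|signed_val (p i)| = `|signed_val (p j)|.
  move: e; case: b => /eqP; rewrite ?mul1r ?mulN1r ?subr_eq0 ?addr_eq0 => /eqP ->; by rewrite ?normrN.
rewrite !signed_val_norm => /eqP; rewrite eqr_nat eqSS => /eqP /val_inj e2.
have := h i j; rewrite !ffunE => /(_ e2) e3.
by rewrite e3 ltnn in ij.
Qed.

Definition inj_sum k : R :=
  \sum_(n : {ffun 'I_r -> 'I_M.+1} | injectiveb n) \prod_i (((n i).+1)%:R ^+ k i)^-1.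

Lemma sum_generic_points k : \sum_(p | generic_point p) weight k p = 2 ^+ r * inj_sum k.
Proof.
pose f (q : {ffun 'I_r -> 'I_M.+1} * {ffun 'I_r -> bool}) : {ffun 'I_r -> spt} := [ffun i => (q.1 i, q.2 i)].
pose g (p : {ffun 'I_r -> spt}) : {ffun 'I_r -> 'I_M.+1} * {ffun 'I_r -> bool} :=
  ([ffun i => (p i).1], [ffun i => (p i).2]).
have gK : cancel g f by move=> p; apply/ffunP => i; rewrite !ffunE /= -surjective_pairing.
have fK : cancel f g.
  by case=> a b; congr (_, _); apply/ffunP => i; rewrite !ffunE.
rewrite (reindex f) /=; last by exists g => q _; [exact: fK|exact: gK].
have P q : generic_point (f q) = injectiveb q.1 && true.
  have e : [ffun i => (f q i).1] = q.1 by apply/ffunP => i; rewrite !ffunE.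
  by rewrite generic_pointP andbT e.
rewrite (eq_bigl _ _ P).
rewrite -(pair_big (fun n : {ffun 'I_r -> 'I_M.+1} => injectiveb n) xpredT
   (fun n (s : {ffun 'I_r -> bool}) => weight k (f (n, s)))) /=.
rewrite /inj_sum mulr_sumr; apply: eq_bigr => n _.
have w s : weight k (f (n, s)) = \prod_i (((n i).+1)%:R ^+ k i)^-1.
  by apply: eq_bigr => i _; rewrite ffunE.
under eq_bigr do rewrite w.
by rewrite sumr_const card_ffun card_bool card_ord -[LHS]mulr_natl natrX.
Qed.

Lemma signed_zeta_sum (nu : seq (PR r)) k : perm_eq nu (enum A) ->
  \sum_(S | nbc_flat R nu S) (-1) ^+ #|S| * ((zero_block S == finset.set0)%:R *
    \prod_(i | is_rep S i) (2 * zeta_partial R (\sum_(j in block S i) k j)%N M.+1))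
  = 2 ^+ r * inj_sum k.
Proof.
move=> hnu; rewrite -sum_generic_points.
under eq_bigr do rewrite -sum_perp_points mulr_sumr big_mkcond.
rewrite exchange_big /= [RHS]big_mkcond; apply: eq_bigr => p _.
rewrite -big_mkcondr -mulr_suml (nbc_sign_sum hnu) /generic_point.
by case: ifP => _; rewrite ?mul1r ?mul0r.
Qed.

End Truncated.
End SignedSums.

(** * Even exponents and rationality *)

Section RationalMultiples.
Variable R : realType.

Definition rat_pi n (x : R) := exists q : rat, x = ratr q * pi ^+ n.

Lemma rat_pi0 n : rat_pi n 0.
Proof. by exists 0; rewrite rmorph0 mul0r. Qed.

Lemma rat_piD n x y : rat_pi n x -> rat_pi n y -> rat_pi n (x + y).
Proof. by case=> p ->; case=> q ->; exists (p + q); rewrite rmorphD mulrDl. Qed.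

Lemma rat_piM m n x y : rat_pi m x -> rat_pi n y -> rat_pi (m + n) (x * y).
Proof. by case=> p ->; case=> q ->; exists (p * q); rewrite rmorphM /= mulrACA exprD. Qed.

Lemma rat_pi_rat (q : rat) : rat_pi 0 (ratr q).
Proof. by exists q; rewrite expr0 mulr1. Qed.

Lemma rat_pi_prod (I : finType) (P : pred I) (F : I -> R) (m : I -> nat) :
  (forall i, P i -> rat_pi (m i) (F i)) -> rat_pi (\sum_(i | P i) m i) (\prod_(i | P i) F i).
Proof.
move=> h; apply: (big_rec2 rat_pi); first by exists 1; rewrite rmorph1 mul1r.
by move=> i x n Pi; exact/rat_piM/h.
Qed.

Lemma zeta_rat_pi m : (0 < m)%N -> ~~ odd m -> rat_pi m (zeta R m).
Proof.
move=> m0 ev; have [q] := bern_rat R m.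
have m1 : (m == 1)%N = false by apply/negP => /eqP e; rewrite e in ev.
rewrite /bern (gtn_eqF m0) m1 (negPf ev) => e.
exists (- ((-1) ^+ m./2 * q * 2 ^+ m / 2)).
rewrite rmorphN !rmorphM rmorphXn /= rmorphN1 fmorphV rmorphXn /= rmorph_nat -e.
have s2 : (-1) ^+ m./2 * (-1) ^+ m./2 = 1 :> R by rewrite -exprMn mulrNN mulr1 expr1n.
have p0 : (pi : R) ^+ m != 0 by rewrite expf_neq0 // gt_eqF ?pi_gt0.
have t0 : (2 : R) ^+ m != 0 by rewrite expf_neq0.
rewrite exprMn; move: s2 p0 t0; move: (_ ^+ m./2) (pi ^+ m) (2 ^+ m) (zeta R m) => s p t z s2 p0 t0.
field: s2; by rewrite p0 t0.
Qed.

End RationalMultiples.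

Section EvenBlocks.
Variables (R : realType) (I : finType) (B : {set I}) (k : I -> nat).
Hypothesis ev : forall i, ~~ odd (k i).

(** For even n > 0, [bern n] is this factor times twice zeta n. On even arguments it turns sums into
    products except for its sign, and over a block the signs combine to the (-1)^|B| of
    [block_coef]. *)
Definition even_factor n : R := - ((-1) ^+ n./2 / (2 * pi) ^+ n).

Lemma half_sum_even :
  (\sum_(i in B) k i)./2 = (\sum_(i in B) (k i)./2)%N /\ ~~ odd (\sum_(i in B) k i).
Proof.
have -> : (\sum_(i in B) k i)%N = (\sum_(i in B) (k i)./2).*2.
  rewrite -muln2 big_distrl /=; apply: eq_bigr => i _.
  by rewrite muln2 even_halfK.
by rewrite doubleK odd_double.
Qed.

Lemma block_coef_even : B != finset.set0 ->
  (forall i, 0 < k i)%N ->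
  block_coef R B k = (\prod_(i in B) even_factor (k i)) * (2 * zeta R (\sum_(i in B) k i)%N).
Proof.
move=> /set0Pn[b bB] k0; rewrite /block_coef.
have -> : [forall i in B, k i == 0%N] = false.
  by apply/negP => /forall_inP /(_ b bB); rewrite (gtn_eqF (k0 b)).
have -> : [forall i in B, (0 < k i)%N] by apply/forall_inP => i _; exact: k0.
have [e evK] := half_sum_even.
have K0 : (0 < \sum_(i in B) k i)%N by rewrite (bigD1 b) //= ltn_addr.
have K1 : (\sum_(i in B) k i == 1)%N = false by apply/negP => /eqP E1; rewrite E1 in evK.
rewrite /bern (gtn_eqF K0) K1 (negPf evK) e /even_factor prodrN -/(even_factor _).
rewrite prodf_div !prodrXr.
by ring.
Qed.

End EvenBlocks.

Section EvenCoefficients.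
Variables (R : realType) (r : nat).
Implicit Types (S : {set PR r}) (i j : 'I_r) (k : 'I_r -> nat).
Local Notation zero_block := (@zero_block R r).
Local Notation rep := (@rep R r).
Local Notation is_rep := (@is_rep R r).
Local Notation block := (@block R r).

Lemma prod_blocks (M : Type) (idx : M) (op : Monoid.com_law idx) S (F : 'I_r -> M) :
  zero_block S = finset.set0 ->
  \big[op/idx]_(i | is_rep S i) \big[op/idx]_(j in block S i) F j = \big[op/idx]_j F j.
Proof.
move=> Z0; have nZ j : j \notin zero_block S by rewrite Z0 inE.
rewrite [RHS](partition_big (rep S) (is_rep S)) /=; last by move=> j _; rewrite is_rep_rep.
by apply: eq_bigr => i _; apply: eq_bigl => j; rewrite inE /in_block nZ.
Qed.

Variables (nu : seq (PR r)) (phi : 'rV[R]_r).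
Hypothesis hnu : perm_eq nu (enum (short_roots r)).
Hypothesis hphi : forall V, Bases R r V -> forall b, b \in V -> dotv phi (mu R V b) != 0.
Local Notation nbc_flat := (nbc_flat R nu).

Definition flat_zeta_sum k : R :=
  \sum_(S | nbc_flat S) (-1) ^+ #|S| * ((zero_block S == finset.set0)%:R *
    \prod_(i | is_rep S i) (2 * zeta R (\sum_(j in block S i) k j)%N)).

(** Here [phi] disappears: its signs are nonzero and occur to even powers. *)
Lemma phi_sign_even S k : nbc_flat S -> zero_block S = finset.set0 ->
  (forall j, ~~ odd (k j)) -> \prod_j phi_sign phi S j ^+ k j = 1.
Proof.
case/andP => SA /asboolP nS Z0 ev; rewrite big1 // => j _.
have hh i : is_rep S i -> in_block R S i (id i) by rewrite /is_rep.
have := phi_block_vec_neq0 SA (nbc_lin_indep hnu SA nS) hh hphi (j := j).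
rewrite Z0 inE => /(_ isT) p0.
by rewrite -(even_halfK (ev j)) -mul2n exprM /phi_sign sqr_sg p0 expr1n.
Qed.

Lemma flat_coef_even S k : nbc_flat S ->
  (forall i, 0 < k i)%N -> (forall i, ~~ odd (k i)) ->
  flat_coef phi S k = (\prod_j even_factor R (k j)) * ((zero_block S == finset.set0)%:R *
    \prod_(i | is_rep S i) (2 * zeta R (\sum_(j in block S i) k j)%N)).
Proof.
move=> hS k0 ev; rewrite /flat_coef /zero_on.
have [Z0|/set0Pn [i iZ]] := eqVneq (zero_block S) finset.set0; last first.
  rewrite mul0r mulr0; case: forall_inP; last by rewrite !mul0r.
  by move=> /(_ i iZ); rewrite (gtn_eqF (k0 i)).
have -> : [forall i in zero_block S, k i == 0%N] by apply/forall_inP => i; rewrite Z0 inE.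
rewrite phi_sign_even // !mul1r -(prod_blocks _ _ Z0) -big_split /=.
apply: eq_bigr => i ri; apply: block_coef_even => //.
by apply/set0Pn; exists i; rewrite inE.
Qed.

Lemma long_coef_even k : (forall i, 0 < k i)%N -> (forall i, ~~ odd (k i)) ->
  long_coef phi nu k = (\prod_j ((k j)`!%:R * even_factor R (k j))) * flat_zeta_sum k.
Proof.
move=> k0 ev; rewrite /long_coef big_split /= -mulrA; congr (_ * _).
rewrite mulr_sumr; apply: eq_bigr => S hS.
by rewrite flat_coef_even // mulrCA.
Qed.

Lemma inj_sum_cvg k : (forall i, 1 < k i)%N ->
  inj_sum R M k @[M --> \oo] --> flat_zeta_sum k / 2 ^+ r.
Proof.
move=> k1.
have e M : inj_sum R M k = (\sum_(S | nbc_flat S) (-1) ^+ #|S| * ((zero_block S == finset.set0)%:R *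
    \prod_(i | is_rep S i) (2 * zeta_partial R (\sum_(j in block S i) k j)%N M.+1))) / 2 ^+ r.
  by rewrite (signed_zeta_sum R M k hnu) mulrC mulKf // expf_neq0.
under eq_fun do rewrite e.
apply: cvgMl.
apply: (@cvg_big _ _ +%R 0) => [|S _]; first exact: add_continuous.
apply: cvgMr; apply: cvgMr.
apply: (@cvg_big R _ (@GRing.mul R) 1) => [|i ri]; first exact: mul_continuous.
apply: cvgMr; rewrite (cvg_shiftS (zeta_partial R _)); apply: zeta_cvg.
have iB : i \in block S i by rewrite inE.
by rewrite (bigD1 i) //= ltn_addr.
Qed.

Lemma flat_zeta_sum_rat_pi k : (forall i, 0 < k i)%N -> (forall i, ~~ odd (k i)) ->
  rat_pi (\sum_i k i)%N (flat_zeta_sum k).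
Proof.
move=> k0 ev; apply: (big_ind (rat_pi (\sum_i k i)%N)).
- exact: rat_pi0.
- by move=> x y; exact: rat_piD.
move=> S hS; rewrite mulrCA.
have [Z0|_] := eqVneq (zero_block S) finset.set0; last by rewrite mul0r; exact: rat_pi0.
rewrite mul1r -(prod_blocks _ _ Z0) -[X in rat_pi X]add0n; apply: rat_piM.
  by rewrite -(rmorphN1 (@ratr R)) -rmorphXn; exact: rat_pi_rat.
apply: rat_pi_prod => i ri; rewrite -[X in rat_pi X]add0n; apply: rat_piM.
  by rewrite -(ratr_nat R 2); exact: rat_pi_rat.
have iB : i \in block S i by rewrite inE.
apply: zeta_rat_pi; first by rewrite (bigD1 i) //= ltn_addr.
by have [] := half_sum_even (block S i) ev.
Qed.

End EvenCoefficients.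

(** * Compositions and Euler-Zagier sums *)

Section Multiplicities.
Variable T : eqType.
Implicit Types (s u : seq T) (x : T).

Lemma sum_count_undup s : (\sum_(x <- undup s) count_mem x s)%N = size s.
Proof.
have /perm_size := perm_count_undup s; rewrite size_flatten => <-.
rewrite sumnE /shape big_map big_map; apply: eq_bigr => x _.
by rewrite size_nseq.
Qed.

Lemma prod_fact_count_rem u s x : uniq u -> x \in u -> x \in s ->
  (\prod_(h <- u) (count_mem h s)`! =
   count_mem x s * \prod_(h <- u) (count_mem h (rem x s))`!)%N.
Proof.
move=> uu xu xs; rewrite (bigD1_seq x) //= [in RHS](bigD1_seq x) //=.
have c0 : (0 < count_mem x s)%N by rewrite -has_count has_pred1.
rewrite mulnA count_rem xs /= eqxx subn1 -[in LHS](prednK c0) factS prednK //.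
congr (_ * _)%N; apply: eq_bigr => h hx.
by rewrite count_rem /= [x == h]eq_sym (negPf hx) andbF subn0.
Qed.

(** The multinomial formula, by induction on the first entry of a permutation. The list [u] of
    possible values stays fixed because [undup s] may shrink when an entry is removed. *)
Lemma card_permutations u s : uniq u -> {subset s <= u} ->
  (\prod_(h <- u) (count_mem h s)`! * size (permutations s) = (size s)`!)%N.
Proof.
move=> uu; elim: {s}(size s) {-2}s (erefl (size s)) => [|n IH] s sz su.
  by move/size0nil: sz => -> /=; rewrite big1.
have s0 : (0 < size s)%N by rewrite sz.
rewrite (perm_size (permutationsE s0)) size_allpairs_dep sumnE big_map big_distrr /=.
rewrite [RHS](_ : _ = size s * n`!)%N; last by rewrite sz factS.
rewrite -[in RHS](sum_count_undup s) big_distrl /=.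
rewrite [LHS]big_seq [RHS]big_seq; apply: eq_bigr => x.
rewrite mem_undup => xs; rewrite (prod_fact_count_rem uu (su x xs) xs) -mulnA.
by rewrite IH ?size_rem ?sz // => y /mem_rem; apply: su.
Qed.

Definition multiplicities s : seq nat := [seq count_mem h s | h <- undup s].

Lemma card_permutations_multiplicities s :
  (\prod_(j <- multiplicities s) j`! * size (permutations s) = (size s)`!)%N.
Proof.
rewrite big_map; apply: card_permutations; first exact: undup_uniq.
by move=> x; rewrite mem_undup.
Qed.

End Multiplicities.

Section Runs.
Implicit Types (J h : seq nat).

Definition runs J h : seq nat := flatten [seq nseq p.1 p.2 | p <- zip J h].

Lemma mem_runs J h x : size h = size J -> all (fun j => 0 < j)%N J -> (x \in runs J h) = (x \in h).
Proof.
elim: J h => [|j J IH] [|y h] //= [sz] /andP[j0 J0].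
by rewrite /runs /= mem_cat mem_nseq j0 in_cons -/(runs J h) IH.
Qed.

Lemma mem_runs_sub J h x : x \in runs J h -> x \in h.
Proof.
elim: J h => [|j J IH] [|y h] //=.
rewrite /runs /= mem_cat mem_nseq in_cons -/(runs J h) => /orP[/andP[_ ->] //|/IH ->].
by rewrite orbT.
Qed.

Lemma sorted_ltn_notin y h : path ltn y h -> y \notin h.
Proof. by move=> /(order_path_min ltn_trans) /allP a; apply/negP => /a; rewrite ltnn. Qed.

Lemma undup_nseq_cat (T : eqType) j (y : T) s : (0 < j)%N -> y \notin s -> undup (nseq j y ++ s) = y :: undup s.
Proof.
elim: j => // [[|j]] IH _ ys /=; first by rewrite (negPf ys).
by rewrite -[in RHS](IH isT ys) /= in_cons eqxx.
Qed.

Lemma undup_runs J h : size h = size J -> all (fun j => 0 < j)%N J -> sorted ltn h ->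
  undup (runs J h) = h.
Proof.
elim: J h => [|j J IH] [|y h] //= [sz] /andP[j0 J0] so.
have yh := sorted_ltn_notin so.
rewrite /runs /= -/(runs J h) undup_nseq_cat ?mem_runs // IH //.
exact: path_sorted so.
Qed.

Lemma multiplicities_runs J h : size h = size J -> all (fun j => 0 < j)%N J -> sorted ltn h ->
  multiplicities (runs J h) = J.
Proof.
move=> sz J0 so; rewrite /multiplicities undup_runs //.
elim: J h sz J0 so => [|j J IH] [|y h] //= [sz] /andP[j0 J0] so.
have yh := sorted_ltn_notin so.
have yr : y \notin runs J h by rewrite mem_runs.
rewrite /runs /= -/(runs J h) count_cat count_nseq /= eqxx mul1n (count_memPn yr) addn0.
congr (_ :: _); rewrite -[RHS](IH h) //; last exact: path_sorted so.
apply/eq_in_map => x xh; rewrite count_cat count_nseq /=.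
by case: eqVneq => // e; rewrite e xh in yh.
Qed.

Lemma sorted_runs J h : sorted ltn h -> sorted leq (runs J h).
Proof.
rewrite !sorted_pairwise; [|exact: leq_trans|exact: ltn_trans].
elim: J h => [|j J IH] [|y h] //= /andP[ay ph].
rewrite /runs /= -/(runs J h) pairwise_cat IH // andbT; apply/andP; split; last first.
  by rewrite -sorted_pairwise; [elim: j => //= [[|j]] //=; rewrite leqnn|exact: leq_trans].
apply/allrelP => a b /nseqP[-> _] /mem_runs_sub bh.
by have /allP /(_ b bh)/ltnW := ay.
Qed.

Lemma runs_multiplicities s : sorted leq s -> runs (multiplicities s) (undup s) = s.
Proof.
move=> so; have so' : sorted ltn (undup s).
  by rewrite ltn_sorted_uniq_leq undup_uniq (subseq_sorted leq_trans (undup_subseq _)).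
apply: (sorted_eq leq_trans anti_leq) => //; first exact: sorted_runs.
rewrite /runs -[X in zip _ X]map_id zip_map -map_comp.
exact: perm_count_undup.
Qed.

Lemma size_multiplicities (T : eqType) (s : seq T) : size (multiplicities s) = size (undup s).
Proof. exact: size_map. Qed.

Lemma multiplicities_gt0 (T : eqType) (s : seq T) : all (fun j => 0 < j)%N (multiplicities s).
Proof. by apply/allP => j /mapP[x]; rewrite mem_undup => xs ->; rewrite -has_count has_pred1. Qed.

Lemma sumn_multiplicities (T : eqType) (s : seq T) : sumn (multiplicities s) = size s.
Proof. by rewrite sumnE big_map sum_count_undup. Qed.

End Runs.

Section Compositions.
Implicit Types (r N : nat) (a b J : seq nat).

Definition compositions r N : seq (seq nat) :=
  [seq a <- [seq [seq (c i : nat) | i : 'I_r] | c : {ffun 'I_r -> 'I_N.+1}]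
     | all (fun x => 0 < x)%N a && (sumn a == N)].

Lemma nth_image_ord (T : Type) (x : T) r (f : 'I_r -> T) (i : 'I_r) : nth x [seq f j | j : 'I_r] i = f i.
Proof. by rewrite (nth_map i) ?size_enum_ord //; congr f; exact: nth_ord_enum. Qed.

Lemma codom_ord_inj r N :
  injective (fun c : {ffun 'I_r -> 'I_N.+1} => [seq (c i : nat) | i : 'I_r]).
Proof.
move=> c c' e; apply/ffunP => i; apply: val_inj.
by have := congr1 (fun s => nth 0%N s i) e; rewrite !nth_image_ord.
Qed.

Lemma compositions_uniq r N : uniq (compositions r N).
Proof. by rewrite filter_uniq // map_inj_uniq ?enum_uniq //; exact: codom_ord_inj. Qed.

Lemma mem_compositions r N a :
  (a \in compositions r N) = [&& size a == r, all (fun x => 0 < x)%N a & sumn a == N].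
Proof.
rewrite mem_filter andbC; apply/andP/and3P => [[/mapP[c _ ->] /andP[h1 h2]]|[/eqP sz h1 h2]].
  by rewrite size_map size_enum_ord.
split; last by rewrite h1.
have le i : (nth 0 a i < N.+1)%N.
  rewrite ltnS -(eqP h2); have [ia|ia] := ltnP i (size a); last by rewrite nth_default.
  by rewrite sumnE (big_rem (nth 0%N a i)) ?mem_nth //= leq_addr.
apply/mapP; exists [ffun i : 'I_r => Ordinal (le i)]; first by rewrite mem_enum.
apply: (@eq_from_nth _ 0%N); first by rewrite size_map size_enum_ord.
move=> i; rewrite sz => ir.
by rewrite (nth_map (Ordinal ir)) ?size_enum_ord // ffunE /= nth_enum_ord.
Qed.

Lemma compositionsP r N a : a \in compositions r N <-> Icomp r N a.
Proof.
rewrite mem_compositions /Icomp /=; split; first by case/and3P => /eqP -> -> /eqP ->.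
by case=> -> [-> ->]; rewrite !eqxx.
Qed.

Lemma perm_compositions r N a b : perm_eq a b ->
  (a \in compositions r N) = (b \in compositions r N).
Proof. by move=> p; rewrite !mem_compositions (perm_size p) (perm_all _ p) (perm_sumn p). Qed.

Definition sorted_compositions r N : seq (seq nat) := [seq a <- compositions r N | sorted leq a].

Lemma mem_sorted_compositions r N a :
  (a \in sorted_compositions r N) = sorted leq a && (a \in compositions r N).
Proof. exact: mem_filter. Qed.

Lemma sorted_compositions_uniq r N : uniq (sorted_compositions r N).
Proof. by rewrite filter_uniq ?compositions_uniq. Qed.

Lemma sum_compositions_sorted (V : nmodType) r N (G : seq nat -> V) :
  (forall a b, perm_eq a b -> G a = G b) ->
  \sum_(a <- compositions r N) G a = \sum_(b <- sorted_compositions r N) G b *+ size (permutations b).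
Proof.
move=> Gp; pose srt : seq nat -> seq nat := sort leq.
have srtP a b : sorted leq b -> (srt a == b) = perm_eq a b.
  move=> sb; apply/eqP/idP => [<-|/(perm_sortP leq_total leq_trans anti_leq)]; first by rewrite perm_sym perm_sort.
  by rewrite /srt => ->; rewrite sorted_sort //; exact: leq_trans.
have su := sorted_compositions_uniq r N.
transitivity (\sum_(a <- compositions r N) \sum_(b <- sorted_compositions r N | srt a == b) G a).
  rewrite [LHS]big_seq [RHS]big_seq; apply: eq_bigr => a ac.
  have sm : srt a \in sorted_compositions r N.
    by rewrite mem_sorted_compositions sort_sorted ?(@perm_compositions _ _ _ a) ?perm_sort //; exact: leq_total.
  rewrite big_mkcond (bigD1_seq _ sm) //= eqxx big1 ?addr0 //.
  by move=> b; rewrite eq_sym => /negPf ->.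
rewrite (exchange_big_dep xpredT) //= [LHS]big_seq [RHS]big_seq; apply: eq_bigr => b.
rewrite mem_sorted_compositions => /andP[sb bc].
transitivity (\sum_(a <- permutations b) G a); last first.
  rewrite big_seq (eq_bigr (fun=> G b)) => [|a].
    by rewrite -big_seq big_const_seq count_predT iter_addr_0.
  by rewrite mem_permutations => /Gp.
rewrite -big_filter; apply: perm_big; apply: uniq_perm.
- by rewrite filter_uniq ?compositions_uniq.
- exact: permutations_uniq.
move=> a; rewrite mem_filter srtP // mem_permutations.
by apply: andb_idr => /perm_compositions ->.
Qed.

(** A weakly increasing sequence and its lengths and values of runs determine each other; the
    lengths form [J], the values the strictly increasing [h]. *)
Lemma AsetP r d N J x : (0 < d)%N -> all (fun j => 0 < j)%N J ->
  Aset r d N J x <->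
  exists a, [/\ a \in sorted_compositions r N, multiplicities a = J & x = map (muln (2 * d)) a].
Proof.
move=> d0 J0; have inj : injective (map (muln (2 * d))).
  by apply: inj_map => p q /eqP; rewrite eqn_pmul2l ?muln_gt0 // => /eqP.
have runsM h : flatten [seq nseq p.1 (2 * d * p.2)%N | p <- zip J h] = map (muln (2 * d)) (runs J h).
  rewrite /runs map_flatten -map_comp; congr flatten; apply: eq_map => p /=.
  by rewrite map_nseq.
split.
  case=> [[a [/compositionsP ac ->]] [h [sz [so]]]]; rewrite runsM => /inj e.
  exists a; split=> //; first by rewrite mem_sorted_compositions ac e sorted_runs.
  by rewrite e multiplicities_runs.
case=> a [ac mJ ->]; move: ac; rewrite mem_sorted_compositions => /andP[sa ac].
split; first by exists a; split=> //; apply/compositionsP.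
exists (undup a); split; first by rewrite -mJ size_multiplicities.
split; first by rewrite ltn_sorted_uniq_leq undup_uniq (subseq_sorted leq_trans (undup_subseq _)).
by rewrite runsM -mJ runs_multiplicities.
Qed.

Definition parts r : seq (seq nat) := undup (flatten [seq compositions n r | n <- iota 1 r]).

Lemma partsP r J : J \in parts r <-> Pset r J.
Proof.
rewrite mem_undup; split.
  case/flattenP => s /mapP [n]; rewrite mem_iota add1n ltnS => nr -> .
  by rewrite mem_compositions /Pset /= => /and3P[/eqP -> -> /eqP ->].
case=> sz [J0 sJ]; apply/flattenP; exists (compositions (size J) r).
  by apply/mapP; exists (size J); rewrite // mem_iota add1n ltnS.
by rewrite mem_compositions eqxx J0 sJ eqxx.
Qed.

End Compositions.

(** Each sorted composition belongs to exactly one J, its tuple of multiplicities, so the double sum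
    collapses. *)
Lemma sum_parts (F : fieldType) r d N (G : seq nat -> F) : (0 < r)%N -> (0 < d)%N ->
  \sum_(J \in Pset r) ((\prod_(j <- J) (j`!)%:R)^-1 * \sum_(x \in Aset r d N J) G x) =
  \sum_(a <- sorted_compositions r N)
    (\prod_(j <- multiplicities a) (j`!)%:R)^-1 * G (map (muln (2 * d)) a).
Proof.
move=> r0 d0; have -> : Pset r = [set` parts r].
  by apply/seteqP; split => J /=; rewrite partsP.
rewrite -fsbig_seq ?undup_uniq //.
transitivity (\sum_(J <- parts r) \sum_(a <- sorted_compositions r N | multiplicities a == J)
   (\prod_(j <- multiplicities a) (j`!)%:R)^-1 * G (map (muln (2 * d)) a)).
  rewrite [LHS]big_seq [RHS]big_seq; apply: eq_bigr => J /partsP [_ [J0 _]].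
  transitivity (\sum_(a <- sorted_compositions r N | multiplicities a == J)
      (\prod_(j <- J) (j`!)%:R)^-1 * G (map (muln (2 * d)) a)); last first.
    by apply: eq_bigr => a /eqP ->.
  rewrite -mulr_sumr; congr (_ * _).
  have -> : Aset r d N J = [set` [seq map (muln (2 * d)) a | a <- sorted_compositions r N & multiplicities a == J]].
    apply/seteqP; split => x /=; rewrite AsetP //.
      by case=> a [ac mJ ->]; rewrite map_f // mem_filter mJ eqxx.
    by case/mapP => a; rewrite mem_filter => /andP[/eqP mJ ac] ->; exists a.
  rewrite -fsbig_seq ?big_map ?big_filter // map_inj_uniq.
    by rewrite filter_uniq ?sorted_compositions_uniq.
  by apply: inj_map => p q /eqP; rewrite eqn_pmul2l ?muln_gt0 // => /eqP.
rewrite (exchange_big_dep xpredT) //= [LHS]big_seq [RHS]big_seq; apply: eq_bigr => a.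
rewrite mem_sorted_compositions mem_compositions => /and4P[_ /eqP sz a0 sa].
have mP : multiplicities a \in parts r.
  apply/partsP; split; last by rewrite multiplicities_gt0 sumn_multiplicities.
  rewrite size_multiplicities -sz size_undup andbT.
  case: a sz {a0 sa} => [e|y a _]; first by rewrite -e in r0.
  by rewrite -has_predT; apply/hasP; exists y; rewrite // mem_undup mem_head.
rewrite big_mkcond (bigD1_seq _ mP) ?undup_uniq //= eqxx.
by rewrite [X in _ + X]big1 ?addr0 // => J; rewrite eq_sym => /negPf ->.
Qed.

Section Rearrangement.
Variables r M : nat.
Local Notation fT := {ffun 'I_r -> 'I_M}.
Implicit Types (n : fT) (s : 'S_r).

Definition increasing n : bool :=
  [forall i : 'I_r, forall j : 'I_r, (i < j)%N ==> (n i < n j)%N].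

Lemma increasingP n : reflect (forall i j : 'I_r, (n i < n j)%N = (i < j)%N) (increasing n).
Proof.
apply: (iffP 'forall_'forall_implyP) => [h i j|h i j]; last by rewrite h.
apply/idP/idP; last exact: h.
by apply: contraTT; rewrite -!leqNgt leq_eqVlt => /orP[/eqP/val_inj ->//|/h/ltnW].
Qed.

Lemma increasing_injective n : increasing n -> injectiveb n.
Proof.
move=> /increasingP h; apply/injectiveP => i j e; apply: val_inj.
by apply/eqP; rewrite eqn_leq (leqNgt i) (leqNgt j) -!h e ltnn.
Qed.

Definition compose n s : fT := [ffun i => n (s i)].

Lemma composeK s : cancel (compose^~ s) (compose^~ s^-1%g).
Proof. by move=> n; apply/ffunP => i; rewrite !ffunE permKV. Qed.

Lemma composeVK s : cancel (compose^~ s^-1%g) (compose^~ s).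
Proof. by move=> n; apply/ffunP => i; rewrite !ffunE permK. Qed.

Lemma injectiveb_compose n s : injectiveb (compose n s) = injectiveb n.
Proof.
apply/injectiveP/injectiveP => h i j e.
  by apply: (@perm_inj _ s^-1%g); apply: h; rewrite !ffunE !permKV.
by apply: (@perm_inj _ s); apply: h; move: e; rewrite !ffunE.
Qed.

Lemma card_ltn_ord i : (i <= r)%N -> #|[set j : 'I_r | (j < i)%N]%SET| = i.
Proof.
move=> ir; rewrite -sum1_card (eq_bigl (fun j : 'I_r => (j < i)%N)).
  by rewrite (big_ord_narrow ir) sum1_card card_ord.
by move=> j; rewrite inE.
Qed.

Definition rank n (i : 'I_r) : nat := #|[set j | (n j < n i)%N]%SET|.

Lemma rank_lt n i : (rank n i < r)%N.
Proof.
rewrite -[X in (_ < X)%N]card_ord -cardsT; apply: proper_card.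
by apply/properP; split; [exact: finset.subsetT|exists i; rewrite !inE ?ltnn].
Qed.

Lemma rank_mono n : injective n -> {mono rank n : i j / n i < n j >-> (i < j)}%N.
Proof.
move=> nI; suff h i j : (n i < n j)%N -> (rank n i < rank n j)%N.
  move=> i j; apply/idP/idP; last exact: h.
  apply: contraTT; rewrite -!leqNgt leq_eqVlt => /orP[/eqP/val_inj/nI ->//|/h/ltnW //].
move=> ij; apply: proper_card; apply/properP; split.
  by apply/fintype.subsetP => l; rewrite !inE => /ltn_trans; apply.
by exists i; rewrite !inE ?ltnn.
Qed.

Lemma rank_compose n s i : increasing (compose n s) -> rank n (s i) = i.
Proof.
move=> /increasingP h; rewrite -[RHS](card_ltn_ord (ltnW (ltn_ord i))).
rewrite -(card_imset _ (@perm_inj _ s)) /rank; apply: eq_card => j.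
rewrite inE; apply/idP/finset.imsetP => [ij|[l]]; last by rewrite inE -h !ffunE => li ->.
by exists (s^-1%g j); rewrite ?permKV // inE -h !ffunE permKV.
Qed.

(** A sorting permutation must send i to the index whose value has rank i, hence is the inverse of
    the rank permutation. *)
Lemma card_sorting n : injectiveb n -> #|[pred s : 'S_r | increasing (compose n s)]| = 1%N.
Proof.
move=> /injectiveP nI; pose f i := Ordinal (rank_lt n i).
have fI : injective f.
  move=> i j [e]; apply: (nI i j); apply: val_inj; apply/eqP.
  by rewrite eqn_leq (leqNgt (n i)) (leqNgt (n j)) -!(rank_mono nI) e ltnn.
rewrite -[RHS](card1 (((perm fI)^-1)%g : {perm 'I_r})); apply: eq_card => s; rewrite !inE; apply/idP/eqP => [h|->].
  apply/permP => i; apply: (@perm_inj _ (perm fI)).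
  by rewrite permKV permE; apply: val_inj; exact: rank_compose.
have rV i : rank n ((perm fI)^-1%g i) = i.
  by have := permKV (perm fI) i; rewrite permE => /(congr1 val).
by apply/increasingP => i j; rewrite !ffunE -(rank_mono nI) !rV.
Qed.

(** Double counting of the pairs of a function n and a permutation s for which n composed with s is
    increasing. *)
Lemma sum_injective (V : nmodType) (W : fT -> V) : (forall n s, W (compose n s) = W n) ->
  \sum_(n : fT | injectiveb n) W n = (\sum_(n : fT | increasing n) W n) *+ r`!.
Proof.
move=> sym.
transitivity (\sum_(n : fT | injectiveb n) \sum_(s : {perm 'I_r} | increasing (compose n s)) W n).
  by apply: eq_bigr => n nI; rewrite sumr_const card_sorting.
rewrite (exchange_big_dep xpredT) //=.
rewrite (eq_bigr (fun=> \sum_(n : fT | increasing n) W n)) => [|s _].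
  by rewrite sumr_const card_Sn.
rewrite [RHS](reindex (compose^~ s)) /=; last first.
  by exists (compose^~ s^-1%g) => n _; [exact: composeK|exact: composeVK].
apply: eq_big => n; last by rewrite sym.
rewrite andb_idl // => /increasing_injective; by rewrite injectiveb_compose.
Qed.

End Rearrangement.

Definition inc_sum (R : realType) r M (k : 'I_r -> nat) : R :=
  \sum_(n : {ffun 'I_r -> 'I_M.+1} | increasing n) \prod_i (((n i).+1)%:R ^+ k i)^-1.

(** Shift of indices: a positive value at most M + 1 is the successor of an element of ['I_M.+1]. *)
Lemma EZpartial_inc_sum (R : realType) r (s : seq nat) M : size s = r -> EZpartial R s M.+1 = inc_sum R M (fun i : 'I_r => nth 0%N s i).
Proof.
move=> e; case: r / e; rewrite /inc_sum /EZpartial.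
rewrite (reindex_onto (fun n : {ffun 'I_(size s) -> 'I_M.+1} => [ffun i => lift ord0 (n i)] : {ffun 'I_(size s) -> 'I_M.+2})
  (fun n => [ffun i => inord (n i).-1])) /=; last first.
  move=> n /andP[/forallP n0 _]; apply/ffunP => i; rewrite !ffunE; apply: val_inj.
  by rewrite [LHS]lift0 inordK ?prednK // -ltnS; exact: ltn_ord.
apply: eq_big => [n|n _]; last by apply: eq_bigr => i _; rewrite ffunE lift0.
rewrite (_ : [forall i, _]) => [|/=]; last by apply/forallP => i; rewrite ffunE lift0.
rewrite (_ : _ == n); last first.
  by apply/eqP/ffunP => i; rewrite !ffunE lift0 /= inord_val.
by rewrite andbT; apply: eq_forallb => i; apply: eq_forallb => j; rewrite !ffunE !lift0.
Qed.

Lemma nth_map_muln e (a : seq nat) i : nth 0%N (map (muln e) a) i = (e * nth 0 a i)%N.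
Proof.
have [ia|ia] := ltnP i (size a); first exact: nth_map.
by rewrite !nth_default ?size_map ?muln0.
Qed.

Section EulerZagier.
Variables (R : realType) (r : nat).
Implicit Types (M N : nat) (k : 'I_r -> nat) (s t : seq nat).
Local Notation inc_sum := (@inc_sum R r).
Local Notation entries s := (fun i : 'I_r => nth 0%N s i).

Lemma inc_sum_ge0 M k (n : {ffun 'I_r -> 'I_M.+1}) : 0 <= \prod_i (((n i).+1)%:R ^+ k i)^-1 :> R.
Proof. by apply: prodr_ge0 => i _; rewrite invr_ge0 exprn_ge0. Qed.

Lemma inc_sum_nd k : nondecreasing_seq (inc_sum^~ k).
Proof.
apply/nondecreasing_seqP => M.
pose w (n : {ffun 'I_r -> 'I_M.+1}) : {ffun 'I_r -> 'I_M.+2} := [ffun i => widen_ord (leqnSn _) (n i)].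
have wI : injective w.
  by move=> n n' e; apply/ffunP => i; have := congr1 (fun f : {ffun 'I_r -> 'I_M.+2} => val (f i)) e; rewrite !ffunE => /= /val_inj.
have we n : increasing (w n) = increasing n.
  by apply: eq_forallb => i; apply: eq_forallb => j; rewrite !ffunE.
rewrite /inc_sum [leRHS](bigID (mem (codom w))) /= ler_wpDr ?sumr_ge0 // => [n _|]; first exact: inc_sum_ge0.
rewrite le_eqVlt; apply/orP; left; apply/eqP.
transitivity (\sum_(n in [set n | increasing n]%SET) \prod_i (((w n i).+1)%:R ^+ k i)^-1 : R).
  by apply: eq_big => n; rewrite ?inE // => _; apply: eq_bigr => i _; rewrite ffunE.
rewrite -(big_imset (fun n : {ffun 'I_r -> 'I_M.+2} => \prod_i (((n i).+1)%:R ^+ k i)^-1 : R)) /=; last by move=> n n' _ _; exact: wI.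
apply: eq_bigl => n; apply/finset.imsetP/andP => [[n']|[nI /codomP [n' e]]].
  by rewrite inE => nI ->; rewrite we codom_f.
by exists n'; rewrite // inE -we -e.
Qed.

Lemma inc_sum_le M k : (forall i, 1 < k i)%N -> inc_sum M k <= 2 ^+ r.
Proof.
move=> k1; apply: (@le_trans _ _ (\prod_i zeta_partial R (k i) M.+1)).
  under [leRHS]eq_bigr do rewrite zeta_partial_ord.
  rewrite bigA_distr_bigA /= [leRHS](bigID (@increasing r M.+1)) /= ler_wpDr //.
  by apply: sumr_ge0 => n _; exact: inc_sum_ge0.
rewrite -[r in leRHS]card_ord -prodr_const; apply: ler_prod => i _.
by rewrite zeta_partial_le2 // andbT /zeta_partial sumr_ge0 // => j _; rewrite invr_ge0 exprn_ge0.
Qed.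

Lemma EZ_cvg s : size s = r -> (forall i : 'I_r, 1 < nth 0 s i)%N ->
  inc_sum M (entries s) @[M --> \oo] --> EZ R s.
Proof.
move=> sz s1; set u := (X in X @ _ --> _).
have cu : cvgn u.
  apply: nondecreasing_is_cvgn; first exact: inc_sum_nd.
  by exists (2 ^+ r) => _ [M _ <-]; exact: inc_sum_le.
suff -> : EZ R s = limn u by [].
have c1 : EZpartial R s @ \oo --> limn u.
  rewrite -(cvg_shiftS (EZpartial R s)) (_ : [sequence _]_n = u) //.
  by apply/funext => M; exact: EZpartial_inc_sum.
exact: cvg_lim c1.
Qed.

Lemma inj_sum_compose M k (p : {perm 'I_r}) : inj_sum R M (k \o p) = inj_sum R M k.
Proof.
rewrite /inj_sum [LHS](reindex (fun n : {ffun 'I_r -> 'I_M.+1} => compose n p)) /=; last first.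
  by exists (fun n => compose n p^-1%g) => n _; [exact: composeK|exact: composeVK].
apply: eq_big => n; first exact: injectiveb_compose.
by rewrite [RHS](reindex_inj (@perm_inj _ p)) /= => _; apply: eq_bigr => i _; rewrite ffunE.
Qed.

Lemma inj_sum_perm M s t : size s = r -> perm_eq s t ->
  inj_sum R M (entries s) = inj_sum R M (entries t).
Proof.
move=> sz pst; have szt : size t == r by rewrite -(perm_size pst) sz.
have [p e] := tuple_permP (t := Tuple szt) pst.
rewrite -(inj_sum_compose M (entries t) p); congr inj_sum; apply/funext => i /=.
rewrite e (nth_map i) ?size_enum_ord //= nth_ord_enum.
by rewrite (tnth_nth 0%N).
Qed.

(** For one composition the summand is not symmetric in the n_i; after summing over all compositions
    it is, since permuting the n_i can be undone by permuting the composition. *)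
Lemma sum_compositions_inj_sum M N e :
  \sum_(a <- compositions r N) inj_sum R M (entries (map (muln e) a)) =
  (\sum_(a <- compositions r N) inc_sum M (entries (map (muln e) a))) *+ r`!.
Proof.
pose W (n : {ffun 'I_r -> 'I_M.+1}) : R :=
  \sum_(a <- compositions r N) \prod_i (((n i).+1)%:R ^+ nth 0%N (map (muln e) a) i)^-1.
rewrite /inj_sum /inc_sum exchange_big [in RHS]exchange_big /=.
apply: (sum_injective (W := W)) => n s; rewrite /W.
rewrite /compositions !big_filter !big_image_cond /=.
rewrite [LHS](reindex (fun c : {ffun 'I_r -> 'I_N.+1} => compose c s)) /=; last first.
  by exists (fun c => compose c s^-1%g) => c _; [exact: composeK|exact: composeVK].
apply: eq_big => [c|c _].
  have pc : perm_eq [seq (compose c s i : nat) | i : 'I_r] [seq (c i : nat) | i : 'I_r].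
    have -> : [seq (compose c s i : nat) | i : 'I_r] = map (fun j => c j : nat) (map s (enum 'I_r)).
      by rewrite -map_comp; apply: eq_map => i /=; rewrite ffunE.
    apply: perm_map.
    apply: uniq_perm; [by rewrite (map_inj_uniq (@perm_inj _ s)) enum_uniq|exact: enum_uniq|].
    by move=> i; rewrite mem_enum; apply/mapP; exists (s^-1%g i); rewrite ?mem_enum ?permKV.
  by rewrite (perm_all _ pc) (perm_sumn pc).
rewrite [RHS](reindex_inj (@perm_inj _ s)) /=; apply: eq_bigr => i _.
by rewrite !nth_map_muln !nth_image_ord !ffunE.
Qed.

End EulerZagier.

Local Open Scope complex_scope.

(** The factors (2 pi i)^n / n! of the formula cancel everything in a coefficient except the zeta
    sums and one sign per entry, the source of (-1)^r. *)
Lemma even_factor_complex (R : realType) n : ~~ odd n ->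
  ((n`!)%:R * even_factor R n)%:C * ((2%:R * pi%:C * 'i) ^+ n / (n`!)%:R) = -1 :> R[i].
Proof.
move=> ev; have f0 : (n`!)%:R != 0 :> R[i] by rewrite pnatr_eq0 -lt0n fact_gt0.
have p0 : ((2 * pi) ^+ n)%:C != 0 :> R[i].
  by rewrite fmorph_eq0 expf_neq0 // mulf_neq0 ?gt_eqF ?pi_gt0.
have e2 : (2%:R * pi%:C * 'i) ^+ n = ((2 * pi) ^+ n)%:C * ((-1) ^+ n./2) :> R[i].
  rewrite exprMn -[in X in _ * X](even_halfK ev) -mul2n exprM sqr_i.
  by rewrite rmorphXn /= rmorphM rmorph_nat.
rewrite e2 /even_factor rmorphM rmorphN /= rmorphM fmorphV rmorph_nat rmorphXn /= rmorphN1.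
have s2 : (-1) ^+ n./2 * (-1) ^+ n./2 = 1 :> R[i] by rewrite -exprMn mulrNN mulr1 expr1n.
move: s2 p0 f0; move: (_ ^+ n./2) (_ %:C) (n`!%:R) => s p f s2 p0 f0.
by field: s2; rewrite p0 f0.
Qed.

Lemma big_entries (T : Type) (idx : T) (op : Monoid.law idx) r (s : seq nat) (F : nat -> T) :
  size s = r -> \big[op/idx]_(i < r) F (nth 0%N s i) = \big[op/idx]_(n <- s) F n.
Proof. by move=> <-; rewrite [RHS](big_nth 0%N) big_mkord. Qed.

(** * Evaluation of both sides of the identity *)

Section Main.
Variables (R : realType) (r d N : nat) (nu : seq (PR r)) (phi : 'rV[R]_r).
Hypothesis r0 : (0 < r)%N.
Hypothesis d0 : (0 < d)%N.
Hypothesis hnu : perm_eq nu (enum (short_roots r)).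
Hypothesis hphi : forall V, Bases R r V -> forall b, b \in V -> dotv phi (mu R V b) != 0.
Local Notation entries s := (fun i : 'I_r => nth 0%N s i).
Local Notation dilate := (map (muln (2 * d))).

(** The sum of prod n_i^(-s_i) over distinct positive integers, as [zeta_avg_cvg] shows. The finite
    expression by flats serves for rationality, the limit for symmetry in the entries, which the
    order [nu] hides. *)
Definition zeta_avg (s : seq nat) : R := flat_zeta_sum R nu (entries s) / 2 ^+ r.

Lemma zeta_avg_cvg s : size s = r -> all (fun n => 1 < n)%N s ->
  inj_sum R M (entries s) @[M --> \oo] --> zeta_avg s.
Proof.
move=> sz /all_nthP s1; apply: inj_sum_cvg => // i.
by apply: s1; rewrite sz.
Qed.

Lemma zeta_avg_perm s t : size s = r -> all (fun n => 1 < n)%N s -> perm_eq s t ->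
  zeta_avg s = zeta_avg t.
Proof.
move=> sz s1 p; have szt : size t = r by rewrite -(perm_size p).
have t1 : all (fun n => 1 < n)%N t by rewrite -(perm_all _ p).
have := zeta_avg_cvg sz s1; under eq_fun do rewrite (inj_sum_perm R _ sz p).
by move/(cvg_lim (@Rhausdorff R)); rewrite (cvg_lim (@Rhausdorff R) (zeta_avg_cvg szt t1)).
Qed.

Lemma Plong_prod s : size s = r -> all (fun n => 1 < n)%N s -> all (fun n => ~~ odd n) s ->
  (Plong nu phi s)%:C * \prod_(n <- s) ((2%:R * pi%:C * 'i) ^+ n / (n`!)%:R) =
  ((-1) ^+ r * 2 ^+ r * zeta_avg s)%:C.
Proof.
(* [Plong] attaches the entries to 2e_r, ..., 2e_1, so the exponents by coordinate are [rev s]; the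
   symmetry of [zeta_avg] undoes the reversal. *)
move=> sz s1 ev; have szr : size (rev s) = r by rewrite size_rev.
have pr : perm_eq s (rev s) by rewrite perm_sym perm_rev.
have entry (P : pred nat) (i : 'I_r) : all P s -> P (nth 0%N (rev s) i).
  by rewrite (perm_all _ pr) => /all_nthP; apply; rewrite szr.
have -> : Plong nu phi s = long_coef phi nu (entries (rev s)).
  rewrite /Plong (Pcoef_long_coef hnu hphi (Ordinal r0)); congr long_coef.
  by apply/funext => i; rewrite nth_rev sz ?ltn_ord // -subnDA add1n.
rewrite (long_coef_even hnu hphi); first last.
- by move=> i; exact: (entry (fun n => ~~ odd n)).
- by move=> i; apply: ltnW; exact: (entry (fun n => 1 < n)%N).
rewrite (big_entries _ (fun n => (n`!)%:R * even_factor R n) szr) (perm_big _ pr) /=.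
rewrite rmorphM mulrAC rmorph_prod -big_split /= big_seq.
rewrite (eq_bigr (fun=> -1)) => [|n nr]; last first.
  by apply: even_factor_complex; move/allP: ev; apply; rewrite (perm_mem pr).
rewrite -big_seq big_const_seq count_predT szr iter_mulr_1 (zeta_avg_perm sz s1 pr).
rewrite -mulrA rmorphM rmorphXn /= rmorphN1; congr (_ * (_ %:C)).
by rewrite /zeta_avg mulrC divfK // expf_neq0.
Qed.

Section Entries.
Variable a : seq nat.
Hypothesis ac : a \in compositions r N.

Lemma size_dilate : size (dilate a) = r.
Proof. by move: ac; rewrite mem_compositions size_map => /and3P[/eqP]. Qed.

Lemma dilate_gt1 : all (fun n => 1 < n)%N (dilate a).
Proof.
move: ac; rewrite mem_compositions => /and3P[_ /allP a0 _].
apply/allP => _ /mapP [m /a0 m0 ->].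
by rewrite -mulnA -[2%N]muln1 leq_mul // muln_gt0 d0.
Qed.

Lemma dilate_even : all (fun n => ~~ odd n) (dilate a).
Proof. by apply/allP => _ /mapP[m _ ->]; rewrite !oddM. Qed.

Lemma zeta_avg_rat_pi : rat_pi (2 * d * N) (zeta_avg (dilate a)).
Proof.
rewrite -[X in rat_pi X]addn0; apply: rat_piM.
  have -> : (2 * d * N = \sum_(i < r) nth 0 (dilate a) i)%N.
    rewrite (big_entries _ id size_dilate) big_map -big_distrr /= -sumnE.
    by move: ac; rewrite mem_compositions => /and3P[_ _ /eqP ->].
  apply: flat_zeta_sum_rat_pi => i.
    by apply: ltnW; move/all_nthP: dilate_gt1; apply; rewrite size_dilate.
  by move/all_nthP: dilate_even; apply; rewrite size_dilate.
rewrite (_ : _^-1 = ratr (2 ^+ r)^-1); first exact: rat_pi_rat.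
by rewrite fmorphV rmorphXn /= ratr_nat.
Qed.

End Entries.

Lemma sum_compositions_EZ :
  \sum_(a <- compositions r N) zeta_avg (dilate a) =
  (\sum_(a <- compositions r N) EZ R (dilate a)) *+ r`!.
Proof.
have c1 : (fun M => \sum_(a <- compositions r N) inj_sum R M (entries (dilate a))) @ \oo -->
    \sum_(a <- compositions r N) zeta_avg (dilate a).
  rewrite [X in _ --> X]big_seq; under eq_fun do rewrite big_seq.
  apply: (@cvg_big _ _ +%R 0) => [|a ac]; first exact: add_continuous.
  by apply: zeta_avg_cvg; [exact: size_dilate|exact: dilate_gt1].
have c2 : (fun M => (\sum_(a <- compositions r N) inc_sum R M (entries (dilate a))) *+ r`!) @ \oo -->
    (\sum_(a <- compositions r N) EZ R (dilate a)) *+ r`!.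
  rewrite -[X in _ --> X]mulr_natr; under eq_fun do rewrite -mulr_natr.
  apply: cvgMl; rewrite [X in _ --> X]big_seq; under eq_fun do rewrite big_seq.
  apply: (@cvg_big _ _ +%R 0) => [|a ac]; first exact: add_continuous.
  apply: EZ_cvg => [|i]; first exact: size_dilate.
  by move/all_nthP: (dilate_gt1 ac); apply; rewrite size_dilate.
rewrite -(cvg_lim (@Rhausdorff R) c1) -(cvg_lim (@Rhausdorff R) c2).
by congr (limn _); apply/funext => M; exact: sum_compositions_inj_sum.
Qed.

Lemma sum_EZ_sorted :
  \sum_(a <- compositions r N) EZ R (dilate a) =
  \sum_(a <- sorted_compositions r N)
    (\prod_(j <- multiplicities a) (j`!)%:R)^-1 * zeta_avg (dilate a).
Proof.
have f0 : (r`!)%:R != 0 :> R by rewrite pnatr_eq0 -lt0n fact_gt0.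
apply: (mulIf f0); rewrite mulr_natr -sum_compositions_EZ.
(* Extension by 0 gives a function invariant under permutation on all sequences, as grouping by
   sorted compositions requires. The number of rearrangements, r! / prod j!, then cancels the r! of
   [sum_compositions_EZ]. *)
pose G a : R := if a \in compositions r N then zeta_avg (dilate a) else 0.
have GE a : a \in compositions r N -> G a = zeta_avg (dilate a) by rewrite /G => ->.
have Gp a b : perm_eq a b -> G a = G b.
  move=> p; rewrite /G -(perm_compositions _ _ p); case: ifP => // ac.
  by apply: zeta_avg_perm; [exact: size_dilate|exact: dilate_gt1|exact: perm_map].
transitivity (\sum_(a <- compositions r N) G a).
  by rewrite [LHS]big_seq [RHS]big_seq; apply: eq_bigr => a /GE.
rewrite (sum_compositions_sorted _ _ Gp) mulr_suml [LHS]big_seq [RHS]big_seq.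
apply: eq_bigr => a; rewrite mem_sorted_compositions => /andP[_ ac].
rewrite GE // -[LHS]mulr_natr [LHS]mulrC mulrAC; congr (_ * _).
have sz : size a = r by move: ac; rewrite mem_compositions => /and3P[/eqP].
rewrite -sz -card_permutations_multiplicities natrM natr_prod mulrA mulVf ?mul1r //.
rewrite prodf_seq_neq0; apply/allP => j _ /=.
by rewrite pnatr_eq0 -lt0n fact_gt0.
Qed.

End Main.

Theorem theorem7p1 (R : realType) (r d N : nat)
  (hr : (1 <= r)%N) (hd : (1 <= d)%N) (hN : (r <= N)%N)
  (nu : seq (PR r)) (hnu : perm_eq nu (enum (Dplus r :\: Dlong r)))
  (phi : 'rV[R]_r)
  (hphi : forall V, Bases R r V -> forall b, b \in V -> dotv phi (mu R V b) != 0) :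
  let LHS : R := \sum_(a \in Icomp r N) EZ R (map (fun ai => 2 * d * ai)%N a) in
  LHS%:C =
    ((-1) ^+ r / 2%:R ^+ r) *
    \sum_(J \in Pset r)
      ((\prod_(j <- J) (j`!)%:R)^-1 *
       \sum_(x \in Aset r d N J)
         ((Plong nu phi x)%:C *
          \prod_(xr <- x) ((2%:R * pi%:C * 'i) ^+ xr / (xr`!)%:R)))
  /\ exists q : rat, LHS = ratr q * pi ^+ (2 * d * N).
Proof.
move=> LHS.
have hnu' : perm_eq nu (enum (short_roots r)) by exact: hnu.
have LHSE : LHS = \sum_(a <- sorted_compositions r N)
    (\prod_(j <- multiplicities a) (j`!)%:R)^-1 * zeta_avg R nu (map (muln (2 * d)) a).
  rewrite -sum_EZ_sorted // /LHS.
  have -> : Icomp r N = [set` compositions r N].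
    by apply/seteqP; split => a /=; rewrite compositionsP.
  by rewrite -fsbig_seq ?compositions_uniq.
rewrite -/(rat_pi (2 * d * N) LHS); split.
  rewrite sum_parts // LHSE rmorph_sum mulr_sumr [LHS in LHS = _]big_seq [RHS]big_seq.
  apply: eq_bigr => a; rewrite mem_sorted_compositions => /andP[_ ac].
  rewrite Plong_prod ?(size_dilate _ ac) ?(dilate_gt1 _ ac) ?dilate_even //.
  move: (zeta_avg _ _ _) => z.
  rewrite rmorphM fmorphV rmorph_prod /= (eq_bigr (fun j => (j`!)%:R)) => [|j _]; last by rewrite rmorph_nat.
  rewrite !rmorphM !rmorphXn /= rmorphN1 rmorph_nat mulrCA; congr (_ * _).
  have t0 : (2 : R[i]) ^+ r != 0 by rewrite expf_neq0 // pnatr_eq0.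
  have s2 : (-1) ^+ r * (-1) ^+ r = 1 :> R[i] by rewrite -exprMn mulrNN mulr1 expr1n.
  by rewrite mulrA mulrACA s2 mul1r mulVf ?mul1r.
rewrite LHSE big_seq; apply: (big_ind (rat_pi (2 * d * N))) => [|x y|a].
- exact: rat_pi0.
- exact: rat_piD.
rewrite mem_sorted_compositions => /andP[_ ac].
rewrite -[X in rat_pi X]add0n; apply: rat_piM; last exact: zeta_avg_rat_pi.
rewrite (_ : _^-1 = ratr (\prod_(j <- multiplicities a) (j`!)%:R)^-1); first exact: rat_pi_rat.
by rewrite fmorphV rmorph_prod /=; congr _^-1; apply: eq_bigr => j _; rewrite ratr_nat.
Qed.
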